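(* Let $A,H$ be Hopf algebras forming a bicrossproduct $A\blacktriangleright\!\!\!\triangleleft H$ with left action $\triangleright:H\otimes A\to A$ and right coaction $\beta:H\to H\otimes A$. Let $\Omega(A),\Omega(H)$ be strongly bicovariant exterior algebras such that $\triangleright$ extends to a degree-preserving $\triangleright:\Omega(H)\underline\otimes\Omega(A)\to\Omega(A)$ making $\Omega(A)$ a super left $\Omega(H)$-module algebra, and $\beta$ extends to a degree-preserving super coaction $\beta_*:\Omega(H)\to\Omega(H)\underline\otimes\Omega(A)$, $\beta_*(\eta)=\eta^{(0)}\otimes\eta^{(1)}$, making $\Omega(H)$ a super right $\Omega(A)$-comodule coalgebra, obeying for all $\eta,\xi\in\Omega(H)$, $\omega\in\Omega(A)$: $$d_A(\eta\triangleright\omega)=(d_H\eta)\triangleright\omega+(-1)^{|\eta|}\eta\triangleright(d_A\omega),$$ $$\beta_*(d_H\eta)=d_H\eta^{(0)}\otimes\eta^{(1)}+(-1)^{|\eta^{(0)}|}\eta^{(0)}\otimes d_A\eta^{(1)},$$ $$\epsilon(\eta\triangleright\omega)=\epsilon(\eta)\epsilon(\omega),$$ $$\Delta_*(\eta\triangleright\omega)=(-1)^{(|\eta_{(1)}{}^{(1)}|+|\eta_{(2)}|)|\omega_{(1)}|}\eta_{(1)}{}^{(0)}\triangleright\omega_{(1)}\otimes\eta_{(1)}{}^{(1)}(\eta_{(2)}\triangleright\omega_{(2)}),$$ $$\beta_*(\eta\xi)=(-1)^{(|\eta_{(1)}{}^{(1)}|+|\eta_{(2)}|)|\xi^{(0)}|}\eta_{(1)}{}^{(0)}\xi^{(0)}\otimes\eta_{(1)}{}^{(1)}(\eta_{(2)}\triangleright\xi^{(1)}),$$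 $$(-1)^{|\omega||\eta_{(2)}{}^{(1)}|+|\eta_{(1)}||\eta_{(2)}{}^{(0)}|}\eta_{(2)}{}^{(0)}\otimes(\eta_{(1)}\triangleright\omega)\eta_{(2)}{}^{(1)}=\eta_{(1)}{}^{(0)}\otimes\eta_{(1)}{}^{(1)}(\eta_{(2)}\triangleright\omega).$$ Then $\Omega(A\blacktriangleright\!\!\!\triangleleft H):=\Omega(A)\blacktriangleright\!\!\!\triangleleft\Omega(H)$ (the super bicrossproduct) is a strongly bicovariant exterior algebra on $A\blacktriangleright\!\!\!\triangleleft H$ with differential $$d(\omega\otimes\eta)=d_A\omega\otimes\eta+(-1)^{|\omega|}\omega\otimes d_H\eta$$ for all $\omega\in\Omega(A)$, $\eta\in\Omega(H)$.
   Context: Work over a field $k$. An exterior algebra on an algebra $A$ is a differential graded algebra $\Omega(A)=\oplus_{n\ge0}\Omega^n(A)$ with $\Omega^0=A$, generated by $A$ and $\Omega^1=\mathrm{span}\{a\,db\}$, with $d^2=0$ and graded Leibniz rule. The super tensor product $\underline\otimes$ has product $(a\otimes b)(c\otimes d)=(-1)^{|b||c|}ac\otimes bd$. $\Omega(A)$ on a Hopf algebra $A$ is strongly bicovariant if it is a super-Hopf algebra (grade = form degree mod 2) with coproduct $\Delta_*$ preserving total degree, restricting to $\Delta$ on $A$, and $\Delta_*d\omega=(d\otimes\mathrm{id}+(-1)^{|\ |}\mathrm{id}\otimes d)\Delta_*\omega$, where $(-1)^{|\ |}\omega=(-1)^{|\omega|}\omega$. Sweedler notation is with homogeneous components. Super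 left module algebra: $\eta\triangleright(\omega\tau)=(-1)^{|\eta_{(2)}||\omega|}(\eta_{(1)}\triangleright\omega)(\eta_{(2)}\triangleright\tau)$, $\eta\triangleright1=\epsilon(\eta)1$. Super right comodule coalgebra: $(\Delta_*\otimes\mathrm{id})\beta_*(\eta)=(-1)^{|\eta_{(2)}{}^{(0)}||\eta_{(1)}{}^{(1)}|}\eta_{(1)}{}^{(0)}\otimes\eta_{(2)}{}^{(0)}\otimes\eta_{(1)}{}^{(1)}\eta_{(2)}{}^{(1)}$, with counit condition. Bicrossproduct $A\blacktriangleright\!\!\!\triangleleft H$: $A$ is a left $H$-module algebra by $\triangleright$, $H$ is a right $A$-comodule coalgebra by $\beta(h)=h^{(0)}\otimes h^{(1)}$, compatible (the last four displayed conditions of the claim restricted to degree 0, and $\beta(1)=1\otimes1$), so that $A\otimes H$ with $(a\otimes h)(b\otimes g)=a(h_{(1)}\triangleright b)\otimes h_{(2)}g$ and $\Delta(a\otimes h)=a_{(1)}\otimes h_{(1)}{}^{(0)}\otimes a_{(2)}h_{(1)}{}^{(1)}\otimes h_{(2)}$ is a Hopf algebra. The super bicrossproduct $\Omega(A)\blacktriangleright\!\!\!\triangleleft\Omega(H)$ is $\Omega(A)\otimes\Omega(H)$ with $$(\omega\otimes\eta)(\tau\otimes\xi)=(-1)^{|\eta_{(2)}||\tau|}\omega(\eta_{(1)}\triangleright\tau)\otimes\eta_{(2)}\xi,\qquad\Delta_*(\omega\otimes\eta)=(-1)^{|\omega_{(2)}||\eta_{(1)}{}^{(0)}|}\omega_{(1)}\otimes\eta_{(1)}{}^{(0)}\otimes\omega_{(2)}\eta_{(1)}{}^{(1)}\otimes\eta_{(2)}.$$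 *)

(* Defs.v *)
From HB Require Import structures.
From mathcomp Require Import all_boot all_order all_algebra.
From mathcomp Require Import boolp.

Set Implicit Arguments.
Unset Strict Implicit.
Unset Printing Implicit Defensive.

Import GRing.Theory.
Local Open Scope ring_scope.
Local Open Scope quotient_scope.

Reserved Notation "x ⊗ y" (at level 40, left associativity).

(* The tensor product of two (possibly infinite-dimensional) vector spaces:
   formal finite sums of pure tensors, two of them being identified when no
   bilinear map distinguishes them. *)
Section Tensor.
Variable k : fieldType.

Definition is_bilinear (V W U : lmodType k) (f : V -> W -> U) : Prop :=
  (forall x, linear (f x)) /\ (forall y, linear (f^~ y)).

Variables V W : lmodType k.

Definition tensor_rel (s t : seq (V * W)) : bool :=
  `[< forall (U : lmodType k) (f : V -> W -> U), is_bilinear f ->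
        \sum_(x <- s) f x.1 x.2 = \sum_(x <- t) f x.1 x.2 >].

Lemma tensor_rel_refl : reflexive tensor_rel.
Proof. by move=> s; apply/asboolP. Qed.

Lemma tensor_rel_sym : symmetric tensor_rel.
Proof.
by move=> s t; apply/asboolP/asboolP => h U f bf; rewrite (h U f bf).
Qed.

Lemma tensor_rel_trans : transitive tensor_rel.
Proof.
move=> t s u /asboolP h1 /asboolP h2; apply/asboolP => U f bf.
by rewrite (h1 U f bf) (h2 U f bf).
Qed.

Canonical tensor_equiv :=
  EquivRel tensor_rel tensor_rel_refl tensor_rel_sym tensor_rel_trans.

Definition tensor := {eq_quot tensor_rel}.
HB.instance Definition _ : EqQuotient _ tensor_rel tensor :=
  EqQuotient.on tensor.
HB.instance Definition _ := Choice.on tensor.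

Definition pure (x : V) (y : W) : tensor := \pi_tensor [:: (x, y)].

(* Sweedler-type sums: if t is the sum of the x_i ⊗ y_i, then sw t f is the
   sum of the f x_i y_i. This does not depend on the decomposition of t when
   f is bilinear (lemmas sw_pi, sw_pure and sw_linear). *)
Definition sw (U : lmodType k) (t : tensor) (f : V -> W -> U) : U :=
  \sum_(x <- repr t) f x.1 x.2.

Lemma sw_pi (U : lmodType k) (f : V -> W -> U) s :
  is_bilinear f -> sw (\pi_tensor s) f = \sum_(x <- s) f x.1 x.2.
Proof.
move=> bf; rewrite /sw.
have /eqmodP/asboolP h : repr (\pi_tensor s) = s %[mod tensor] by rewrite reprK.
exact: h.
Qed.

Lemma sw_pure (U : lmodType k) (f : V -> W -> U) x y :
  is_bilinear f -> sw (pure x y) f = f x y.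
Proof. by move=> bf; rewrite sw_pi // big_seq1. Qed.

Lemma tensor_ext (s t : tensor) :
  (forall (U : lmodType k) (f : V -> W -> U), is_bilinear f ->
     sw s f = sw t f) -> s = t.
Proof.
by move=> h; rewrite -[s]reprK -[t]reprK; apply/eqmodP/asboolP.
Qed.

Definition tensor_add (s t : tensor) : tensor := \pi_tensor (repr s ++ repr t).
Definition tensor_scale (c : k) (t : tensor) : tensor :=
  \pi_tensor [seq (c *: x.1, x.2) | x <- repr t].

Let sw_zero_aux (U : lmodType k) (f : V -> W -> U) :
  is_bilinear f -> sw (\pi_tensor [::]) f = 0.
Proof. by move=> bf; rewrite sw_pi // big_nil. Qed.

Let sw_add_aux (U : lmodType k) (f : V -> W -> U) s t :
  is_bilinear f -> sw (tensor_add s t) f = sw s f + sw t f.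
Proof. by move=> bf; rewrite sw_pi // big_cat. Qed.

Let sw_scale_aux (U : lmodType k) (f : V -> W -> U) c t :
  is_bilinear f -> sw (tensor_scale c t) f = c *: sw t f.
Proof.
move=> bf; rewrite sw_pi // big_map scaler_sumr; apply: eq_bigr => x _ /=.
have [_ /(_ x.2) lf] := bf.
have f0 : f 0 x.2 = 0.
  by have := lf (-1) 0 0; rewrite scaler0 addr0 scaleN1r addNr.
by have := lf c x.1 0; rewrite !addr0 f0 addr0.
Qed.

Lemma tensor_addA : associative tensor_add.
Proof.
by move=> x y z; apply: tensor_ext => U f bf; rewrite !sw_add_aux // addrA.
Qed.
Lemma tensor_addC : commutative tensor_add.
Proof.
by move=> x y; apply: tensor_ext => U f bf; rewrite !sw_add_aux // addrC.
Qed.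
Lemma tensor_add0 : left_id (\pi_tensor [::]) tensor_add.
Proof.
move=> x; apply: tensor_ext => U f bf.
by rewrite !sw_add_aux // sw_zero_aux // add0r.
Qed.
Lemma tensor_addN : left_inverse (\pi_tensor [::]) (tensor_scale (-1)) tensor_add.
Proof.
move=> x; apply: tensor_ext => U f bf.
by rewrite !sw_add_aux // sw_scale_aux // sw_zero_aux // scaleN1r addNr.
Qed.

HB.instance Definition _ :=
  GRing.isZmodule.Build tensor tensor_addA tensor_addC tensor_add0 tensor_addN.

Lemma tensor_scaleA a b (t : tensor) :
  tensor_scale a (tensor_scale b t) = tensor_scale (a * b) t.
Proof.
by apply: tensor_ext => U f bf; rewrite !sw_scale_aux // scalerA.
Qed.
Lemma tensor_scale1 : left_id 1 tensor_scale.
Proof.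
by move=> t; apply: tensor_ext => U f bf; rewrite !sw_scale_aux // scale1r.
Qed.
Lemma tensor_scaleDr : right_distributive tensor_scale +%R.
Proof.
move=> c s t; apply: tensor_ext => U f bf.
by rewrite sw_scale_aux // !sw_add_aux // !sw_scale_aux // scalerDr.
Qed.
Lemma tensor_scaleDl (t : tensor) :
  {morph tensor_scale^~ t : a b / a + b >-> a + b}.
Proof.
move=> a b; apply: tensor_ext => U f bf.
by rewrite sw_add_aux // !sw_scale_aux // scalerDl.
Qed.

HB.instance Definition _ := GRing.Zmodule_isLmodule.Build k tensor
  tensor_scaleA tensor_scale1 tensor_scaleDr tensor_scaleDl.

Lemma sw_linear (U : lmodType k) (f : V -> W -> U) :
  is_bilinear f -> linear (fun t : tensor => sw t f).
Proof.
move=> bf c s t.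
have -> : c *: s + t = tensor_add (tensor_scale c s) t by [].
by rewrite sw_add_aux // sw_scale_aux.
Qed.

Lemma pure_bilinear : is_bilinear pure.
Proof.
split=> [x c y y'|y c x x']; apply: tensor_ext => U f bf.
  by rewrite (sw_linear bf) !sw_pure //; case: bf => /(_ x) lf _; rewrite lf.
by rewrite (sw_linear bf) !sw_pure //; case: bf => _ /(_ y) lf; rewrite lf.
Qed.

End Tensor.

Arguments tensor {k} V W.
Arguments pure {k V W} x y.
Arguments sw {k V W U} t f.
Notation "x ⊗ y" := (pure x y) : ring_scope.

Section Graded.
Variable k : fieldType.

(* A direct sum decomposition of V indexed by the natural numbers, given by
   its projections: the summand of index n is the image of p n. *)
Record is_grading (V : lmodType k) (p : nat -> V -> V) : Prop := IsGrading {
  grading_linear : forall n, linear (p n);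
  grading_orth : forall m n x, p m (p n x) = if m == n then p n x else 0;
  grading_sum : forall x, exists N : nat, x = \sum_(n < N) p n x }.

Structure gmodType := GMod {
  gmod_sort :> lmodType k;
  hcomp : nat -> gmod_sort -> gmod_sort;
  hcomp_grading : is_grading hcomp }.

Definition homog (V : gmodType) (n : nat) (x : V) : Prop := hcomp n x = x.

Definition degbound (V : gmodType) (x : V) : nat :=
  projT1 (cid (grading_sum (hcomp_grading V) x)).

Lemma degboundE (V : gmodType) (x : V) :
  x = \sum_(n < degbound x) hcomp n x.
Proof. by rewrite /degbound; case: cid. Qed.

Definition tensor_hcomp (V W : gmodType) (n : nat) (t : tensor V W) :
    tensor V W :=
  sw t (fun x y => \sum_(i < n.+1) hcomp i x ⊗ hcomp (n - i)%N y).

End Graded.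

Section TensorGrading.
Variables (k : fieldType) (V W : gmodType k).
Local Notation T := (tensor V W).

Let linfun_sum (U U' : lmodType k) (g : U -> U') (lg : linear g)
    I (r : seq I) (F : I -> U) :
  g (\sum_(i <- r) F i) = \sum_(i <- r) g (F i).
Proof.
pose gM := GRing.isLinear.Build k U U' *:%R g lg.
pose G : {linear U -> U'} := HB.pack g gM.
exact: (linear_sum G).
Qed.

Let lin0 (U U' : lmodType k) (g : U -> U') : linear g -> g 0 = 0.
Proof. by move=> /(_ (-1) 0 0); rewrite scaler0 addr0 scaleN1r addNr. Qed.

Let compL (U : gmodType k) n : linear (@hcomp k U n).
Proof. exact: grading_linear (hcomp_grading U) n. Qed.

Let compC (U : gmodType k) m n (x : U) :
  hcomp m (hcomp n x) = if m == n then hcomp n x else 0.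
Proof. exact: grading_orth (hcomp_grading U) m n x. Qed.

Let pureL (x : V) : linear (fun y : W => x ⊗ y).
Proof. by case: (pure_bilinear V W). Qed.
Let pureR (y : W) : linear (fun x : V => x ⊗ y).
Proof. by case: (pure_bilinear V W). Qed.

Lemma tensor_sum_pure (t : T) : t = \sum_(x <- repr t) x.1 ⊗ x.2.
Proof.
apply: tensor_ext => U f bf; rewrite (linfun_sum (sw_linear bf)).
by apply: eq_bigr => x _; rewrite sw_pure.
Qed.

Lemma tensor_hcomp_bilinear n : is_bilinear
  (fun (x : V) (y : W) => \sum_(i < n.+1) hcomp i x ⊗ hcomp (n - i)%N y).
Proof.
split=> [x c y y'|y c x x']; rewrite scaler_sumr -big_split /=;
  by apply: eq_bigr => i _; rewrite (compL _) ?(pureL _) ?(pureR _).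
Qed.

Let tcompL n : linear (@tensor_hcomp k V W n).
Proof. exact: sw_linear (tensor_hcomp_bilinear n). Qed.

Let tcomp_pure n i j (x : V) (y : W) :
  tensor_hcomp n (hcomp i x ⊗ hcomp j y) =
  if n == (i + j)%N then hcomp i x ⊗ hcomp j y else 0.
Proof.
rewrite /tensor_hcomp sw_pure; last exact: tensor_hcomp_bilinear.
have F (l : 'I_n.+1) : (l : nat) != i ->
    hcomp l (hcomp i x) ⊗ hcomp (n - l)%N (hcomp j y) = 0.
  by move=> /negPf li; rewrite compC li (lin0 (pureR _)).
have [ij|ij] := ltnP i n.+1.
  rewrite (bigD1 (Ordinal ij)) //= big1 ?addr0; last first.
    by move=> l li; apply: F; apply: contraNneq li => li; apply/eqP/val_inj.
  rewrite !compC eqxx.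
  have -> : ((n - i)%N == j) = (n == (i + j)%N).
    by apply/eqP/eqP => [<-|->]; rewrite ?subnKC // addKn.
  by case: ifP => // _; rewrite (lin0 (pureL _)).
rewrite big1 => [|l _].
  by case: eqP ij => // ->; rewrite ltnNge leq_addr.
by apply: F; rewrite neq_ltn (leq_trans (ltn_ord l)).
Qed.

Let tcomp_dbl (t : T) : exists (I : Type) (r : seq I) (d e : I -> nat)
    (x : I -> V) (y : I -> W),
  t = \sum_(i <- r) hcomp (d i) (x i) ⊗ hcomp (e i) (y i).
Proof.
exists (V * W * (nat * nat))%type.
exists (flatten [seq [seq (z, (i, j)) | i <- iota 0 (degbound z.1),
   j <- iota 0 (degbound z.2)] | z <- repr t]).
exists (fun u => u.2.1), (fun u => u.2.2), (fun u => u.1.1), (fun u => u.1.2).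
rewrite {1}[t]tensor_sum_pure big_flatten big_map; apply: eq_bigr => z _.
rewrite big_allpairs_dep {1}[z.1]degboundE (linfun_sum (pureR _)).
rewrite -(big_mkord xpredT (fun i => hcomp i z.1 ⊗ z.2)) /index_iota subn0.
transitivity (\sum_(i <- iota 0 (degbound z.1)) \sum_(j <- iota 0 (degbound z.2))
  hcomp i z.1 ⊗ hcomp j z.2); last by [].
apply: eq_bigr => i _; rewrite {1}[z.2]degboundE (linfun_sum (pureL _)).
rewrite -(big_mkord xpredT (fun j => hcomp i z.1 ⊗ hcomp j z.2)).
by rewrite /index_iota subn0.
Qed.

Lemma tensor_grading : is_grading (@tensor_hcomp k V W).
Proof.
split=> [n|m n t|t]; first exact: tcompL.
  have [I [r [d [e [x [y ->]]]]]] := tcomp_dbl t.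
  rewrite (linfun_sum (tcompL n)) (linfun_sum (tcompL m)).
  have E i : tensor_hcomp m (tensor_hcomp n (hcomp (d i) (x i) ⊗ hcomp (e i) (y i)))
      = if m == n then tensor_hcomp n (hcomp (d i) (x i) ⊗ hcomp (e i) (y i)) else 0.
    rewrite tcomp_pure; case: eqP => [E|_].
      by rewrite tcomp_pure -E.
    by rewrite (lin0 (tcompL _)) if_same.
  by under eq_bigr do rewrite E; case: eqP => // _; rewrite big1.
have [I [r [d [e [x [y ->]]]]]] := tcomp_dbl t.
exists (\max_(i <- r) (d i + e i).+1)%N.
under [RHS]eq_bigr do rewrite (linfun_sum (tcompL _)).
rewrite exchange_big /=.
have [M defM] : {M | M = \max_(i <- r) (d i + e i).+1}%N by eexists.
rewrite -defM; have {defM} := eq_leq (esym defM).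
elim: r => [|i r IH]; first by rewrite !big_nil.
rewrite !big_cons geq_max => /andP[lM /IH ->]; congr (_ + _).
rewrite (bigD1 (Ordinal lM)) //= tcomp_pure eqxx big1 ?addr0 // => l ll.
by rewrite tcomp_pure; case: eqP => // E; case/eqP: ll; apply: val_inj.
Qed.

Canonical gtensor : gmodType k := GMod tensor_grading.

(* Sweedler-type sums over homogeneous components: for t the sum of the
   x_i ⊗ y_i, the sum of the f (deg x) x (deg y) y, where x and y range over
   the homogeneous components of x_i and y_i. *)
Definition gsw (U : lmodType k) (t : tensor V W)
    (f : nat -> V -> nat -> W -> U) : U :=
  sw t (fun x y => \sum_(i < degbound x) \sum_(j < degbound y)
                      f i (hcomp i x) j (hcomp j y)).

Let degbound_over (U : gmodType k) (x : U) n :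
  (degbound x <= n)%N -> hcomp n x = 0.
Proof.
move=> le_n; rewrite [x]degboundE (linfun_sum (@compL U n)) big1 // => i _.
by rewrite compC gtn_eqF // (leq_trans (ltn_ord i)).
Qed.

Let degsum_widen (U : gmodType k) (U' : lmodType k) (g : nat -> U -> U')
    (x : U) N :
  (forall i, linear (g i)) -> (degbound x <= N)%N ->
  \sum_(i < degbound x) g i (hcomp i x) = \sum_(i < N) g i (hcomp i x).
Proof.
move=> lg leN; rewrite (big_ord_widen N (fun n => g n (hcomp n x)) leN).
rewrite big_mkcond; apply: eq_bigr => n _; case: ifPn => //.
by rewrite -leqNgt => le_n; rewrite degbound_over // (lin0 (lg n)).
Qed.

Let degsum_linear (U : gmodType k) (U' : lmodType k) (g : nat -> U -> U') :
  (forall i, linear (g i)) ->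
  linear (fun x : U => \sum_(i < degbound x) g i (hcomp i x)).
Proof.
move=> lg c x y.
pose N := maxn (degbound (c *: x + y)) (maxn (degbound x) (degbound y)).
rewrite !(@degsum_widen _ _ g _ N) ?leq_max ?leqnn ?orbT //.
rewrite scaler_sumr -big_split; apply: eq_bigr => i _ /=.
by rewrite (@compL U i) (lg i).
Qed.

Let degsum_homog (U : gmodType k) (U' : lmodType k) (g : nat -> U -> U') p
    (x : U) :
  (forall i, linear (g i)) -> homog p x ->
  \sum_(i < degbound x) g i (hcomp i x) = g p x.
Proof.
move=> lg hx; pose N := maxn (degbound x) p.+1.
rewrite (@degsum_widen _ _ g _ N) ?leq_max ?leqnn //.
have pN : (p < N)%N by rewrite leq_max leqnn orbT.
rewrite (bigD1 (Ordinal pN)) //= hx big1 ?addr0 // => i ip.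
rewrite -hx compC; case: eqP => [E|_]; last by rewrite (lin0 (lg i)).
by case/eqP: ip; apply: val_inj.
Qed.

Let gsw_bilinear (U : lmodType k) (f : nat -> V -> nat -> W -> U) :
  (forall i j, is_bilinear (fun x y => f i x j y)) ->
  is_bilinear (fun x y => \sum_(i < degbound x) \sum_(j < degbound y)
                             f i (hcomp i x) j (hcomp j y)).
Proof.
move=> bf; split=> [x c y y'|y].
  rewrite scaler_sumr -big_split; apply: eq_bigr => i _ /=.
  have lg j : linear (fun y => f i (hcomp i x) j y) by case: (bf i j).
  exact: (degsum_linear lg).
have lg i : linear (fun x => \sum_(j < degbound y) f i x j (hcomp j y)).
  move=> c x x'; rewrite scaler_sumr -big_split; apply: eq_bigr => j _ /=.
  by case: (bf i j) => _ /(_ (hcomp j y)) ->.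
exact: (degsum_linear lg).
Qed.

Lemma gsw_linear (U : lmodType k) (f : nat -> V -> nat -> W -> U) :
  (forall i j, is_bilinear (fun x y => f i x j y)) ->
  linear (fun t : T => gsw t f).
Proof. by move=> bf; apply: sw_linear; apply: gsw_bilinear. Qed.

Lemma gsw_homog (U : lmodType k) (f : nat -> V -> nat -> W -> U) p q x y :
  (forall i j, is_bilinear (fun x y => f i x j y)) ->
  homog p x -> homog q y -> gsw (x ⊗ y) f = f p x q y.
Proof.
move=> bf hx hy; rewrite /gsw sw_pure; last exact: gsw_bilinear.
under eq_bigr => i _.
  have lg j : linear (fun y => f i (hcomp i x) j y) by case: (bf i j).
  rewrite (degsum_homog lg hy); over.
have lg i : linear (fun x => f i x q y) by case: (bf i q) => _ /(_ y).
exact: (degsum_homog lg hx).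
Qed.

End TensorGrading.

Arguments gsw {k V W U} t f.

Section Ungraded.
Variable k : fieldType.

Record alg_str (V : lmodType k) := AlgStr {
  amul : V -> V -> V;
  aone : V }.

Record coalg_str (V : lmodType k) := CoalgStr {
  cop : V -> tensor V V;
  cou : V -> k }.

Record hopf_str (V : lmodType k) := HopfStr {
  hopf_alg :> alg_str V;
  hopf_coalg :> coalg_str V }.

Definition algebra (V : lmodType k) (A : alg_str V) : Prop :=
  [/\ is_bilinear (amul A), associative (amul A),
      left_id (aone A) (amul A) & right_id (aone A) (amul A)].

Definition coalgebra (V : lmodType k) (C : coalg_str V) : Prop :=
  [/\ linear (cop C), scalar (cou C),
      forall x, sw (cop C x) (fun a b => sw (cop C a)
                  (fun a1 a2 => a1 ⊗ (a2 ⊗ b)))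
              = sw (cop C x) (fun a b => a ⊗ cop C b),
      forall x, sw (cop C x) (fun a b => cou C a *: b) = x
    & forall x, sw (cop C x) (fun a b => cou C b *: a) = x].

Definition antipode (V : lmodType k) (H : hopf_str V) (S : V -> V) : Prop :=
  [/\ linear S,
      forall x, sw (cop H x) (fun a b => amul H (S a) b) = cou H x *: aone H
    & forall x, sw (cop H x) (fun a b => amul H a (S b)) = cou H x *: aone H].

Definition tensor_mul (V W : lmodType k) (A : alg_str V) (B : alg_str W)
    (s t : tensor V W) : tensor V W :=
  sw s (fun a b => sw t (fun c d => amul A a c ⊗ amul B b d)).

Record hopf_algebra (V : lmodType k) (H : hopf_str V) : Prop := HopfAlgebra {
  hopf_algebra_alg : algebra H;
  hopf_algebra_coalg : coalgebra H;
  hopf_algebra_copM : forall x y,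
    cop H (amul H x y) = tensor_mul H H (cop H x) (cop H y);
  hopf_algebra_cop1 : cop H (aone H) = aone H ⊗ aone H;
  hopf_algebra_couM : forall x y, cou H (amul H x y) = cou H x * cou H y;
  hopf_algebra_cou1 : cou H (aone H) = 1;
  hopf_algebra_antipode : exists S : V -> V, antipode H S }.

Definition left_module (H A : lmodType k) (sH : alg_str H)
    (act : H -> A -> A) : Prop :=
  [/\ is_bilinear act, forall a, act (aone sH) a = a
    & forall h g a, act (amul sH h g) a = act h (act g a)].

Definition module_algebra (H A : lmodType k) (sH : hopf_str H)
    (sA : alg_str A) (act : H -> A -> A) : Prop :=
  [/\ left_module sH act,
      forall h a b, act h (amul sA a b) =
        sw (cop sH h) (fun h1 h2 => amul sA (act h1 a) (act h2 b))
    & forall h, act h (aone sA) = cou sH h *: aone sA].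

Definition right_comodule (H A : lmodType k) (sA : coalg_str A)
    (beta : H -> tensor H A) : Prop :=
  [/\ linear beta,
      forall h, sw (beta h) (fun h0 h1 => sw (beta h0)
                  (fun h00 h01 => h00 ⊗ (h01 ⊗ h1)))
              = sw (beta h) (fun h0 h1 => h0 ⊗ cop sA h1)
    & forall h, sw (beta h) (fun h0 h1 => cou sA h1 *: h0) = h].

Definition comodule_coalgebra (H A : lmodType k) (sH : coalg_str H)
    (sA : hopf_str A) (beta : H -> tensor H A) : Prop :=
  [/\ right_comodule sA beta,
      forall h,
        sw (beta h) (fun h0 h1 => sw (cop sH h0)
          (fun h01 h02 => h01 ⊗ (h02 ⊗ h1)))
        = sw (cop sH h) (fun h1 h2 => sw (beta h1) (fun h10 h11 =>
            sw (beta h2) (fun h20 h21 => h10 ⊗ (h20 ⊗ amul sA h11 h21))))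
    & forall h, sw (beta h) (fun h0 h1 => cou sH h0 *: h1)
              = cou sH h *: aone sA].

Record bicrossproduct (A H : lmodType k) (sA : hopf_str A) (sH : hopf_str H)
    (act : H -> A -> A) (beta : H -> tensor H A) : Prop := Bicrossproduct {
  bicross_module : module_algebra sH sA act;
  bicross_comodule : comodule_coalgebra sH sA beta;
  bicross_cou_act : forall h a, cou sA (act h a) = cou sH h * cou sA a;
  bicross_cop_act : forall h a,
    cop sA (act h a) =
    sw (cop sH h) (fun h1 h2 => sw (beta h1) (fun h10 h11 =>
      sw (cop sA a) (fun a1 a2 => act h10 a1 ⊗ amul sA h11 (act h2 a2))));
  bicross_beta1 : beta (aone sH) = aone sH ⊗ aone sA;
  bicross_betaM : forall h g,
    beta (amul sH h g) =
    sw (cop sH h) (fun h1 h2 => sw (beta h1) (fun h10 h11 =>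
      sw (beta g) (fun g0 g1 => amul sH h10 g0 ⊗ amul sA h11 (act h2 g1))));
  bicross_match : forall h a,
    sw (cop sH h) (fun h1 h2 => sw (beta h2) (fun h20 h21 =>
      h20 ⊗ amul sA (act h1 a) h21))
    = sw (cop sH h) (fun h1 h2 => sw (beta h1) (fun h10 h11 =>
      h10 ⊗ amul sA h11 (act h2 a))) }.

Definition bicross_str (A H : lmodType k) (sA : hopf_str A) (sH : hopf_str H)
    (act : H -> A -> A) (beta : H -> tensor H A) : hopf_str (tensor A H) :=
  HopfStr
    (AlgStr
      (fun s t => sw s (fun a h => sw t (fun b g => sw (cop sH h)
         (fun h1 h2 => amul sA a (act h1 b) ⊗ amul sH h2 g))))
      (aone sA ⊗ aone sH))
    (CoalgStr
      (fun t => sw t (fun a h => sw (cop sA a) (fun a1 a2 =>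
         sw (cop sH h) (fun h1 h2 => sw (beta h1) (fun h10 h11 =>
           (a1 ⊗ h10) ⊗ (amul sA a2 h11 ⊗ h2))))))
      (fun t => sw (U := k^o) t (fun a h => cou sA a * cou sH h))).

End Ungraded.

Section Super.
Variable k : fieldType.

Definition has_parity (V : gmodType k) (p : bool) (x : V) : Prop :=
  forall n, odd n != p -> hcomp n x = 0.

(* Koszul signs are given by the degrees of homogeneous components. *)
Definition super_tensor_mul (V W : gmodType k) (A : alg_str V) (B : alg_str W)
    (s t : tensor V W) : tensor V W :=
  gsw s (fun _ a j b => gsw t (fun p c _ d =>
    (-1) ^+ (j * p)%N *: (amul A a c ⊗ amul B b d))).

(* Hopf algebra in super vector spaces: the structure maps are even. *)
Record super_hopf_algebra (V : gmodType k) (H : hopf_str V) : Prop :=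
  SuperHopfAlgebra {
  super_hopf_alg : algebra H;
  super_hopf_coalg : coalgebra H;
  super_hopf_mul_even : forall p q x y,
    has_parity p x -> has_parity q y -> has_parity (p (+) q) (amul H x y);
  super_hopf_one_even : has_parity false (aone H);
  super_hopf_cop_even : forall p x,
    has_parity p x -> has_parity (V := gtensor V V) p (cop H x);
  super_hopf_cou_even : forall x, has_parity true x -> cou H x = 0;
  super_hopf_copM : forall x y,
    cop H (amul H x y) = super_tensor_mul H H (cop H x) (cop H y);
  super_hopf_cop1 : cop H (aone H) = aone H ⊗ aone H;
  super_hopf_couM : forall x y, cou H (amul H x y) = cou H x * cou H y;
  super_hopf_cou1 : cou H (aone H) = 1;
  super_hopf_antipode : exists S : V -> V,
    antipode H S /\ forall p x, has_parity p x -> has_parity p (S x) }.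

Record dg_algebra (V : gmodType k) (A : alg_str V) (d : V -> V) : Prop :=
  DGAlgebra {
  dga_alg : algebra A;
  dga_one : homog 0 (aone A);
  dga_mul : forall i j x y,
    homog i x -> homog j y -> homog (i + j)%N (amul A x y);
  dga_linear : linear d;
  dga_degree : forall i x, homog i x -> homog i.+1 (d x);
  dga_square : forall x, d (d x) = 0;
  dga_leibniz : forall i x y, homog i x ->
    d (amul A x y) = amul A (d x) y + (-1) ^+ i *: amul A x (d y) }.

(* einc : A -> O is the identification of A with the degree 0 part of O. *)
Record exterior_algebra (A : lmodType k) (sA : alg_str A) (O : gmodType k)
    (sO : alg_str O) (einc : A -> O) (d : O -> O) : Prop := ExteriorAlgebra {
  ext_dga : dg_algebra sO d;
  ext_inc_linear : linear einc;
  ext_inc_inj : injective einc;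
  ext_inc1 : einc (aone sA) = aone sO;
  ext_incM : forall a b, einc (amul sA a b) = amul sO (einc a) (einc b);
  ext_deg0 : forall w, homog 0 w <-> exists a, w = einc a;
  ext_deg1 : forall w, homog 1 w <-> exists s : seq (A * A),
    w = \sum_(x <- s) amul sO (einc x.1) (d (einc x.2));
  ext_generated : forall P : O -> Prop,
    P (aone sO) ->
    (forall c x y, P x -> P y -> P (c *: x + y)) ->
    (forall x y, P x -> P y -> P (amul sO x y)) ->
    (forall x, homog 0 x \/ homog 1 x -> P x) ->
    forall x, P x }.

Record ext_str (A : lmodType k) (O : gmodType k) := ExtStr {
  ext_hopf :> hopf_str O;
  einc : A -> O;
  ediff : O -> O }.

Record strongly_bicovariant (A : lmodType k) (sA : hopf_str A)
    (O : gmodType k) (E : ext_str A O) : Prop := StronglyBicovariant {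
  sbc_hopf : hopf_algebra sA;
  sbc_ext : exterior_algebra sA E (einc E) (ediff E);
  sbc_super : super_hopf_algebra E;
  sbc_degree : forall n w, homog n w -> homog (V := gtensor O O) n (cop E w);
  sbc_restrict : forall a,
    cop E (einc E a) = sw (cop sA a) (fun a1 a2 => einc E a1 ⊗ einc E a2);
  sbc_diff : forall w, cop E (ediff E w) =
    gsw (cop E w) (fun i w1 _ w2 =>
      ediff E w1 ⊗ w2 + (-1) ^+ i *: (w1 ⊗ ediff E w2)) }.

(* That the action (resp. the coaction below) is even is not part of these
   conditions; it follows from preservation of degrees, stated separately. *)
Definition super_module_algebra (H A : gmodType k) (sH : hopf_str H)
    (sA : alg_str A) (act : H -> A -> A) : Prop :=
  [/\ left_module sH act,
      forall p x a b, homog p a -> act x (amul sA a b) =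
        gsw (cop sH x) (fun _ x1 j x2 =>
          (-1) ^+ (j * p)%N *: amul sA (act x1 a) (act x2 b))
    & forall x, act x (aone sA) = cou sH x *: aone sA].

Definition super_comodule_coalgebra (H A : gmodType k) (sH : coalg_str H)
    (sA : hopf_str A) (beta : H -> tensor H A) : Prop :=
  [/\ right_comodule sA beta,
      forall x,
        sw (beta x) (fun x0 x1 => sw (cop sH x0)
          (fun x01 x02 => x01 ⊗ (x02 ⊗ x1)))
        = sw (cop sH x) (fun x1 x2 =>
            gsw (beta x1) (fun _ x10 i11 x11 =>
            gsw (beta x2) (fun i20 x20 _ x21 =>
              (-1) ^+ (i20 * i11)%N *: (x10 ⊗ (x20 ⊗ amul sA x11 x21)))))
    & forall x, sw (beta x) (fun x0 x1 => cou sH x0 *: x1)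
              = cou sH x *: aone sA].

Definition super_bicross_str (OA OH : gmodType k) (sA : hopf_str OA)
    (sH : hopf_str OH) (act : OH -> OA -> OA) (beta : OH -> tensor OH OA) :
    hopf_str (gtensor OA OH) :=
  HopfStr
    (AlgStr (V := gtensor OA OH)
      (fun s t => sw s (fun w x => gsw t (fun p v _ y =>
         gsw (cop sH x) (fun _ x1 j x2 =>
           (-1) ^+ (j * p)%N *: (amul sA w (act x1 v) ⊗ amul sH x2 y)))))
      (aone sA ⊗ aone sH))
    (CoalgStr (V := gtensor OA OH)
      (fun t => sw t (fun w x => gsw (cop sA w) (fun _ w1 j w2 =>
         sw (cop sH x) (fun x1 x2 => gsw (beta x1) (fun i x10 _ x11 =>
           (-1) ^+ (j * i)%N *: ((w1 ⊗ x10) ⊗ (amul sA w2 x11 ⊗ x2)))))))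
      (fun t => sw (U := k^o) t (fun w x => cou sA w * cou sH x))).

Definition super_bicross (A H : lmodType k) (OA OH : gmodType k)
    (EA : ext_str A OA) (EH : ext_str H OH)
    (act : OH -> OA -> OA) (beta : OH -> tensor OH OA) :
    ext_str (tensor A H) (gtensor OA OH) :=
  ExtStr (super_bicross_str EA EH act beta)
    (fun t => sw t (fun a h => einc EA a ⊗ einc EH h))
    (fun t => gsw t (fun i w _ x =>
       ediff EA w ⊗ x + (-1) ^+ i *: (w ⊗ ediff EH x))).

End Super.

(* Main.v *)
Require Import Defs.
From mathcomp Require Import all_boot all_order all_algebra.
From mathcomp Require Import boolp ring.
Set Implicit Arguments.
Unset Strict Implicit.
Unset Printing Implicit Defensive.
Import GRing.Theory.
Local Open Scope ring_scope.

(** Why the theorem holds. Write R(x,v) = (-1)^{|x2||v|} x1 ▷ v ⊗ x2 for the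
    exchange of x past v, and Q(w,x) = (-1)^{|w||x^(0)|} x^(0) ⊗ w x^(1) for the
    exchange of w past x. The product and the coproduct of the super
    bicrossproduct are (m ⊗ m)(id ⊗ R ⊗ id) and (id ⊗ Q ⊗ id)(Δ ⊗ Δ); all Koszul
    signs are absorbed in R and Q ([super_bicross_strE]).

    Associativity then only asks that R be compatible with the two products
    ([fact_algebra]), coassociativity that Q be compatible with the two
    coproducts ([fact_coalgebra]). The former is the module algebra condition
    together with the super multiplicativity of Δ on Ω(H) ([super_RMl],
    [super_RMr]); the latter is the comodule coalgebra condition together with
    the super multiplicativity of Δ on Ω(A) ([super_Qcop_l], [super_Qcop_r]).

    For the multiplicativity of Δ, every element is a sum of products
    (w ⊗ 1)(1 ⊗ x) and the super tensor square of an associative graded algebra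
    is associative ([super_tensor_mulA]), so it is enough to treat products of
    two generators. The products of two elements 1 ⊗ x give the formula for
    β(xy) ([cop_right_right]); the products (1 ⊗ x)(v ⊗ 1) = R(x,v) combine the
    formula for Δ(x ▷ v) with the last compatibility condition, which says that
    QR(x,v) is the unsigned sum of the x1^(0) ⊗ x1^(1) (x2 ▷ v)
    ([cop_right_left]).

    For the antipode, the identity is the convolution product of the two maps
    w ⊗ x |-> ε(x) w ⊗ 1 and w ⊗ x |-> ε(w) 1 ⊗ x ([conv_left_right]), and each
    of them has a convolution inverse built from the antipode of one factor
    ([fact_antipodeP]).

    The ordinary bicrossproduct is the case in which everything sits in degree
    0, so the same argument shows that it is a Hopf algebra
    ([bicross_hopf_algebra]).

    The differential of the tensor product commutes with R and Q ([super_R_d],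
    [super_Q_d]). As it is a derivation for the products and a coderivation for
    the coproducts of the two factors, it is one for the composites that define
    the product and the coproduct of the bicrossproduct ([super_leibniz],
    [super_cop_d]). Finally, generation in degrees 0 and 1 follows from that of
    the two factors, because (w ⊗ 1)(1 ⊗ x) = w ⊗ x ([tensor_deg1],
    [tensor_generated]). *)

(** * Linear maps and Sweedler sums *)
Section LinearMaps.
Variables (k : fieldType).
Implicit Types U V W : lmodType k.

Lemma lin0 V U (f : V -> U) : linear f -> f 0 = 0.
Proof. by move=> /(_ (-1) 0 0); rewrite scaler0 addr0 scaleN1r addNr. Qed.

Lemma linZ V U (f : V -> U) c x : linear f -> f (c *: x) = c *: f x.
Proof. by move=> lf; rewrite -[c *: x]addr0 lf (lin0 lf) addr0. Qed.

Lemma linD V U (f : V -> U) x y : linear f -> f (x + y) = f x + f y.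
Proof. by move=> lf; rewrite -[x]scale1r lf !scale1r. Qed.

Lemma lin_sum V U (f : V -> U) I (r : seq I) (F : I -> V) :
  linear f -> f (\sum_(i <- r) F i) = \sum_(i <- r) f (F i).
Proof.
move=> lf; elim: r => [|i r IH]; first by rewrite !big_nil lin0.
by rewrite !big_cons linD // IH.
Qed.

Lemma lin_comp V W U (f : W -> U) (g : V -> W) :
  linear f -> linear g -> linear (fun x => f (g x)).
Proof. by move=> lf lg c x y; rewrite lg lf. Qed.

Lemma lin_scale V U c (f : V -> U) : linear f -> linear (fun x => c *: f x).
Proof. by move=> lf a x y; rewrite lf scalerDr !scalerA mulrC. Qed.

Lemma lin_scalel V U (f : V -> k) (u : U) :
  scalar f -> linear (fun x => f x *: u).
Proof. by move=> lf a x y; rewrite lf scalerDl scalerA. Qed.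

Lemma lin_add V U (f g : V -> U) :
  linear f -> linear g -> linear (fun x => f x + g x).
Proof. by move=> lf lg a x y; rewrite lf lg scalerDr addrACA. Qed.

Lemma lin_bigsum V U I (r : seq I) (f : I -> V -> U) :
  (forall i, linear (f i)) -> linear (fun x => \sum_(i <- r) f i x).
Proof.
move=> lf a x y; rewrite scaler_sumr -big_split /=.
by apply: eq_bigr => i _; rewrite lf.
Qed.

Lemma lin_id V : linear (fun x : V => x).
Proof. by []. Qed.

Lemma bil_l V W U (f : V -> W -> U) : is_bilinear f -> forall y, linear (f^~ y).
Proof. by case. Qed.

Lemma bil_r V W U (f : V -> W -> U) : is_bilinear f -> forall x, linear (f x).
Proof. by case. Qed.

(** The sums [sw t f] are handled as in Sweedler notation: one rewrites under
    them ([eq_sw]), exchanges them ([sw_exchange]), composes them ([sw_bind]) and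
    moves linear maps across them ([lin_sw]). Bilinearity of the summand is
    needed only to evaluate a sum on a tensor that is itself pure ([sw_pure]) or
    a sum ([sw_bind]). *)
Lemma eq_sw V W U (t : tensor V W) (f g : V -> W -> U) :
  (forall x y, f x y = g x y) -> sw t f = sw t g.
Proof. by move=> fg; apply: eq_bigr => u _. Qed.


Lemma sw_lin_in V W U U' (t : tensor V W) (F : U' -> V -> W -> U) :
  (forall x y, linear (fun u => F u x y)) -> linear (fun u => sw t (F u)).
Proof. by move=> lF; apply: lin_bigsum => u; apply: lF. Qed.

Lemma lin_sw V W U U' (L : U -> U') (t : tensor V W) f :
  linear L -> L (sw t f) = sw t (fun x y => L (f x y)).
Proof. exact: lin_sum. Qed.

Lemma sw_exchange V W V' W' U (s : tensor V W) (t : tensor V' W')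
    (F : V -> W -> V' -> W' -> U) :
  sw s (fun a b => sw t (F a b)) =
  sw t (fun c d => sw s (fun a b => F a b c d)).
Proof. exact: exchange_big. Qed.

Lemma sw_bind V W V' W' U (t : tensor V W) (f : V -> W -> tensor V' W')
    (g : V' -> W' -> U) :
  is_bilinear g -> sw (sw t f) g = sw t (fun a b => sw (f a b) g).
Proof. by move=> bg; rewrite (lin_sum _ _ (sw_linear bg)). Qed.

Lemma sw_id V W (t : tensor V W) : sw t pure = t.
Proof.
apply: tensor_ext => U f bf; rewrite sw_bind //.
by apply: eq_bigr => u _; rewrite sw_pure.
Qed.

Lemma tensor_lin_ext V W U (f g : tensor V W -> U) :
  linear f -> linear g -> (forall x y, f (x ⊗ y) = g (x ⊗ y)) ->
  forall t, f t = g t.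
Proof.
move=> lf lg fg t; rewrite -[t]sw_id (lin_sw _ _ lf) (lin_sw _ _ lg).
exact: eq_sw.
Qed.

Definition is_trilinear V W V' U (f : V -> W -> V' -> U) : Prop :=
  [/\ forall y z, linear (fun x => f x y z), forall x z, linear (fun y => f x y z)
    & forall x y, linear (f x y)].

(** Identities between triple tensors, such as coassociativity, are used in the
    form obtained by applying [sw3 f]: they then hold for every trilinear
    expression of the three components. *)
Definition sw3 V W V' U (f : V -> W -> V' -> U) (t : tensor V (tensor W V')) : U :=
  sw t (fun x yz => sw yz (f x)).

Lemma trilinear_sw V W V' U (f : V -> W -> V' -> U) :
  is_trilinear f -> is_bilinear (fun x yz => sw yz (f x)).
Proof.
case=> [f1 f2 f3]; split=> ?; last by apply: sw_lin_in => ? ?; apply: f1.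
by apply: sw_linear; split=> ?; [apply: f3 | apply: f2].
Qed.

Lemma sw3_linear V W V' U (f : V -> W -> V' -> U) :
  is_trilinear f -> linear (sw3 f).
Proof. by move=> tf; apply: sw_linear; apply: trilinear_sw. Qed.

Lemma sw3_pure V W V' U (f : V -> W -> V' -> U) x t :
  is_trilinear f -> sw3 f (x ⊗ t) = sw t (f x).
Proof. by move=> tf; rewrite /sw3 sw_pure //; apply: trilinear_sw. Qed.

Lemma sw3_pure3 V W V' U (f : V -> W -> V' -> U) x y z :
  is_trilinear f -> sw3 f (x ⊗ (y ⊗ z)) = f x y z.
Proof.
move=> tf; rewrite sw3_pure // sw_pure //.
by case: tf => [f1 f2 f3]; split=> ?; [apply: f3 | apply: f2].
Qed.

End LinearMaps.

(** * Sweedler sums over homogeneous components *)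
Section GradedTools.
Variable k : fieldType.
Implicit Types (V W : gmodType k) (U : lmodType k).

(** The degrees are parameters independent of the vectors: a Koszul sign in
    these degrees is then a constant with respect to linearity, and signed
    expressions are multilinear on the nose. *)
Definition graded_trilinear V W (X : gmodType k) U
    (F : nat -> V -> nat -> W -> nat -> X -> U) : Prop :=
  forall i j l, is_trilinear (fun x y z => F i x j y l z).

Definition graded_quadrilinear V W (X Y : gmodType k) U
    (F : nat -> V -> nat -> W -> nat -> X -> nat -> Y -> U) : Prop :=
  forall i j l m,
  [/\ forall b c d, linear (fun a => F i a j b l c m d),
      forall a c d, linear (fun b => F i a j b l c m d),
      forall a b d, linear (fun c => F i a j b l c m d)
    & forall a b c, linear (fun d => F i a j b l c m d)].

Lemma lin_hcomp V n : linear (@hcomp k V n).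
Proof. exact: grading_linear (hcomp_grading V) n. Qed.

Lemma hcompE V m n (x : V) : hcomp m (hcomp n x) = if m == n then hcomp n x else 0.
Proof. exact: grading_orth (hcomp_grading V) m n x. Qed.

Lemma homog_hcomp V n (x : V) : homog n (hcomp n x).
Proof. by rewrite /homog hcompE eqxx. Qed.

Lemma hcomp_homog V m n (x : V) : homog n x -> hcomp m x = if m == n then x else 0.
Proof. by move=> <-; rewrite hcompE. Qed.

Lemma homog0 V n : homog n (0 : V).
Proof. exact: lin0 (@lin_hcomp V n). Qed.

Lemma homogZ V n c (x : V) : homog n x -> homog n (c *: x).
Proof. by move=> hx; rewrite /homog (linZ _ _ (@lin_hcomp V n)) hx. Qed.

Lemma homogD V n (x y : V) : homog n x -> homog n y -> homog n (x + y).
Proof. by move=> hx hy; rewrite /homog (linD _ _ (@lin_hcomp V n)) hx hy. Qed.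

Lemma homog_sum V n I (r : seq I) (F : I -> V) :
  (forall i, homog n (F i)) -> homog n (\sum_(i <- r) F i).
Proof. by move=> hF; apply: big_rec => [|i x _]; [apply: homog0 | apply: homogD]. Qed.

Lemma graded_lin_ext V U (f g : V -> U) :
  linear f -> linear g -> (forall n x, homog n x -> f x = g x) ->
  forall x, f x = g x.
Proof.
move=> lf lg fg x; rewrite [x]degboundE (lin_sum _ _ lf) (lin_sum _ _ lg).
by apply: eq_bigr => i _; apply: fg; apply: homog_hcomp.
Qed.

Lemma homog_pure V W i j (x : V) (y : W) :
  homog i x -> homog j y -> homog (V := gtensor V W) (i + j) (x ⊗ y).
Proof.
move=> hx hy; rewrite /homog /= /tensor_hcomp sw_pure; last first.
  exact: tensor_hcomp_bilinear.
have lt_i : (i < (i + j).+1)%N by rewrite ltnS leq_addr.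
rewrite (bigD1 (Ordinal lt_i)) //= addKn hx hy big1 ?addr0 // => l.
rewrite -val_eqE /= => li; rewrite (hcomp_homog _ hx) (negPf li).
exact: lin0 (bil_l (pure_bilinear V W) _).
Qed.

Lemma graded_tensor_lin_ext V W U (f g : tensor V W -> U) :
  linear f -> linear g ->
  (forall i j x y, homog i x -> homog j y -> f (x ⊗ y) = g (x ⊗ y)) ->
  forall t, f t = g t.
Proof.
have [lp rp] := pure_bilinear V W.
move=> lf lg fg; apply: tensor_lin_ext => // x y.
apply: (graded_lin_ext (f := fun x => f (x ⊗ y)) (g := fun x => g (x ⊗ y))).
- exact: (lin_comp lf (rp y)).
- exact: (lin_comp lg (rp y)).
move=> n {}x hx; apply: (graded_lin_ext (f := fun y => f (x ⊗ y))
  (g := fun y => g (x ⊗ y))).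
- exact: (lin_comp lf (lp x)).
- exact: (lin_comp lg (lp x)).
by move=> m {}y hy; apply: fg hx hy.
Qed.

(** The last clause matters: if t is homogeneous, the decomposition can be
    chosen without terms of another total degree that would cancel. *)
Definition homog_dec V W (t : tensor V W) (r : seq (nat * V * (nat * W))) :=
  [/\ t = \sum_(u <- r) u.1.2 ⊗ u.2.2,
      forall u, u \in r -> homog u.1.1 u.1.2 /\ homog u.2.1 u.2.2
    & forall n, homog (V := gtensor V W) n t ->
        forall u, u \in r -> (u.1.1 + u.2.1)%N = n].

Lemma homog_dec_exists V W (t : tensor V W) : exists r, homog_dec t r.
Proof.
have [lp rp] := pure_bilinear V W.
have [r [tE rh]] : exists r : seq (nat * V * (nat * W)),
    t = \sum_(u <- r) u.1.2 ⊗ u.2.2 /\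
    forall u, u \in r -> homog u.1.1 u.1.2 /\ homog u.2.1 u.2.2.
  exists (flatten [seq [seq ((i, hcomp i z.1), (j, hcomp j z.2)) |
     i <- iota 0 (degbound z.1), j <- iota 0 (degbound z.2)] | z <- repr t]).
  split=> [|u /flattenP[s /mapP[z _ ->] /allpairsP[[i j] [_ _ ->]]]]; last first.
    by split; apply: homog_hcomp.
  rewrite {1}[t]tensor_sum_pure big_flatten big_map; apply: eq_bigr => z _.
  rewrite big_allpairs_dep {1}[z.1]degboundE (lin_sum _ _ (rp _)).
  rewrite -(big_mkord xpredT (fun i => hcomp i z.1 ⊗ z.2)) /index_iota subn0.
  apply: eq_bigr => i _; rewrite {1}[z.2]degboundE (lin_sum _ _ (lp _)).
  rewrite -(big_mkord xpredT (fun j => hcomp i z.1 ⊗ hcomp j z.2)).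
  by rewrite /index_iota subn0.
(* The zero tensor is homogeneous of every degree, so that only the empty
   decomposition will do. *)
have [->|t0] := eqVneq t 0.
  by exists [::]; split => //; rewrite big_nil.
have [[n hn]|no] := EM (exists n, homog (V := gtensor V W) n t); last first.
  by exists r; split => // n hn; case: no; exists n.
exists [seq u <- r | u.1.1 + u.2.1 == n]%N; split.
- rewrite -[LHS]hn {1}tE (lin_sum _ _ (@lin_hcomp (gtensor V W) n)) big_filter.
  rewrite [RHS]big_mkcond big_seq [RHS]big_seq; apply: eq_bigr => u /rh[h1 h2].
  by rewrite (hcomp_homog _ (homog_pure h1 h2)) eq_sym.
- by move=> u; rewrite mem_filter => /andP[_ /rh].
move=> m hm u; rewrite mem_filter => /andP[/eqP -> _].
move: t0; rewrite -{1}hm (hcomp_homog _ hn).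
by case: (m =P n) => // _; rewrite eqxx.
Qed.

Definition hdec V W (t : tensor V W) := projT1 (cid (homog_dec_exists t)).

Lemma hdecP V W (t : tensor V W) : homog_dec t (hdec t).
Proof. by rewrite /hdec; case: cid. Qed.

(** The same sum as [gsw], but over a chosen homogeneous decomposition: under
    the sum one may use that the components are homogeneous ([eq_hsw]) and that
    their degrees add up to that of the tensor ([eq_hsw_homog]), without any
    linearity assumption. This is what makes the signs computable. *)
Definition hsw V W U (t : tensor V W) (F : nat -> V -> nat -> W -> U) : U :=
  \sum_(u <- hdec t) F u.1.1 u.1.2 u.2.1 u.2.2.

Definition graded_bilinear V W U (F : nat -> V -> nat -> W -> U) : Prop :=
  forall i j, is_bilinear (fun x y => F i x j y).

Lemma gsw_hsw V W U (t : tensor V W) (F : nat -> V -> nat -> W -> U) :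
  graded_bilinear F -> gsw t F = hsw t F.
Proof.
move=> bF; have [tE th _] := hdecP t; rewrite {1}tE (lin_sum _ _ (gsw_linear bF)).
by rewrite big_seq [RHS]big_seq; apply: eq_bigr => u /th[]; apply: gsw_homog.
Qed.

Lemma sw_hsw V W U (t : tensor V W) (f : V -> W -> U) :
  is_bilinear f -> sw t f = hsw t (fun _ x _ y => f x y).
Proof.
move=> bf; have [tE th _] := hdecP t; rewrite {1}tE (lin_sum _ _ (sw_linear bf)).
by apply: eq_bigr => u _; rewrite sw_pure.
Qed.

Lemma gsw_lin_in V W U (U' : lmodType k) (t : tensor V W)
    (F : U' -> nat -> V -> nat -> W -> U) :
  (forall i x j y, linear (fun u => F u i x j y)) -> linear (fun u => gsw t (F u)).
Proof.
move=> lF; apply: sw_lin_in => x y; apply: lin_bigsum => i.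
by apply: lin_bigsum => j; apply: lF.
Qed.

Lemma hsw_linear V W U (F : nat -> V -> nat -> W -> U) :
  graded_bilinear F -> linear (fun t : tensor V W => hsw t F).
Proof. by move=> bF c x y; rewrite -!gsw_hsw // (gsw_linear bF). Qed.

Lemma hsw_pure V W U (F : nat -> V -> nat -> W -> U) i j x y :
  graded_bilinear F -> homog i x -> homog j y -> hsw (x ⊗ y) F = F i x j y.
Proof. by move=> bF hx hy; rewrite -gsw_hsw // (gsw_homog bF hx hy). Qed.

Lemma hsw_id V W (t : tensor V W) : hsw t (fun _ x _ y => x ⊗ y) = t.
Proof. by have [tE _ _] := hdecP t; rewrite [RHS]tE. Qed.

Lemma eq_hsw V W U (t : tensor V W) (F G : nat -> V -> nat -> W -> U) :
  (forall i x j y, homog i x -> homog j y -> F i x j y = G i x j y) ->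
  hsw t F = hsw t G.
Proof.
move=> FG; have [_ th _] := hdecP t; rewrite /hsw big_seq [RHS]big_seq.
by apply: eq_bigr => u /th[]; apply: FG.
Qed.

Lemma eq_hsw_homog V W U n (t : tensor V W) (F G : nat -> V -> nat -> W -> U) :
  homog (V := gtensor V W) n t ->
  (forall i x j y, homog i x -> homog j y -> (i + j)%N = n ->
     F i x j y = G i x j y) ->
  hsw t F = hsw t G.
Proof.
move=> ht FG; have [_ th tn] := hdecP t; rewrite /hsw big_seq [RHS]big_seq.
by apply: eq_bigr => u ru; have [h1 h2] := th u ru; apply: FG => //; apply: tn.
Qed.

Lemma hsw_lin_in V W U (U' : lmodType k) (t : tensor V W)
    (F : U' -> nat -> V -> nat -> W -> U) :
  (forall i x j y, linear (fun u => F u i x j y)) -> linear (fun u => hsw t (F u)).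
Proof. by move=> lF; apply: lin_bigsum => u; apply: lF. Qed.

Lemma lin_hsw V W U (U' : lmodType k) (L : U -> U') (t : tensor V W) F :
  linear L -> L (hsw t F) = hsw t (fun i x j y => L (F i x j y)).
Proof. exact: lin_sum. Qed.

Lemma hsw_exchange V W V' W' U (s : tensor V W) (t : tensor V' W')
    (F : nat -> V -> nat -> W -> nat -> V' -> nat -> W' -> U) :
  hsw s (fun i a j b => hsw t (F i a j b)) =
  hsw t (fun p c q d => hsw s (fun i a j b => F i a j b p c q d)).
Proof. exact: exchange_big. Qed.

Lemma hsw_bind V W V' W' U (t : tensor V W)
    (f : nat -> V -> nat -> W -> tensor V' W')
    (G : nat -> V' -> nat -> W' -> U) :
  graded_bilinear G -> hsw (hsw t f) G = hsw t (fun i a j b => hsw (f i a j b) G).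
Proof. by move=> bG; rewrite (lin_sum _ _ (hsw_linear bG)). Qed.

Lemma hsw_add V W U (t : tensor V W) (F G : nat -> V -> nat -> W -> U) :
  hsw t (fun i a j b => F i a j b + G i a j b) = hsw t F + hsw t G.
Proof. exact: big_split. Qed.

Lemma hsw_scale V W U c (t : tensor V W) (F : nat -> V -> nat -> W -> U) :
  c *: hsw t F = hsw t (fun i a j b => c *: F i a j b).
Proof. exact: scaler_sumr. Qed.

Lemma homog_hsw V W (V' : gmodType k) n (t : tensor V W)
    (F : nat -> V -> nat -> W -> V') m :
  homog (V := gtensor V W) n t ->
  (forall i x j y, homog i x -> homog j y -> (i + j)%N = n ->
     homog m (F i x j y)) -> homog m (hsw t F).
Proof.
move=> ht hF; rewrite /homog (lin_hsw _ _ (@lin_hcomp V' m)).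
by apply: eq_hsw_homog ht _ => i x j y hx hy ij; apply: hF.
Qed.

Lemma eq_sign (m n : nat) U (x y : U) :
  odd m = odd n -> x = y -> (-1 : k) ^+ m *: x = (-1) ^+ n *: y.
Proof. by move=> mn ->; rewrite -[_ ^+ m]signr_odd mn signr_odd. Qed.

End GradedTools.

(** Koszul signs agree as soon as their exponents have the same parity, which
    is a boolean identity in the parities of the degrees. *)
Ltac sgn := rewrite ?scalerA -?exprD; apply: eq_sign;
  [ rewrite ?(addn0, add0n, muln0, mul0n) ?(oddD, oddM) /=;
    by repeat match goal with |- context [odd ?n] => case: (odd n) end | ].

(** Multilinearity of Sweedler expressions is syntactic: in each
    summand a variable occurs once, below operations that are linear in it. [lin] descends to this
    occurrence; the linearity of the primitive operations is taken from the
    hypotheses. *)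
Ltac lin_known :=
  first [ assumption
        | match goal with H : is_bilinear ?f |- linear (?f _) => exact: (bil_r H) end
        | match goal with H : is_bilinear ?f |- linear (fun x => ?f x ?y) =>
            exact: (bil_l H y) end ].

Ltac lin := cbv beta;
  lazymatch goal with
  | |- graded_bilinear _ => intros ? ?; lin
  | |- graded_trilinear _ => intros ? ? ?; lin
  | |- graded_quadrilinear _ => intros ? ? ? ?; split; intros ? ? ?; lin
  | |- is_bilinear _ => split; intros ?; lin
  | |- is_trilinear _ => split; intros ? ?; lin
  | |- linear (fun x => x) => exact: lin_id
  | |- linear (fun x => @?E x + @?E' x) =>
      refine (lin_add (f := E) (g := E') _ _); lin
  | |- linear (fun x => @?C x *: @?E x) =>
      lazymatch C with
      | (fun _ => ?c) => refine (lin_scale (f := E) c _); lin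
      | _ => lazymatch E with
             | (fun _ => ?e) => refine (lin_scalel (f := C) e _);
                 match goal with H : scalar _ |- _ => exact: H end end
      end
  | |- linear (fun x => hsw (@?T x) (@?F x)) =>
      lazymatch T with
      | (fun _ => ?t) =>
          refine (@hsw_lin_in _ _ _ _ _ t F _); intros ? ? ? ?; lin
      | _ => lazymatch F with
             | (fun _ => ?f) =>
                 refine (lin_comp (f := fun t => hsw t f) (g := T) _ _);
                 [apply: hsw_linear; lin | lin] end
      end
  | |- linear (fun x => gsw (@?T x) (@?F x)) =>
      lazymatch T with
      | (fun _ => ?t) =>
          refine (@gsw_lin_in _ _ _ _ _ t F _); intros ? ? ? ?; lin
      | _ => lazymatch F with
             | (fun _ => ?f) =>
                 refine (lin_comp (f := fun t => gsw t f) (g := T) _ _);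
                 [apply: gsw_linear; intros ? ?; lin | lin] end
      end
  | |- linear (fun x => sw (@?T x) (@?F x)) =>
      lazymatch T with
      | (fun _ => ?t) =>
          refine (@sw_lin_in _ _ _ _ _ t F _); intros ? ?; lin
      | _ => lazymatch F with
             | (fun _ => ?f) =>
                 refine (lin_comp (f := fun t => sw t f) (g := T) _ _);
                 [apply: sw_linear; lin | lin] end
      end
  | |- linear (fun x => pure (@?T x) (@?T' x)) =>
      lazymatch T' with
      | (fun _ => ?y) =>
          refine (lin_comp (f := fun t => pure t y) (g := T) _ _);
          [exact: bil_l (pure_bilinear _ _) y | lin]
      | _ => lazymatch T with
             | (fun _ => ?y) =>
                 refine (lin_comp (f := fun t => pure y t) (g := T') _ _);
                 [exact: bil_r (pure_bilinear _ _) y | lin] end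
      end
  | |- linear (fun x => ?f (@?T x) (@?T' x)) =>
      first [ lin_known |
      lazymatch T' with
      | (fun _ => ?y) =>
          refine (lin_comp (f := fun t => f t y) (g := T) _ _);
          [lin_known | lin]
      | _ => lazymatch T with
             | (fun _ => ?y) =>
                 refine (lin_comp (f := f y) (g := T') _ _);
                 [lin_known | lin] end
      end ]
  | |- linear (fun x => ?f (@?T x)) =>
      first [ lin_known |
      refine (lin_comp (f := f) (g := T) _ _); [lin_known | lin] ]
  | |- linear _ => lin_known
  | |- forall _, _ => intros ?; lin
  end.

(** * Algebras and coalgebras from exchange maps *)
Section Factorization.
Variables (k : fieldType) (V W : lmodType k) (A : alg_str V) (B : alg_str W).
Variable R : W -> V -> tensor V W.

(** The product (m ⊗ m)(id ⊗ R ⊗ id). *)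
Definition fact_mul (s t : tensor V W) : tensor V W :=
  sw s (fun w x => sw t (fun v y =>
    sw (R x v) (fun v' x' => amul A w v' ⊗ amul B x' y))).

Definition fact_alg : alg_str (tensor V W) :=
  AlgStr fact_mul (aone A ⊗ aone B).

Hypotheses (algA : algebra A) (algB : algebra B) (Rbil : is_bilinear R).

Let mA : is_bilinear (amul A). Proof. by case: algA. Qed.
Let mB : is_bilinear (amul B). Proof. by case: algB. Qed.

Lemma fact_mul_bilinear : is_bilinear fact_mul.
Proof. rewrite /fact_mul; lin. Qed.

Lemma fact_mul_pure w x v y : fact_mul (w ⊗ x) (v ⊗ y) =
  sw (R x v) (fun v' x' => amul A w v' ⊗ amul B x' y).
Proof.
rewrite /fact_mul sw_pure; last by lin.
by rewrite sw_pure; last by lin.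
Qed.

Hypotheses
  (R1l : forall v, R (aone B) v = v ⊗ aone B)
  (R1r : forall x, R x (aone A) = aone A ⊗ x)
  (RMl : forall x y v, R (amul B x y) v =
     sw (R y v) (fun v' y' => sw (R x v') (fun v'' x' => v'' ⊗ amul B x' y')))
  (RMr : forall x u v, R x (amul A u v) =
     sw (R x u) (fun u' x' => sw (R x' v) (fun v' x'' => amul A u' v' ⊗ x''))).

(** Both bracketings of (w ⊗ x)(v ⊗ y)(u ⊗ z) first exchange x with v and y with
    u, and then the resulting x' with u'. *)
Lemma fact_algebra : algebra fact_alg.
Proof.
have bm := fact_mul_bilinear.
have [_ AA A1l A1r] := algA; have [_ BA B1l B1r] := algB.
split => //=.
- move=> s t r.
  apply: (tensor_lin_ext (f := fun s => fact_mul s (fact_mul t r))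
    (g := fun s => fact_mul (fact_mul s t) r)); try lin.
  move=> w x {s}.
  apply: (tensor_lin_ext (f := fun t => fact_mul (w ⊗ x) (fact_mul t r))
    (g := fun t => fact_mul (fact_mul (w ⊗ x) t) r)); try lin.
  move=> v y {t}.
  apply: (tensor_lin_ext (f := fun r => fact_mul (w ⊗ x) (fact_mul (v ⊗ y) r))
    (g := fun r => fact_mul (fact_mul (w ⊗ x) (v ⊗ y)) r)); try lin.
  move=> u z {r}; rewrite !fact_mul_pure.
  transitivity (sw (R x v) (fun v' x' => sw (R y u) (fun u' y' =>
    sw (R x' u') (fun u'' x'' =>
      amul A (amul A w v') u'' ⊗ amul B (amul B x'' y') z)))).
    rewrite (lin_sw _ _ (bil_r bm _)) sw_exchange; apply: eq_sw => u' y'.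
    rewrite fact_mul_pure RMr sw_bind; last by lin.
    apply: eq_sw => v' x'; rewrite sw_bind; last by lin.
    apply: eq_sw => u'' x''; rewrite sw_pure; last by lin.
    by rewrite AA BA.
  rewrite (lin_sw _ _ (bil_l bm _)); apply: eq_sw => v' x'.
  rewrite fact_mul_pure RMl sw_bind; last by lin.
  apply: eq_sw => u' y'; rewrite sw_bind; last by lin.
  by apply: eq_sw => u'' x''; rewrite sw_pure //; last by lin.
- apply: (tensor_lin_ext (f := fun s => fact_mul _ s) (g := fun t => t)); try lin.
  by move=> w x; rewrite fact_mul_pure R1l sw_pure ?A1l ?B1l //; lin.
- apply: (tensor_lin_ext (f := fun s => fact_mul s _) (g := fun t => t)); try lin.
  by move=> w x; rewrite fact_mul_pure R1r sw_pure ?A1r ?B1r //; lin.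
Qed.

End Factorization.

Section Coalgebra.
Variables (k : fieldType).
Implicit Types (V W U : lmodType k).

Lemma cop_assoc V (C : coalg_str V) U x (F : V -> V -> V -> U) :
  coalgebra C -> is_trilinear F ->
  sw (cop C x) (fun a b => sw (cop C a) (fun a1 a2 => F a1 a2 b)) =
  sw (cop C x) (fun a b => sw (cop C b) (F a)).
Proof.
case=> [_ _ CA _ _] tF; have lF := sw3_linear tF.
transitivity (sw3 F (sw (cop C x) (fun a b => sw (cop C a)
    (fun a1 a2 => a1 ⊗ (a2 ⊗ b))))).
  rewrite (lin_sw _ _ lF); apply: eq_sw => a b; rewrite (lin_sw _ _ lF).
  by apply: eq_sw => a1 a2; rewrite sw3_pure3.
by rewrite CA (lin_sw _ _ lF); apply: eq_sw => a b; rewrite sw3_pure.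
Qed.

Lemma cou_l V (C : coalg_str V) U x (F : V -> U) : coalgebra C -> linear F ->
  sw (cop C x) (fun a b => cou C a *: F b) = F x.
Proof.
case=> [_ _ _ C1 _] lF; rewrite -{2}[x]C1 (lin_sw _ _ lF).
by apply: eq_sw => a b; rewrite linZ.
Qed.

Lemma cou_r V (C : coalg_str V) U x (F : V -> U) : coalgebra C -> linear F ->
  sw (cop C x) (fun a b => cou C b *: F a) = F x.
Proof.
case=> [_ _ _ _ C1] lF; rewrite -{2}[x]C1 (lin_sw _ _ lF).
by apply: eq_sw => a b; rewrite linZ.
Qed.

End Coalgebra.

Section Cofactorization.
Variables (k : fieldType) (V W : lmodType k).
Variables (A : coalg_str V) (B : coalg_str W).
Variable Q : V -> W -> tensor W V.

(** The coproduct (id ⊗ Q ⊗ id)(Δ ⊗ Δ). *)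
Definition fact_cop (t : tensor V W) : tensor (tensor V W) (tensor V W) :=
  sw t (fun w x => sw (cop A w) (fun w1 w2 => sw (cop B x) (fun x1 x2 =>
    sw (Q w2 x1) (fun x' w' => (w1 ⊗ x') ⊗ (w' ⊗ x2))))).

Definition fact_cou (t : tensor V W) : k :=
  sw (U := k^o) t (fun w x => cou A w * cou B x).

Definition fact_coalg : coalg_str (tensor V W) := CoalgStr fact_cop fact_cou.

Hypotheses (coA : coalgebra A) (coB : coalgebra B) (Qbil : is_bilinear Q).

Let lA : linear (cop A). Proof. by case: coA. Qed.
Let lB : linear (cop B). Proof. by case: coB. Qed.
Let eA : scalar (cou A). Proof. by case: coA. Qed.
Let eB : scalar (cou B). Proof. by case: coB. Qed.

Let cou_bil : is_bilinear (fun w x => cou A w * cou B x : k^o).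
Proof.
split=> [w|x]; first exact: (lin_scale (U := k^o) (cou A w) eB).
exact: (lin_scalel (U := k^o) (cou B x) eA).
Qed.

Lemma fact_cou_scalar : scalar fact_cou.
Proof. exact: sw_linear cou_bil. Qed.

Lemma fact_cou_pure w x : fact_cou (w ⊗ x) = cou A w * cou B x.
Proof. by rewrite /fact_cou sw_pure. Qed.

Lemma fact_cop_linear : linear fact_cop.
Proof. rewrite /fact_cop; lin. Qed.

Lemma fact_cop_pure w x : fact_cop (w ⊗ x) =
  sw (cop A w) (fun w1 w2 => sw (cop B x) (fun x1 x2 =>
    sw (Q w2 x1) (fun x' w' => (w1 ⊗ x') ⊗ (w' ⊗ x2)))).
Proof. by rewrite /fact_cop sw_pure; last by lin. Qed.

Hypotheses
  (Qcou_l : forall w x, sw (Q w x) (fun x' w' => cou B x' *: w') = cou B x *: w)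
  (Qcou_r : forall w x, sw (Q w x) (fun x' w' => cou A w' *: x') = cou A w *: x)
  (Qcop_l : forall w x,
     sw (Q w x) (fun x' w' => sw (cop B x') (fun x1 x2 => x1 ⊗ (x2 ⊗ w'))) =
     sw (cop B x) (fun x1 x2 => sw (Q w x1) (fun x1' w' =>
       sw (Q w' x2) (fun x2' w'' => x1' ⊗ (x2' ⊗ w'')))))
  (Qcop_r : forall w x,
     sw (Q w x) (fun x' w' => sw (cop A w') (fun w1 w2 => x' ⊗ (w1 ⊗ w2))) =
     sw (cop A w) (fun w1 w2 => sw (Q w2 x) (fun x' w2' =>
       sw (Q w1 x') (fun x'' w1' => x'' ⊗ (w1' ⊗ w2'))))).

Let Qcop_lF (U : lmodType k) w x (F : W -> W -> V -> U) : is_trilinear F ->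
  sw (Q w x) (fun x' w' => sw (cop B x') (fun x1 x2 => F x1 x2 w')) =
  sw (cop B x) (fun x1 x2 => sw (Q w x1) (fun x1' w' =>
    sw (Q w' x2) (fun x2' w'' => F x1' x2' w''))).
Proof.
move=> tF; have lF := sw3_linear tF.
transitivity (sw3 F (sw (Q w x) (fun x' w' => sw (cop B x')
   (fun x1 x2 => x1 ⊗ (x2 ⊗ w'))))).
  rewrite (lin_sw _ _ lF); apply: eq_sw => x' w'.
  by rewrite (lin_sw _ _ lF); apply: eq_sw => x1 x2; rewrite sw3_pure3.
rewrite Qcop_l (lin_sw _ _ lF); apply: eq_sw => x1 x2.
rewrite (lin_sw _ _ lF); apply: eq_sw => x1' w'.
by rewrite (lin_sw _ _ lF); apply: eq_sw => x2' w''; rewrite sw3_pure3.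
Qed.

Let Qcop_rF (U : lmodType k) w x (F : W -> V -> V -> U) : is_trilinear F ->
  sw (Q w x) (fun x' w' => sw (cop A w') (fun w1 w2 => F x' w1 w2)) =
  sw (cop A w) (fun w1 w2 => sw (Q w2 x) (fun x' w2' =>
    sw (Q w1 x') (fun x'' w1' => F x'' w1' w2'))).
Proof.
move=> tF; have lF := sw3_linear tF.
transitivity (sw3 F (sw (Q w x) (fun x' w' => sw (cop A w')
   (fun w1 w2 => x' ⊗ (w1 ⊗ w2))))).
  rewrite (lin_sw _ _ lF); apply: eq_sw => x' w'.
  by rewrite (lin_sw _ _ lF); apply: eq_sw => x1 x2; rewrite sw3_pure3.
rewrite Qcop_r (lin_sw _ _ lF); apply: eq_sw => x1 x2.
rewrite (lin_sw _ _ lF); apply: eq_sw => x1' w'.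
by rewrite (lin_sw _ _ lF); apply: eq_sw => x2' w''; rewrite sw3_pure3.
Qed.

Lemma crossing_cou_l (U : lmodType k) w x (F : V -> U) : linear F ->
  sw (Q w x) (fun x' w' => cou B x' *: F w') = cou B x *: F w.
Proof.
move=> lF; rewrite -linZ // -Qcou_l (lin_sw _ _ lF).
by apply: eq_sw => ? ?; rewrite linZ.
Qed.

Lemma crossing_cou_r (U : lmodType k) w x (F : W -> U) : linear F ->
  sw (Q w x) (fun x' w' => cou A w' *: F x') = cou A w *: F x.
Proof.
move=> lF; rewrite -linZ // -Qcou_r (lin_sw _ _ lF).
by apply: eq_sw => ? ?; rewrite linZ.
Qed.

Lemma fact_coalgebra : coalgebra fact_coalg.
Proof.
have lc := fact_cop_linear; have ec := fact_cou_scalar.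
split => //=.
- apply: (tensor_lin_ext
    (f := fun t => sw (fact_cop t) (fun a b => sw (fact_cop a)
            (fun a1 a2 => a1 ⊗ (a2 ⊗ b))))
    (g := fun t => sw (fact_cop t) (fun a b => a ⊗ fact_cop b))); try lin.
  move=> w x; rewrite !fact_cop_pure.
  (* Both sides are brought to the form in which w and x are each split in
     three and the three crossings of the pieces are made. *)
  transitivity (sw (cop A w) (fun w1 w' => sw (cop A w') (fun w2 w3 =>
    sw (cop B x) (fun x1 x' => sw (cop B x') (fun x2 x3 =>
    sw (Q w3 x1) (fun x1' w3' => sw (Q w3' x2) (fun x2' w3'' =>
    sw (Q w2 x1') (fun x1'' w2' =>
      (w1 ⊗ x1'') ⊗ ((w2' ⊗ x2') ⊗ (w3'' ⊗ x3)))))))))).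
    transitivity (sw (cop A w) (fun w' w3 => sw (cop A w') (fun w1 w2 =>
      sw (cop B x) (fun x' x3 => sw (cop B x') (fun x1 x2 =>
      sw (Q w3 x1) (fun x1' w3' => sw (Q w3' x2) (fun x2' w3'' =>
      sw (Q w2 x1') (fun x1'' w2' =>
        (w1 ⊗ x1'') ⊗ ((w2' ⊗ x2') ⊗ (w3'' ⊗ x3)))))))))).
      rewrite sw_bind; last by lin.
      apply: eq_sw => w1 w2; rewrite sw_exchange sw_bind; last by lin.
      apply: eq_sw => x1 x2; rewrite sw_bind; last by lin.
      under eq_sw => x' w'.
        rewrite sw_pure; last by lin.
        rewrite fact_cop_pure sw_bind; last by lin.
        over.
      rewrite sw_exchange; apply: eq_sw => w11 w12.
      rewrite -Qcop_lF; last by lin.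
      apply: eq_sw => x' w'; rewrite sw_bind; last by lin.
      apply: eq_sw => x'1 x'2; rewrite sw_bind; last by lin.
      by apply: eq_sw => x'' w''; rewrite sw_pure //; lin.
    rewrite cop_assoc //; last by lin.
    apply: eq_sw => w1 w'; apply: eq_sw => w2 w3.
    by rewrite cop_assoc //; lin.
  rewrite [RHS]sw_bind; last by lin.
  apply: eq_sw => w1 w2; rewrite sw_exchange [RHS]sw_bind; last by lin.
  apply: eq_sw => x1 x2; rewrite [RHS]sw_bind; last by lin.
  under [RHS]eq_sw => x' w'.
    rewrite sw_pure; last by lin.
    rewrite fact_cop_pure (lin_sw _ _ (bil_r (pure_bilinear _ _) _)).
    under eq_sw => w'1 w'2.
      rewrite (lin_sw _ _ (bil_r (pure_bilinear _ _) _)).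
      under eq_sw => x21 x22.
        rewrite (lin_sw _ _ (bil_r (pure_bilinear _ _) _)); over.
      over.
    over.
  rewrite (@Qcop_rF _ w2 x1 (fun p q r => sw (cop B x2) (fun x21 x22 =>
     sw (Q r x21) (fun x2' w'' => (w1 ⊗ p) ⊗ ((q ⊗ x2') ⊗ (w'' ⊗ x22))))));
    last by lin.
  apply: eq_sw => w21 w22; rewrite sw_exchange; apply: eq_sw => x' w2'.
  rewrite [RHS]sw_exchange; apply: eq_sw => x21 x22.
  by rewrite sw_exchange.
- move=> t; apply: (tensor_lin_ext (f := fun t => sw (fact_cop t)
    (fun a b => fact_cou a *: b)) (g := fun t => t)); try lin.
  move=> w x; rewrite fact_cop_pure sw_bind; last by lin.
  transitivity (sw (cop A w) (fun w1 w2 => cou A w1 *: (w2 ⊗ x))).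
    apply: eq_sw => w1 w2; rewrite sw_bind; last by lin.
    transitivity (sw (cop B x) (fun x1 x2 => cou B x1 *: (cou A w1 *: (w2 ⊗ x2)))).
      apply: eq_sw => x1 x2; rewrite sw_bind; last by lin.
      rewrite -(@crossing_cou_l _ w2 x1 (fun w2 => cou A w1 *: (w2 ⊗ x2))); last by lin.
      apply: eq_sw => x' w'; rewrite sw_pure; last by lin.
      by rewrite fact_cou_pure mulrC scalerA.
    by rewrite (@cou_l _ _ _ _ _ (fun x2 => cou A w1 *: (w2 ⊗ x2))) //; lin.
  by rewrite (@cou_l _ _ _ _ _ (fun w2 => w2 ⊗ x)) //; lin.
- move=> t; apply: (tensor_lin_ext (f := fun t => sw (fact_cop t)
    (fun a b => fact_cou b *: a)) (g := fun t => t)); try lin.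
  move=> w x; rewrite fact_cop_pure sw_bind; last by lin.
  transitivity (sw (cop A w) (fun w1 w2 => cou A w2 *: (w1 ⊗ x))).
    apply: eq_sw => w1 w2; rewrite sw_bind; last by lin.
    transitivity (sw (cop B x) (fun x1 x2 => cou B x2 *: (cou A w2 *: (w1 ⊗ x1)))).
      apply: eq_sw => x1 x2; rewrite sw_bind; last by lin.
      rewrite -(@crossing_cou_r _ w2 x1 (fun x1 => (w1 ⊗ x1))); last by lin.
      rewrite (lin_sw _ _ (lin_scale _ (@lin_id _ _))).
      apply: eq_sw => x' w'; rewrite sw_pure; last by lin.
      by rewrite fact_cou_pure mulrC scalerA.
    by rewrite (@cou_r _ _ _ _ _ (fun x2 => cou A w2 *: (w1 ⊗ x2))) //; lin.
  by rewrite (@cou_r _ _ _ _ _ (fun w2 => w2 ⊗ x)) //; lin.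
Qed.

End Cofactorization.

(** * The antipode *)
Section Convolution.
Variables (k : fieldType) (C U : lmodType k) (sC : coalg_str C) (sU : alg_str U).
Hypotheses (coC : coalgebra sC) (algU : algebra sU).

Definition conv (f g : C -> U) (x : C) : U :=
  sw (cop sC x) (fun a b => amul sU (f a) (g b)).

Definition conv_one (x : C) : U := cou sC x *: aone sU.

Let lC : linear (cop sC). Proof. by case: coC. Qed.
Let mU : is_bilinear (amul sU). Proof. by case: algU. Qed.

Lemma conv_linear f g : linear f -> linear g -> linear (conv f g).
Proof. by move=> lf lg; rewrite /conv; lin. Qed.

Lemma convA f g h : linear f -> linear g -> linear h ->
  conv f (conv g h) = conv (conv f g) h.
Proof.
move=> lf lg lh; have [_ UA _ _] := algU; apply: funext => x.
rewrite /conv.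
transitivity (sw (cop sC x) (fun a b => sw (cop sC b) (fun b1 b2 =>
  amul sU (f a) (amul sU (g b1) (h b2))))).
  by apply: eq_sw => a b; rewrite (lin_sw _ _ (bil_r mU _)).
rewrite -cop_assoc //; last by lin.
apply: eq_sw => a b; rewrite (lin_sw _ _ (bil_l mU _)).
by apply: eq_sw => a1 a2; rewrite UA.
Qed.

Lemma conv1l f : linear f -> conv conv_one f = f.
Proof.
move=> lf; have [_ _ U1 _] := algU; apply: funext => x; rewrite /conv /conv_one.
rewrite -[RHS](cou_l x coC lf); apply: eq_sw => a b.
by rewrite (linZ _ _ (bil_l mU _)) U1.
Qed.

End Convolution.

Section FactorAntipode.
Variables (k : fieldType) (V W : lmodType k) (A : hopf_str V) (B : hopf_str W).
Variables (R : W -> V -> tensor V W) (Q : V -> W -> tensor W V).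
Variables (SA : V -> V) (SB : W -> W).

Let T := tensor V W.
Let sT : hopf_str T := HopfStr (fact_alg A B R) (fact_coalg A B Q).

(** Convolution products of maps [on_left f] are computed in the first factor,
    those of maps [on_right g] in the second ([conv_on_left], [conv_on_right]):
    the counit removes Q. This is why these maps have easy inverses. *)
Definition on_left (f : V -> T) (t : T) : T := sw t (fun w x => cou B x *: f w).
Definition on_right (g : W -> T) (t : T) : T := sw t (fun w x => cou A w *: g x).

(** The inverse of a convolution product is the product of the inverses in the
    opposite order. *)
Definition fact_antipode : T -> T :=
  conv sT sT (on_right (fun x => aone A ⊗ SB x)) (on_left (fun w => SA w ⊗ aone B)).

Hypotheses (algA : algebra A) (algB : algebra B) (coA : coalgebra A)
  (coB : coalgebra B) (algT : algebra sT) (coT : coalgebra sT).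
Hypotheses (Rbil : is_bilinear R) (Qbil : is_bilinear Q).
Hypotheses
  (R1l : forall v, R (aone B) v = v ⊗ aone B)
  (R1r : forall x, R x (aone A) = aone A ⊗ x)
  (Qcou_l : forall w x, sw (Q w x) (fun x' w' => cou B x' *: w') = cou B x *: w)
  (Qcou_r : forall w x, sw (Q w x) (fun x' w' => cou A w' *: x') = cou A w *: x).

Let mA : is_bilinear (amul A). Proof. by case: algA. Qed.
Let mB : is_bilinear (amul B). Proof. by case: algB. Qed.
Let mT : is_bilinear (amul sT). Proof. by case: algT. Qed.
Let eA : scalar (cou A). Proof. by case: coA. Qed.
Let eB : scalar (cou B). Proof. by case: coB. Qed.

Lemma on_left_linear f : linear f -> linear (on_left f).
Proof. by move=> lf; rewrite /on_left; lin. Qed.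

Lemma on_right_linear f : linear f -> linear (on_right f).
Proof. by move=> lf; rewrite /on_right; lin. Qed.

Lemma on_left_pure f w x : linear f -> on_left f (w ⊗ x) = cou B x *: f w.
Proof. by move=> lf; rewrite /on_left sw_pure //; lin. Qed.

Lemma on_right_pure f w x : linear f -> on_right f (w ⊗ x) = cou A w *: f x.
Proof. by move=> lf; rewrite /on_right sw_pure //; lin. Qed.

Let conv_pure f g w x : linear f -> linear g -> conv sT sT f g (w ⊗ x) =
  sw (cop A w) (fun w1 w2 => sw (cop B x) (fun x1 x2 => sw (Q w2 x1)
    (fun x' w' => amul sT (f (w1 ⊗ x')) (g (w' ⊗ x2))))).
Proof.
move=> lf lg; rewrite /conv /= fact_cop_pure // sw_bind; last by lin.
apply: eq_sw => w1 w2; rewrite sw_bind; last by lin.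
apply: eq_sw => x1 x2; rewrite sw_bind; last by lin.
by apply: eq_sw => x' w'; rewrite sw_pure //; lin.
Qed.

Lemma conv_on_left f g : linear f -> linear g ->
  conv sT sT (on_left f) (on_left g) = on_left (conv A sT f g).
Proof.
move=> lf lg; apply: funext.
have ll := on_left_linear lf; have lr := on_left_linear lg.
have lc := conv_linear coA algT lf lg.
apply: tensor_lin_ext => [||w x]; first exact: conv_linear.
  exact: on_left_linear.
rewrite conv_pure // on_left_pure // (lin_sw _ _ (lin_scale _ (@lin_id _ _))).
apply: eq_sw => w1 w2.
have lF : linear (fun x => cou B x *: amul sT (f w1) (g w2)) by lin.
rewrite -(cou_l x coB lF); apply: eq_sw => x1 x2.
have lG : linear (fun v => cou B x2 *: amul sT (f w1) (g v)) by lin.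
rewrite -(crossing_cou_l Qcou_l _ _ lG); apply: eq_sw => x' w'.
by rewrite !on_left_pure // (linZ _ _ (bil_l mT _)) (linZ _ _ (bil_r mT _)).
Qed.

Lemma conv_on_right f g : linear f -> linear g ->
  conv sT sT (on_right f) (on_right g) = on_right (conv B sT f g).
Proof.
move=> lf lg; apply: funext.
have ll := on_right_linear lf; have lr := on_right_linear lg.
have lc := conv_linear coB algT lf lg.
apply: tensor_lin_ext => [||w x]; first exact: conv_linear.
  exact: on_right_linear.
have lF : linear (fun w => cou A w *: conv B sT f g x) by lin.
rewrite conv_pure // on_right_pure // -(cou_l w coA lF).
apply: eq_sw => w1 w2.
rewrite !(lin_sw _ _ (lin_scale _ (@lin_id _ _))).
apply: eq_sw => x1 x2.
have lG : linear (fun x1 => cou A w1 *: amul sT (f x1) (g x2)) by lin.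
rewrite scalerA mulrC -scalerA.
rewrite -(crossing_cou_r Qcou_r _ _ lG); apply: eq_sw => x' w'.
rewrite !on_right_pure // (linZ _ _ (bil_l mT _)) (linZ _ _ (bil_r mT _)).
by rewrite !scalerA mulrC.
Qed.

Lemma fact_mul_on_left w v : amul sT (w ⊗ aone B) (v ⊗ aone B) = amul A w v ⊗ aone B.
Proof.
have [_ _ _ B1] := algB.
by rewrite /= fact_mul_pure // R1l sw_pure; [rewrite B1 | lin].
Qed.

Lemma fact_mul_on_right x y : amul sT (aone A ⊗ x) (aone A ⊗ y) = aone A ⊗ amul B x y.
Proof.
have [_ _ _ A1] := algA.
by rewrite /= fact_mul_pure // R1r sw_pure; [rewrite A1 | lin].
Qed.

Lemma fact_mul_left_right w x : amul sT (w ⊗ aone B) (aone A ⊗ x) = w ⊗ x.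
Proof.
have [_ _ _ A1] := algA; have [_ _ B1 _] := algB.
by rewrite /= fact_mul_pure // R1r sw_pure; [rewrite A1 B1 | lin].
Qed.

(** In a factorised algebra w ⊗ x = (w ⊗ 1)(1 ⊗ x), and after Q has been
    removed by the counits only one piece of w and one of x remain. *)
Lemma conv_left_right :
  conv sT sT (on_left (fun w => w ⊗ aone B)) (on_right (fun x => aone A ⊗ x)) = id.
Proof.
have lf : linear (fun w : V => w ⊗ aone B) by lin.
have lg : linear (fun x : W => aone A ⊗ x) by lin.
have ll := on_left_linear lf; have lr := on_right_linear lg.
apply: funext; apply: tensor_lin_ext => [||w x] //; first exact: conv_linear.
rewrite conv_pure //; have lp : linear (fun w : V => w ⊗ x) by lin.
rewrite -[RHS](cou_r w coA lp); apply: eq_sw => w1 w2.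
have lF : linear (fun x : W => cou A w2 *: (w1 ⊗ x)) by lin.
rewrite -(cou_l x coB lF); apply: eq_sw => x1 x2.
have lG : linear (fun w2 => cou A w2 *: (w1 ⊗ x2)) by lin.
rewrite -(crossing_cou_l Qcou_l _ _ lG); apply: eq_sw => x' w'.
rewrite on_left_pure // on_right_pure // (linZ _ _ (bil_l mT _)).
by rewrite (linZ _ _ (bil_r mT _)) fact_mul_left_right.
Qed.

Lemma fact_antipodeP : antipode A SA -> antipode B SB -> antipode sT fact_antipode.
Proof.
move=> [lSA SAl SAr] [lSB SBl SBr].
pose f (w : V) := w ⊗ aone B; pose g (x : W) := aone A ⊗ x.
pose f' w := SA w ⊗ aone B; pose g' x := aone A ⊗ SB x.
have lf : linear f by rewrite /f; lin. have lg : linear g by rewrite /g; lin.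
have lf' : linear f' by rewrite /f'; lin. have lg' : linear g' by rewrite /g'; lin.
have oneL : on_left (conv_one A sT) = conv_one sT sT.
  have l1 : linear (conv_one A sT) by rewrite /conv_one; lin.
  apply: funext; apply: tensor_lin_ext.
  - exact: on_left_linear.
  - have eT : scalar (cou sT) by case: coT.
    by rewrite /conv_one; lin.
  move=> w x; rewrite on_left_pure // /conv_one /= fact_cou_pure //.
  by rewrite scalerA mulrC.
have oneR : on_right (conv_one B sT) = conv_one sT sT.
  have l1 : linear (conv_one B sT) by rewrite /conv_one; lin.
  apply: funext; apply: tensor_lin_ext.
  - exact: on_right_linear.
  - have eT : scalar (cou sT) by case: coT.
    by rewrite /conv_one; lin.
  move=> w x; rewrite on_right_pure // /conv_one /= fact_cou_pure //.
  by rewrite scalerA.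
have ff' : conv sT sT (on_left f) (on_left f') = conv_one sT sT.
  rewrite conv_on_left // -oneL; congr on_left; apply: funext => w.
  rewrite /conv /conv_one; under eq_sw do rewrite fact_mul_on_left.
  rewrite -(lin_sw (L := fun v : V => v ⊗ aone B)) ?SAr; last by lin.
  exact: (linZ _ _ lf).
have f'f : conv sT sT (on_left f') (on_left f) = conv_one sT sT.
  rewrite conv_on_left // -oneL; congr on_left; apply: funext => w.
  rewrite /conv /conv_one; under eq_sw do rewrite fact_mul_on_left.
  rewrite -(lin_sw (L := fun v : V => v ⊗ aone B)) ?SAl; last by lin.
  exact: (linZ _ _ lf).
have gg' : conv sT sT (on_right g) (on_right g') = conv_one sT sT.
  rewrite conv_on_right // -oneR; congr on_right; apply: funext => x.
  rewrite /conv /conv_one; under eq_sw do rewrite fact_mul_on_right.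
  rewrite -(lin_sw (L := fun v : W => aone A ⊗ v)) ?SBr; last by lin.
  exact: (linZ _ _ lg).
have g'g : conv sT sT (on_right g') (on_right g) = conv_one sT sT.
  rewrite conv_on_right // -oneR; congr on_right; apply: funext => x.
  rewrite /conv /conv_one; under eq_sw do rewrite fact_mul_on_right.
  rewrite -(lin_sw (L := fun v : W => aone A ⊗ v)) ?SBl; last by lin.
  exact: (linZ _ _ lg).
have Lf := on_left_linear lf; have Lg := on_right_linear lg.
have Lf' := on_left_linear lf'; have Lg' := on_right_linear lg'.
have Lfg := conv_linear coT algT Lf Lg; have Lgf := conv_linear coT algT Lg' Lf'.
split=> // [x|x].
- have -> : sw (cop sT x) (fun a b => amul sT (fact_antipode a) b) =
     conv sT sT fact_antipode id x by [].
  rewrite /fact_antipode -conv_left_right -convA //.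
  by rewrite (convA coT algT Lf') // f'f conv1l // g'g.
- have -> : sw (cop sT x) (fun a b => amul sT a (fact_antipode b)) =
     conv sT sT id fact_antipode x by [].
  rewrite /fact_antipode -conv_left_right -convA //.
  by rewrite (convA coT algT Lg) // gg' conv1l // ff'.
Qed.

End FactorAntipode.

(** * Graded Hopf algebras and super bicrossproduct data *)
Section GradedSums.
Variable k : fieldType.
Implicit Types (V W X : gmodType k) (U : lmodType k).

Lemma hsw_pure_l V W U (f : nat -> V -> W -> U) i x y :
  (forall i, is_bilinear (f i)) -> homog i x ->
  hsw (x ⊗ y) (fun i x _ y => f i x y) = f i x y.
Proof.
move=> bf hx.
have gf : graded_bilinear (fun i (x : V) (_ : nat) (y : W) => f i x y) by move=> ? ?.
apply: (graded_lin_ext (f := fun y => hsw (x ⊗ y) (fun i x _ y => f i x y))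
   (g := f i x)) => [||n {}y hy].
- exact: lin_comp (hsw_linear gf) (bil_r (pure_bilinear _ _) x).
- exact: bil_r (bf i) x.
by rewrite (hsw_pure gf hx hy).
Qed.

Lemma hsw_pure_r V W U (f : V -> nat -> W -> U) j x y :
  (forall j, is_bilinear (fun x y => f x j y)) -> homog j y ->
  hsw (x ⊗ y) (fun _ x j y => f x j y) = f x j y.
Proof.
move=> bf hy.
have gf : graded_bilinear (fun (_ : nat) (x : V) j (y : W) => f x j y) by move=> ? ?.
apply: (graded_lin_ext (f := fun x => hsw (x ⊗ y) (fun _ x j y => f x j y))
   (g := fun x => f x j y)) => [||n {}x hx].
- exact: lin_comp (hsw_linear gf) (bil_l (pure_bilinear _ _) y).
- exact: bil_l (bf j) y.
by rewrite (hsw_pure gf hx hy).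
Qed.

Definition hsw3 V W X U (F : nat -> V -> nat -> W -> nat -> X -> U)
    (t : tensor V (tensor W X)) : U :=
  hsw (V := V) (W := gtensor W X) t (fun i x _ yz => hsw yz (F i x)).

Lemma graded_trilinear_hsw V W X U (F : nat -> V -> nat -> W -> nat -> X -> U) :
  graded_trilinear F -> forall i, is_bilinear (fun x (yz : tensor W X) => hsw yz (F i x)).
Proof.
move=> tF i; split=> [x|y]; last first.
  by apply: hsw_lin_in => j ? l ?; case: (tF i j l).
by apply: hsw_linear => j l; case: (tF i j l) => [? F2 F3]; split=> ?.
Qed.

Lemma hsw3_linear V W X U (F : nat -> V -> nat -> W -> nat -> X -> U) :
  graded_trilinear F -> linear (hsw3 F).
Proof. by move=> tF; apply: hsw_linear => i ?; apply: graded_trilinear_hsw. Qed.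

Lemma hsw3_pure V W X U (F : nat -> V -> nat -> W -> nat -> X -> U) i x t :
  graded_trilinear F -> homog i x -> hsw3 F (x ⊗ t) = hsw t (F i x).
Proof.
move=> tF hx; rewrite /hsw3.
exact: (@hsw_pure_l V (gtensor W X) U (fun i x yz => hsw yz (F i x)) i x t
  (graded_trilinear_hsw tF) hx).
Qed.

Lemma hsw3_pure3 V W X U (F : nat -> V -> nat -> W -> nat -> X -> U) i x j y l z :
  graded_trilinear F -> homog i x -> homog j y -> homog l z ->
  hsw3 F (x ⊗ (y ⊗ z)) = F i x j y l z.
Proof.
move=> tF hx hy hz; rewrite (hsw3_pure _ tF hx) (hsw_pure _ hy hz) //.
by move=> j' l'; case: (tF i j' l') => [? F2 F3]; split=> ?.
Qed.

(** [hsw3_double] and [hsw3_single] translate the two shapes of the triple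
    tensors that occur in (co)associativity statements. *)
Lemma hsw3_double V W X U (F : nat -> V -> nat -> W -> nat -> X -> U)
    (Y : gmodType k) (t : tensor Y X) (c : Y -> tensor V W) :
  graded_trilinear F -> linear c ->
  hsw3 F (sw t (fun a b => sw (c a) (fun a1 a2 => a1 ⊗ (a2 ⊗ b)))) =
  hsw t (fun _ a j b => hsw (c a) (fun p a1 q a2 => F p a1 q a2 j b)).
Proof.
move=> tF lc; have lF := hsw3_linear tF.
rewrite sw_hsw; last by lin.
rewrite (lin_hsw _ _ lF); apply: eq_hsw => i a j b ha hb.
rewrite sw_hsw; last by lin.
rewrite (lin_hsw _ _ lF); apply: eq_hsw => p a1 q a2 h1 h2.
exact: hsw3_pure3.
Qed.

Lemma hsw3_single V W X U (F : nat -> V -> nat -> W -> nat -> X -> U)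
    (Y : gmodType k) (t : tensor V Y) (c : Y -> tensor W X) :
  graded_trilinear F -> linear c ->
  hsw3 F (sw t (fun a b => a ⊗ c b)) = hsw t (fun i a _ b => hsw (c b) (F i a)).
Proof.
move=> tF lc; have lF := hsw3_linear tF.
rewrite sw_hsw; last by lin.
rewrite (lin_hsw _ _ lF); apply: eq_hsw => i a j b ha hb.
exact: hsw3_pure.
Qed.

Lemma hcop_assoc V (C : coalg_str V) U x
    (F : nat -> V -> nat -> V -> nat -> V -> U) :
  coalgebra C -> graded_trilinear F ->
  hsw (cop C x) (fun _ a j b => hsw (cop C a) (fun p c q d => F p c q d j b)) =
  hsw (cop C x) (fun i a _ b => hsw (cop C b) (fun p c q d => F i a p c q d)).
Proof.
case=> [lC _ CA _ _] tF; rewrite -hsw3_single // -CA.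
by rewrite hsw3_double.
Qed.


(** Coassociativity for four components, from the balanced bracketing
    (ab)(cd) to the bracketing a((bc)d) that isolates the middle pair. *)
Lemma hcop_assoc4 V (C : coalg_str V) U x
    (F : nat -> V -> nat -> V -> nat -> V -> nat -> V -> U) :
  coalgebra C -> graded_quadrilinear F ->
  hsw (cop C x) (fun _ y _ z => hsw (cop C y) (fun i a j b =>
    hsw (cop C z) (fun l c m d => F i a j b l c m d))) =
  hsw (cop C x) (fun i a _ y => hsw (cop C y) (fun _ z m d =>
    hsw (cop C z) (fun j b l c => F i a j b l c m d))).
Proof.
move=> coC qF; have [lC _ _ _ _] := coC.
have F1 i j l m b c d : linear (fun a => F i a j b l c m d).
  by case: (qF i j l m).
have F2 i j l m a c d : linear (fun b => F i a j b l c m d).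
  by case: (qF i j l m).
have F3 i j l m a b d : linear (fun c => F i a j b l c m d).
  by case: (qF i j l m).
have F4 i j l m a b c : linear (fun d => F i a j b l c m d).
  by case: (qF i j l m).
have bF i a j b : graded_bilinear (F i a j b) by move=> l m; split=> ?.
pose G i a j b (_ : nat) z := hsw (cop C z) (F i a j b).
have tG : graded_trilinear G.
  move=> i j l; split=> ? ?; rewrite /G.
  - by apply: hsw_lin_in => ? ? ? ?.
  - by apply: hsw_lin_in => ? ? ? ?.
  - exact: lin_comp (hsw_linear (bF _ _ _ _)) lC.
rewrite (hcop_assoc x coC tG); apply: eq_hsw => i a _ y _ _.
rewrite /G -(hcop_assoc y coC (F := F i a)) //.
Qed.

End GradedSums.

Section GradedHopf.
Variable k : fieldType.

(** A super Hopf algebra whose structure maps other than the counit and the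
    antipode preserve the degree and not only its parity. Both strongly
    bicovariant exterior algebras and ordinary Hopf algebras placed in degree 0 are of this kind. *)
Record graded_hopf (V : gmodType k) (H : hopf_str V) : Prop := GradedHopf {
  gh_super : super_hopf_algebra H;
  gh_one : homog 0 (aone H);
  gh_mul : forall i j x y,
    homog i x -> homog j y -> homog (i + j) (amul H x y);
  gh_cop : forall n x, homog n x -> homog (V := gtensor V V) n (cop H x) }.

(** The hypotheses on the action and the coaction that do not involve the
    differentials, stated for graded Hopf algebras so that they also cover the
    ordinary bicrossproduct. *)
Record super_bicrossproduct (OA OH : gmodType k) (sA : hopf_str OA)
    (sH : hopf_str OH) (act : OH -> OA -> OA) (beta : OH -> tensor OH OA) :
    Prop := SuperBicrossproduct {
  sb_act_homog : forall i j x w,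
    homog i x -> homog j w -> homog (i + j) (act x w);
  sb_module : super_module_algebra sH sA act;
  sb_beta_homog : forall i x,
    homog i x -> homog (V := gtensor OH OA) i (beta x);
  sb_comodule : super_comodule_coalgebra sH sA beta;
  sb_cou_act : forall x w, cou sA (act x w) = cou sH x * cou sA w;
  sb_cop_act : forall x w, cop sA (act x w) =
     gsw (cop sH x) (fun _ x1 i2 x2 =>
     gsw (beta x1) (fun _ x10 i11 x11 =>
     gsw (cop sA w) (fun j1 w1 _ w2 =>
       (-1) ^+ ((i11 + i2) * j1)%N *:
         (act x10 w1 ⊗ amul sA x11 (act x2 w2)))));
  sb_beta1 : beta (aone sH) = aone sH ⊗ aone sA;
  sb_betaM : forall x y, beta (amul sH x y) =
     gsw (cop sH x) (fun _ x1 i2 x2 =>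
     gsw (beta x1) (fun _ x10 i11 x11 =>
     gsw (beta y) (fun j0 y0 _ y1 =>
       (-1) ^+ ((i11 + i2) * j0)%N *:
         (amul sH x10 y0 ⊗ amul sA x11 (act x2 y1)))));
  sb_match : forall p x w, homog p w ->
     gsw (cop sH x) (fun i1 x1 _ x2 =>
     gsw (beta x2) (fun i20 x20 i21 x21 =>
       (-1) ^+ (p * i21 + i1 * i20)%N *:
         (x20 ⊗ amul sA (act x1 w) x21)))
     = sw (cop sH x) (fun x1 x2 =>
       sw (beta x1) (fun x10 x11 =>
         x10 ⊗ amul sA x11 (act x2 w))) }.

Section Rules.
Variables (V : gmodType k) (H : hopf_str V).
Hypothesis gH : graded_hopf H.
Implicit Type U : lmodType k.

Lemma gh_algebra : algebra H. Proof. by case: gH => -[]. Qed.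
Lemma gh_coalgebra : coalgebra H. Proof. by case: gH => -[]. Qed.
Lemma gh_mul_bilinear : is_bilinear (amul H). Proof. by case: gh_algebra. Qed.
Lemma gh_cop_linear : linear (cop H). Proof. by case: gh_coalgebra. Qed.
Lemma gh_cou_scalar : scalar (cou H). Proof. by case: gh_coalgebra. Qed.

(** Signs that involve the degree of an argument of the counit disappear: they
    are trivial for an even argument and the counit kills an odd one. *)
Lemma gh_cou_odd n x : homog n x -> odd n -> cou H x = 0.
Proof.
move=> hx on; apply: (super_hopf_cou_even (gh_super gH)) => m.
by rewrite (hcomp_homog _ hx); case: (m =P n) => // ->; rewrite on.
Qed.

Lemma gh_copM U x y (F : nat -> V -> nat -> V -> U) : graded_bilinear F ->
  hsw (cop H (amul H x y)) F =
  hsw (cop H x) (fun i a j b => hsw (cop H y) (fun p c q d =>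
    (-1) ^+ (j * p) *: F (i + p)%N (amul H a c) (j + q)%N (amul H b d))).
Proof.
move=> bF; have mH := gh_mul_bilinear.
have lH := gh_cop_linear.
rewrite (super_hopf_copM (gh_super gH)) /super_tensor_mul gsw_hsw; last by lin.
rewrite hsw_bind //; apply: eq_hsw => i a j b ha hb.
rewrite gsw_hsw; last by lin.
rewrite hsw_bind //; apply: eq_hsw => p c q d hc hd.
rewrite (linZ _ _ (hsw_linear bF)).
by rewrite (hsw_pure bF (gh_mul gH ha hc) (gh_mul gH hb hd)).
Qed.

End Rules.

Section SuperBicrossproduct.
Variables (OA OH : gmodType k) (sA : hopf_str OA) (sH : hopf_str OH).
Variables (act : OH -> OA -> OA) (beta : OH -> tensor OH OA).
Hypotheses (gA : graded_hopf sA) (gH : graded_hopf sH).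
Hypothesis SB : super_bicrossproduct sA sH act beta.
Implicit Type U : lmodType k.

Let mA := gh_mul_bilinear gA.
Let mH := gh_mul_bilinear gH.
Let lA := gh_cop_linear gA.
Let lH := gh_cop_linear gH.
Let eA := gh_cou_scalar gA.
Let eH := gh_cou_scalar gH.
Let mact : is_bilinear act. Proof. by case: (sb_module SB) => -[]. Qed.
Let lbeta : linear beta. Proof. by case: (sb_comodule SB) => -[]. Qed.

Lemma sb_cop_actF U x w (F : nat -> OA -> nat -> OA -> U) : graded_bilinear F ->
  hsw (cop sA (act x w)) F =
  hsw (cop sH x) (fun _ x1 i2 x2 => hsw (beta x1) (fun i10 x10 i11 x11 =>
  hsw (cop sA w) (fun j1 w1 j2 w2 => (-1) ^+ ((i11 + i2) * j1) *:
    F (i10 + j1)%N (act x10 w1) (i11 + (i2 + j2))%N (amul sA x11 (act x2 w2))))).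
Proof.
move=> bF; rewrite (sb_cop_act SB) gsw_hsw; last by lin.
rewrite hsw_bind //; apply: eq_hsw => i1 x1 i2 x2 h1 h2.
rewrite gsw_hsw; last by lin.
rewrite hsw_bind //; apply: eq_hsw => i10 x10 i11 x11 h10 h11.
rewrite gsw_hsw; last by lin.
rewrite hsw_bind //; apply: eq_hsw => j1 w1 j2 w2 hw1 hw2.
rewrite (linZ _ _ (hsw_linear bF)) (hsw_pure bF (sb_act_homog SB h10 hw1)
  (gh_mul gA h11 (sb_act_homog SB h2 hw2))) //.
Qed.

Lemma sb_betaMF U x y (F : nat -> OH -> nat -> OA -> U) : graded_bilinear F ->
  hsw (beta (amul sH x y)) F =
  hsw (cop sH x) (fun _ x1 i2 x2 => hsw (beta x1) (fun i10 x10 i11 x11 =>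
  hsw (beta y) (fun j0 y0 j1 y1 => (-1) ^+ ((i11 + i2) * j0) *:
    F (i10 + j0)%N (amul sH x10 y0) (i11 + (i2 + j1))%N (amul sA x11 (act x2 y1))))).
Proof.
move=> bF; rewrite (sb_betaM SB) gsw_hsw; last by lin.
rewrite hsw_bind //; apply: eq_hsw => i1 x1 i2 x2 h1 h2.
rewrite gsw_hsw; last by lin.
rewrite hsw_bind //; apply: eq_hsw => i10 x10 i11 x11 h10 h11.
rewrite gsw_hsw; last by lin.
rewrite hsw_bind //; apply: eq_hsw => j1 w1 j2 w2 hw1 hw2.
rewrite (linZ _ _ (hsw_linear bF)) (hsw_pure bF (gh_mul gH h10 hw1)
  (gh_mul gA h11 (sb_act_homog SB h2 hw2))) //.
Qed.

Lemma sb_actM p x a b : homog p a ->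
  act x (amul sA a b) = hsw (cop sH x) (fun _ x1 j x2 =>
    (-1) ^+ (j * p) *: amul sA (act x1 a) (act x2 b)).
Proof.
by move=> ha; case: (sb_module SB) => _ E _; rewrite (E p) // gsw_hsw //; lin.
Qed.

Lemma sb_coassoc U x (F : nat -> OH -> nat -> OA -> nat -> OA -> U) :
  graded_trilinear F ->
  hsw (beta x) (fun _ x0 j x1 =>
    hsw (beta x0) (fun p c q d => F p c q d j x1)) =
  hsw (beta x) (fun i x0 _ x1 => hsw (cop sA x1) (F i x0)).
Proof.
move=> tF; case: (sb_comodule SB) => [[_ CA _] _ _].
by rewrite -(hsw3_single _ tF lA) -CA (hsw3_double _ tF lbeta).
Qed.

Lemma sb_comodule_cop U x (F : nat -> OH -> nat -> OH -> nat -> OA -> U) :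
  graded_trilinear F ->
  hsw (beta x) (fun _ x0 j x1 =>
    hsw (cop sH x0) (fun p c q d => F p c q d j x1)) =
  hsw (cop sH x) (fun _ x1 _ x2 => hsw (beta x1) (fun i10 x10 i11 x11 =>
    hsw (beta x2) (fun i20 x20 i21 x21 => (-1) ^+ (i20 * i11) *:
      F i10 x10 i20 x20 (i11 + i21)%N (amul sA x11 x21)))).
Proof.
move=> tF; case: (sb_comodule SB) => [_ CA _]; have lF := hsw3_linear tF.
rewrite -(hsw3_double _ tF lH) CA sw_hsw; last by lin.
rewrite (lin_hsw _ _ lF); apply: eq_hsw => i1 x1 i2 x2 h1 h2.
rewrite gsw_hsw; last by lin.
rewrite (lin_hsw _ _ lF); apply: eq_hsw => i10 x10 i11 x11 h10 h11.
rewrite gsw_hsw; last by lin.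
rewrite (lin_hsw _ _ lF); apply: eq_hsw => i20 x20 i21 x21 h20 h21.
by rewrite (linZ _ _ lF) (hsw3_pure3 tF h10 h20 (gh_mul gA h11 h21)).
Qed.

(** The form of the matching condition in which it is applied below: inside a
    larger expression [F] of the two components. *)
Lemma sb_matchF U p x w (F : nat -> OH -> nat -> OA -> U) :
  homog p w -> graded_bilinear F ->
  hsw (cop sH x) (fun i1 x1 _ x2 => hsw (beta x2) (fun i20 x20 i21 x21 =>
    (-1) ^+ (p * i21 + i1 * i20) *:
      F i20 x20 (i1 + p + i21)%N (amul sA (act x1 w) x21))) =
  hsw (cop sH x) (fun _ x1 i2 x2 => hsw (beta x1) (fun i10 x10 i11 x11 =>
    F i10 x10 (i11 + (i2 + p))%N (amul sA x11 (act x2 w)))).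
Proof.
move=> hw bF; have lF := hsw_linear bF.
have := congr1 (fun t => hsw t F) (sb_match SB x hw).
rewrite gsw_hsw; last by lin.
rewrite sw_hsw; last by lin.
rewrite !hsw_bind // => E.
transitivity (hsw (cop sH x) (fun i1 x1 _ x2 => hsw (gsw (beta x2)
   (fun i20 x20 i21 x21 => (-1) ^+ (p * i21 + i1 * i20) *:
         (x20 ⊗ amul sA (act x1 w) x21))) F)).
  apply: eq_hsw => i1 x1 i2 x2 h1 h2; rewrite gsw_hsw; last by lin.
  rewrite hsw_bind //; apply: eq_hsw => i20 x20 i21 x21 h20 h21.
  by rewrite (linZ _ _ lF) (hsw_pure bF h20
    (gh_mul gA (sb_act_homog SB h1 hw) h21)).
rewrite E; apply: eq_hsw => i1 x1 i2 x2 h1 h2; rewrite sw_hsw; last by lin.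
rewrite hsw_bind //; apply: eq_hsw => i20 x20 i21 x21 h20 h21.
by rewrite (hsw_pure bF h20 (gh_mul gA h21 (sb_act_homog SB h2 hw))).
Qed.

(** The exchange of x past v. The outer sum splits x ⊗ v only to make the
    degree of v available for inhomogeneous v; [super_RE] is the usual formula
    for homogeneous v. Likewise for [super_Q]. *)
Definition super_R (x : OH) (v : OA) : tensor OA OH :=
  hsw (x ⊗ v) (fun _ x p v => hsw (cop sH x) (fun _ x1 j x2 =>
    (-1) ^+ (j * p) *: (act x1 v ⊗ x2))).

Definition super_Q (w : OA) (x : OH) : tensor OH OA :=
  hsw (w ⊗ x) (fun j w _ x => hsw (beta x) (fun i x0 _ x1 =>
    (-1) ^+ (j * i) *: (x0 ⊗ amul sA w x1))).

Lemma super_R_bilinear : is_bilinear super_R.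
Proof. by rewrite /super_R; lin. Qed.

Lemma super_Q_bilinear : is_bilinear super_Q.
Proof. by rewrite /super_Q; lin. Qed.

Lemma super_RE p x v : homog p v -> super_R x v =
  hsw (cop sH x) (fun _ x1 j x2 => (-1) ^+ (j * p) *: (act x1 v ⊗ x2)).
Proof.
move=> hv; rewrite /super_R (hsw_pure_r (f := fun x p v => hsw (cop sH x)
  (fun _ x1 j x2 => (-1) ^+ (j * p) *: (act x1 v ⊗ x2))) x _ hv) // => j; lin.
Qed.

Lemma super_QE j w x : homog j w -> super_Q w x =
  hsw (beta x) (fun i x0 _ x1 => (-1) ^+ (j * i) *: (x0 ⊗ amul sA w x1)).
Proof.
move=> hw; rewrite /super_Q (hsw_pure_l (f := fun j w x => hsw (beta x)
  (fun i x0 _ x1 => (-1) ^+ (j * i) *: (x0 ⊗ amul sA w x1))) x _ hw) // => i; lin.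
Qed.

Lemma super_RF U p x v (F : nat -> OA -> nat -> OH -> U) :
  homog p v -> graded_bilinear F -> hsw (super_R x v) F =
  hsw (cop sH x) (fun i x1 j x2 => (-1) ^+ (j * p) *: F (i + p)%N (act x1 v) j x2).
Proof.
move=> hv bF; rewrite (super_RE x hv) hsw_bind //.
apply: eq_hsw => i a j b ha hb; rewrite (linZ _ _ (hsw_linear bF)).
by rewrite (hsw_pure bF (sb_act_homog SB ha hv) hb).
Qed.

Lemma super_QF U j w x (F : nat -> OH -> nat -> OA -> U) :
  homog j w -> graded_bilinear F -> hsw (super_Q w x) F =
  hsw (beta x) (fun i x0 l x1 => (-1) ^+ (j * i) *: F i x0 (j + l)%N (amul sA w x1)).
Proof.
move=> hw bF; rewrite (super_QE x hw) hsw_bind //.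
apply: eq_hsw => i a l b ha hb; rewrite (linZ _ _ (hsw_linear bF)).
by rewrite (hsw_pure bF ha (gh_mul gA hw hb)).
Qed.

Let bR := super_R_bilinear.
Let bQ := super_Q_bilinear.

Lemma super_R1l v : super_R (aone sH) v = v ⊗ aone sH.
Proof.
apply: (graded_lin_ext (f := super_R (aone sH)) (g := fun v => v ⊗ aone sH));
  try lin.
move=> p {}v hv; rewrite (super_RE _ hv) (super_hopf_cop1 (gh_super gH)).
rewrite (hsw_pure _ (gh_one gH) (gh_one gH)); last by lin.
by case: (sb_module SB) => -[_ act1 _] _ _; rewrite act1 scale1r.
Qed.

Lemma super_R1r x : super_R x (aone sA) = aone sA ⊗ x.
Proof.
rewrite (super_RE _ (gh_one gA)).
have lf : linear (fun x : OH => aone sA ⊗ x) by lin.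
rewrite -[RHS](cou_l x (gh_coalgebra gH) lf) sw_hsw; last by lin.
apply: eq_hsw => i a j b ha hb; rewrite muln0 scale1r.
case: (sb_module SB) => _ _ ->.
by rewrite (linZ _ _ (bil_l (pure_bilinear _ _) _)).
Qed.

(** Moving a product xy past v moves y, then x. The sign |x2||y1| that comes
    from the super coproduct of xy is the one for moving x past y1 ▷ v, which
    has the degree of y1 in addition to that of v. *)
Lemma super_RMl x y v : super_R (amul sH x y) v =
  sw (super_R y v) (fun v' y' => sw (super_R x v')
    (fun v'' x' => v'' ⊗ amul sH x' y')).
Proof.
apply: (graded_lin_ext (f := fun v => super_R (amul sH x y) v)
  (g := fun v => sw (super_R y v) (fun v' y' => sw (super_R x v')
    (fun v'' x' => v'' ⊗ amul sH x' y')))); try lin.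
move=> p {}v hv; rewrite (super_RE _ hv) (gh_copM gH); last by lin.
rewrite sw_hsw; last by lin.
rewrite (super_RF _ hv); last by lin.
rewrite hsw_exchange; apply: eq_hsw => i a j b ha hb.
rewrite sw_hsw; last by lin.
rewrite (super_RF _ (sb_act_homog SB ha hv)); last by lin.
rewrite hsw_scale; apply: eq_hsw => i' a' j' b' ha' hb'.
case: (sb_module SB) => -[_ _ ->] _ _.
by sgn.
Qed.

Lemma super_RMr x u v : super_R x (amul sA u v) =
  sw (super_R x u) (fun u' x' => sw (super_R x' v)
    (fun v' x'' => amul sA u' v' ⊗ x'')).
Proof.
apply: (graded_lin_ext (f := fun v => super_R x (amul sA u v))
  (g := fun v => sw (super_R x u) (fun u' x' => sw (super_R x' v)
    (fun v' x'' => amul sA u' v' ⊗ x'')))); try lin.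
move=> p {}v hv.
apply: (graded_lin_ext (f := fun u => super_R x (amul sA u v))
  (g := fun u => sw (super_R x u) (fun u' x' => sw (super_R x' v)
    (fun v' x'' => amul sA u' v' ⊗ x'')))); try lin.
move=> m {}u hu.
transitivity (hsw (cop sH x) (fun i a _ b => hsw (cop sH b) (fun j c l d =>
  (-1) ^+ ((j + l) * m + l * p) *: (amul sA (act a u) (act c v) ⊗ d)))).
  rewrite -(hcop_assoc _ (gh_coalgebra gH)); last by lin.
  rewrite (super_RE _ (gh_mul gA hu hv)); apply: eq_hsw => i a j b ha hb.
  rewrite (sb_actM _ _ hu) (lin_hsw _ _ (bil_l (pure_bilinear _ _) _)) hsw_scale.
  apply: eq_hsw_homog (gh_cop gH ha) _ => p' c q d hc hd _.
  rewrite (linZ _ _ (bil_l (pure_bilinear _ _) _)).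
  by sgn.
rewrite sw_hsw; last by lin.
rewrite (super_RF _ hu); last by lin.
apply: eq_hsw => i a j b ha hb; rewrite sw_hsw; last by lin.
rewrite (super_RF _ hv) ?hsw_scale; last by lin.
apply: eq_hsw_homog (gh_cop gH hb) _ => j' c l d hc hd <-.
by sgn.
Qed.

(** The counits remove Q. The remaining sign has a factor |x^(0)|, resp. |w|,
    which is even where the counit does not vanish. *)
Lemma super_Qcou_l w x :
  sw (super_Q w x) (fun x' w' => cou sH x' *: w') = cou sH x *: w.
Proof.
apply: (graded_lin_ext (f := fun w => sw (super_Q w x) (fun x' w' => cou sH x' *: w'))
  (g := fun w => cou sH x *: w)); try lin.
move=> j {}w hw; rewrite sw_hsw; last by lin.
rewrite (super_QF _ hw); last by lin.
case: (sb_comodule SB) => _ _ Bc; have [_ _ _ A1] := gh_algebra gA.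
rewrite -[in RHS](A1 w) -(linZ _ _ (bil_r mA _)) -Bc.
rewrite sw_hsw; last by lin.
rewrite (lin_hsw _ _ (bil_r mA _)); apply: eq_hsw => i a l b ha hb.
rewrite (linZ _ _ (bil_r mA _)).
have [oi|ei] := boolP (odd i).
  by rewrite (gh_cou_odd gH ha oi) !scale0r scaler0.
by rewrite -signr_odd oddM (negPf ei) andbF scale1r.
Qed.

Lemma super_Qcou_r w x :
  sw (super_Q w x) (fun x' w' => cou sA w' *: x') = cou sA w *: x.
Proof.
apply: (graded_lin_ext (f := fun w => sw (super_Q w x) (fun x' w' => cou sA w' *: x'))
  (g := fun w => cou sA w *: x)); try lin.
move=> j {}w hw; rewrite sw_hsw; last by lin.
rewrite (super_QF _ hw); last by lin.
case: (sb_comodule SB) => -[_ _ Bc] _ _; rewrite -[in RHS](Bc x).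
rewrite sw_hsw; last by lin.
rewrite hsw_scale; apply: eq_hsw => i a l b ha hb.
rewrite (super_hopf_couM (gh_super gA)) -scalerA.
have [oj|ej] := boolP (odd j).
  by rewrite (gh_cou_odd gA hw oj) !scale0r scaler0.
by rewrite -signr_odd oddM (negPf ej) scale1r.
Qed.

(** The two coproducts pass through Q one tensor factor at a time: this is the
    comodule coalgebra condition here, and the coaction axiom with the super
    multiplicativity of Δ on Ω(A) in [super_Qcop_r]. *)
Lemma super_Qcop_l w x :
  sw (super_Q w x) (fun x' w' => sw (cop sH x') (fun x1 x2 => x1 ⊗ (x2 ⊗ w'))) =
  sw (cop sH x) (fun x1 x2 => sw (super_Q w x1) (fun x1' w' =>
    sw (super_Q w' x2) (fun x2' w'' => x1' ⊗ (x2' ⊗ w'')))).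
Proof.
apply: (graded_lin_ext (f := fun w => sw (super_Q w x)
    (fun x' w' => sw (cop sH x') (fun x1 x2 => x1 ⊗ (x2 ⊗ w'))))
  (g := fun w => sw (cop sH x) (fun x1 x2 => sw (super_Q w x1) (fun x1' w' =>
    sw (super_Q w' x2) (fun x2' w'' => x1' ⊗ (x2' ⊗ w'')))))); try lin.
move=> m {}w hw; rewrite sw_hsw; last by lin.
rewrite (super_QF _ hw); last by lin.
transitivity (hsw (beta x) (fun _ x0 j x1 => hsw (cop sH x0) (fun p a q b =>
  (-1) ^+ (m * (p + q)) *: (a ⊗ (b ⊗ amul sA w x1))))).
  apply: eq_hsw => i x0 j x1 h0 h1; rewrite sw_hsw; last by lin.
  rewrite hsw_scale; apply: eq_hsw_homog (gh_cop gH h0) _ => p a q b ha hb <-.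
  by sgn.
rewrite sb_comodule_cop; last by lin.
rewrite [RHS]sw_hsw; last by lin.
apply: eq_hsw => i1 x1 i2 x2 h1 h2; rewrite [RHS]sw_hsw; last by lin.
rewrite (super_QF _ hw); last by lin.
apply: eq_hsw => i10 x10 i11 x11 h10 h11; rewrite [in RHS]sw_hsw; last by lin.
rewrite (super_QF _ (gh_mul gA hw h11)) ?hsw_scale; last by lin.
apply: eq_hsw => i20 x20 i21 x21 h20 h21.
have [_ AA _ _] := gh_algebra gA; rewrite AA.
by sgn.
Qed.

Lemma super_Qcop_r w x :
  sw (super_Q w x) (fun x' w' => sw (cop sA w') (fun w1 w2 => x' ⊗ (w1 ⊗ w2))) =
  sw (cop sA w) (fun w1 w2 => sw (super_Q w2 x) (fun x' w2' =>
    sw (super_Q w1 x') (fun x'' w1' => x'' ⊗ (w1' ⊗ w2')))).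
Proof.
apply: (graded_lin_ext (f := fun w => sw (super_Q w x)
    (fun x' w' => sw (cop sA w') (fun w1 w2 => x' ⊗ (w1 ⊗ w2))))
  (g := fun w => sw (cop sA w) (fun w1 w2 => sw (super_Q w2 x) (fun x' w2' =>
    sw (super_Q w1 x') (fun x'' w1' => x'' ⊗ (w1' ⊗ w2')))))); try lin.
move=> m {}w hw; rewrite sw_hsw; last by lin.
rewrite (super_QF _ hw); last by lin.
rewrite [RHS]sw_hsw; last by lin.
transitivity (hsw (cop sA w) (fun i1 w1 i2 w2 => hsw (beta x)
  (fun _ x0 j x1 => hsw (beta x0) (fun p c q d =>
    (-1) ^+ ((i1 + i2) * p + i2 * q) *:
       (c ⊗ (amul sA w1 d ⊗ amul sA w2 x1)))))).
  under [RHS]eq_hsw => i1 w1 i2 w2 h1 h2.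
    rewrite sb_coassoc; last by lin.
    over.
  rewrite hsw_exchange; apply: eq_hsw => i x0 j x1 h0 h1.
  rewrite sw_hsw; last by lin.
  rewrite (gh_copM gA) ?hsw_scale; last by lin.
  apply: eq_hsw_homog (gh_cop gA hw) _ => i1 w1 i2 w2 hw1 hw2 <-.
  rewrite hsw_scale; apply: eq_hsw => j1 v1 j2 v2 hv1 hv2.
  by sgn.
apply: eq_hsw => i1 w1 i2 w2 h1 h2; rewrite [RHS]sw_hsw; last by lin.
rewrite (super_QF _ h2); last by lin.
apply: eq_hsw => i x0 j x1 hx0 hx1; rewrite [in RHS]sw_hsw; last by lin.
rewrite (super_QF _ h1) ?hsw_scale; last by lin.
apply: eq_hsw_homog (sb_beta_homog SB hx0) _ => p c q d hc hd <-.
by sgn.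
Qed.

End SuperBicrossproduct.

End GradedHopf.

(** * The super bicrossproduct is a super Hopf algebra *)
Section SuperTensorAlgebra.
Variables (k : fieldType) (V : gmodType k) (A : alg_str V).
Hypotheses (mA : is_bilinear (amul A)) (AA : associative (amul A)).
Hypothesis degA : forall i j x y,
  homog i x -> homog j y -> homog (i + j) (amul A x y).

Local Notation stm := (super_tensor_mul A A).

Lemma super_tensor_mul_bilinear : is_bilinear stm.
Proof. by rewrite /super_tensor_mul; lin. Qed.

Lemma super_tensor_mul_pure i j p q a b c d :
  homog i a -> homog j b -> homog p c -> homog q d ->
  stm (a ⊗ b) (c ⊗ d) = (-1) ^+ (j * p) *: (amul A a c ⊗ amul A b d).
Proof.
move=> ha hb hc hd; rewrite /super_tensor_mul (gsw_homog _ ha hb); last by lin.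
by rewrite (gsw_homog _ hc hd); last by lin.
Qed.

Lemma super_tensor_mulA : associative stm.
Proof.
have bm := super_tensor_mul_bilinear.
move=> s t r.
apply: (graded_tensor_lin_ext (f := fun s => stm s (stm t r))
  (g := fun s => stm (stm s t) r)); try lin.
move=> i j a b ha hb {s}.
apply: (graded_tensor_lin_ext (f := fun t => stm (a ⊗ b) (stm t r))
  (g := fun t => stm (stm (a ⊗ b) t) r)); try lin.
move=> p q c d hc hd {t}.
apply: (graded_tensor_lin_ext (f := fun r => stm (a ⊗ b) (stm (c ⊗ d) r))
  (g := fun r => stm (stm (a ⊗ b) (c ⊗ d)) r)); try lin.
move=> l m e f he hf {r}.
rewrite (super_tensor_mul_pure hc hd he hf) (super_tensor_mul_pure ha hb hc hd).
rewrite (linZ _ _ (bil_r bm _)) (linZ _ _ (bil_l bm _)).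
rewrite (super_tensor_mul_pure ha hb (degA hc he) (degA hd hf)).
rewrite (super_tensor_mul_pure (degA ha hc) (degA hb hd) he hf) !AA.
by sgn.
Qed.

End SuperTensorAlgebra.

Section Parity.
Variable k : fieldType.
Implicit Types V W : gmodType k.

Lemma homog_has_parity V n (x : V) : homog n x -> has_parity (odd n) x.
Proof. by move=> hx m; rewrite (hcomp_homog _ hx); case: (m =P n) => // ->; case: odd. Qed.

Lemma has_parity0 V p : has_parity p (0 : V).
Proof. by move=> n _; apply: homog0. Qed.

Lemma has_parityD V p (x y : V) :
  has_parity p x -> has_parity p y -> has_parity p (x + y).
Proof. by move=> px py n np; rewrite (linD _ _ (@lin_hcomp _ V n)) px ?py ?addr0. Qed.

Lemma has_parityZ V p c (x : V) : has_parity p x -> has_parity p (c *: x).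
Proof. by move=> px n np; rewrite (linZ _ _ (@lin_hcomp _ V n)) px ?scaler0. Qed.

Lemma has_parity_sum V p I (r : seq I) (F : I -> V) :
  (forall i, has_parity p (F i)) -> has_parity p (\sum_(i <- r) F i).
Proof.
move=> hF; apply: big_rec => [|i x _]; first exact: has_parity0.
exact: has_parityD.
Qed.

(** Evenness of a map follows from its values on elements of pure degree; the
    weaker conclusion on parities is needed because the antipodes of the two
    factors are only known to preserve the parity. *)
Lemma has_parity_linear V W p (f : V -> W) x : linear f ->
  (forall n y, homog n y -> has_parity (odd n) (f y)) ->
  has_parity p x -> has_parity p (f x).
Proof.
move=> lf hf px; rewrite [x]degboundE (lin_sum _ _ lf).
apply: has_parity_sum => n; have [on|no] := eqVneq (odd n) p.
  by rewrite -on; apply: hf; apply: homog_hcomp.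
by rewrite px // (lin0 lf); apply: has_parity0.
Qed.

Lemma has_parity_bilinear V W (X : gmodType k) p q (f : V -> W -> X) x y :
  is_bilinear f ->
  (forall i j a b, homog i a -> homog j b -> homog (i + j) (f a b)) ->
  has_parity p x -> has_parity q y -> has_parity (p (+) q) (f x y).
Proof.
move=> [lr ll] hf px py; rewrite [x]degboundE (lin_sum _ _ (ll y)).
apply: has_parity_sum => i; have [<-|no] := eqVneq (odd i) p; last first.
  by rewrite px // (lin0 (ll _)); apply: has_parity0.
rewrite [y]degboundE (lin_sum _ _ (lr _)).
apply: has_parity_sum => j; have [<-|no] := eqVneq (odd j) q; last first.
  by rewrite py // (lin0 (lr _)); apply: has_parity0.
by rewrite -oddD; apply: homog_has_parity; apply: hf; apply: homog_hcomp.
Qed.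

Lemma has_parity_hsw V W (X : gmodType k) n p (t : tensor V W)
    (F : nat -> V -> nat -> W -> X) :
  homog (V := gtensor V W) n t ->
  (forall i x j y, homog i x -> homog j y -> (i + j)%N = n ->
     has_parity p (F i x j y)) -> has_parity p (hsw t F).
Proof.
move=> ht hF m mp; rewrite (lin_hsw _ _ (@lin_hcomp _ X m)).
transitivity (hsw t (fun i a j b => 0 : X)); last exact: big1_eq.
by apply: eq_hsw_homog ht _ => i x j y hx hy ij; rewrite (hF i x j y hx hy ij).
Qed.

End Parity.

Section Comultiplication.
Variables (k : fieldType) (OA OH : gmodType k) (sA : hopf_str OA) (sH : hopf_str OH).
Variables (act : OH -> OA -> OA) (beta : OH -> tensor OH OA).
Hypotheses (gA : graded_hopf sA) (gH : graded_hopf sH).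
Hypothesis SB : super_bicrossproduct sA sH act beta.

Let mA := gh_mul_bilinear gA.
Let mH := gh_mul_bilinear gH.
Let lA := gh_cop_linear gA.
Let lH := gh_cop_linear gH.
Let eA := gh_cou_scalar gA.
Let eH := gh_cou_scalar gH.
Let mact : is_bilinear act. Proof. by case: (sb_module SB) => -[]. Qed.
Let lbeta : linear beta. Proof. by case: (sb_comodule SB) => -[]. Qed.

Local Notation R := (super_R sH act).
Local Notation Q := (super_Q sA beta).
Local Notation B := (gtensor OA OH).
Let bR := super_R_bilinear gH SB.
Let bQ := super_Q_bilinear gA SB.

Definition super_fact_str : hopf_str B :=
  @HopfStr k B (fact_alg sA sH R) (fact_coalg sA sH Q).

(** The signs in the product and coproduct of the super bicrossproduct are
    exactly those of R and Q. *)
Lemma super_bicross_strE : super_bicross_str sA sH act beta = super_fact_str.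
Proof.
rewrite /super_bicross_str /super_fact_str; congr HopfStr.
  congr AlgStr; apply: funext => s; apply: funext => t.
  have bm := fact_mul_bilinear (gh_algebra gA) (gh_algebra gH) bR.
  pose m' s t := sw s (fun w x => gsw t (fun p v _ y =>
     gsw (cop sH x) (fun _ x1 j x2 =>
       (-1) ^+ (j * p)%N *: (amul sA w (act x1 v) ⊗ amul sH x2 y)))).
  have bm' : is_bilinear m' by rewrite /m'; lin.
  apply: (tensor_lin_ext (f := fun s => m' s t)
    (g := fun s => fact_mul sA sH R s t)); try lin.
  move=> w x {s}; apply: (graded_tensor_lin_ext (f := fun t => m' (w ⊗ x) t)
    (g := fun t => fact_mul sA sH R (w ⊗ x) t)); try lin.
  move=> p q v y hv hy {t}; rewrite /m' sw_pure; last by lin.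
  rewrite (gsw_homog _ hv hy); last by lin.
  rewrite (fact_mul_pure (gh_algebra gA) (gh_algebra gH) bR) gsw_hsw; last by lin.
  rewrite sw_hsw; last by lin.
  by rewrite (super_RF gH SB _ hv) //; lin.
congr CoalgStr; apply: funext => t.
pose c' t := sw t (fun w x => gsw (cop sA w) (fun _ w1 j w2 =>
   sw (cop sH x) (fun x1 x2 => gsw (beta x1) (fun i x10 _ x11 =>
     (-1) ^+ (j * i)%N *: ((w1 ⊗ x10) ⊗ (amul sA w2 x11 ⊗ x2)))))).
have lc' : linear c' by rewrite /c'; lin.
have lc := fact_cop_linear (gh_coalgebra gA) (gh_coalgebra gH) bQ.
apply: (tensor_lin_ext (f := c') (g := fact_cop sA sH Q)) => // w x.
rewrite /c' sw_pure; last by lin.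
rewrite (fact_cop_pure (gh_coalgebra gA) (gh_coalgebra gH) bQ) gsw_hsw; last by lin.
rewrite [RHS]sw_hsw; last by lin.
apply: eq_hsw => i1 w1 i2 w2 h1 h2; apply: eq_sw => x1 x2.
rewrite gsw_hsw; last by lin.
rewrite sw_hsw; last by lin.
by rewrite (super_QF gA SB _ h2) //; lin.
Qed.

Lemma super_fact_algebra : algebra super_fact_str.
Proof.
apply: (fact_algebra (gh_algebra gA) (gh_algebra gH) bR).
- exact: super_R1l gH SB.
- exact: super_R1r gA gH SB.
- exact: super_RMl gH SB.
- exact: super_RMr gA gH SB.
Qed.

Lemma super_fact_coalgebra : coalgebra super_fact_str.
Proof.
apply: (fact_coalgebra (gh_coalgebra gA) (gh_coalgebra gH) bQ).
- exact: super_Qcou_l gA gH SB.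
- exact: super_Qcou_r gA SB.
- exact: super_Qcop_l gA gH SB.
- exact: super_Qcop_r gA SB.
Qed.

Lemma super_R_homog i j x v : homog i x -> homog j v ->
  homog (V := B) (i + j) (R x v).
Proof.
move=> hx hv; rewrite (super_RE gH SB x hv).
apply: homog_hsw (gh_cop gH hx) _ => i1 x1 i2 x2 h1 h2 <-.
apply: homogZ; rewrite addnAC.
by apply: homog_pure => //; apply: (sb_act_homog SB h1 hv).
Qed.

Lemma super_Q_homog i j w x : homog i w -> homog j x ->
  homog (V := gtensor OH OA) (i + j) (Q w x).
Proof.
move=> hw hx; rewrite (super_QE gA SB x hw).
apply: homog_hsw (sb_beta_homog SB hx) _ => i1 x1 i2 x2 h1 h2 <-.
apply: homogZ; rewrite addnCA; apply: homog_pure => //.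
exact: (gh_mul gA hw h2).
Qed.

Let bm : is_bilinear (fact_mul sA sH R).
Proof. exact: fact_mul_bilinear (gh_algebra gA) (gh_algebra gH) bR. Qed.
Let lc : linear (fact_cop sA sH Q).
Proof. exact: fact_cop_linear (gh_coalgebra gA) (gh_coalgebra gH) bQ. Qed.

Lemma super_fact_mul_homog i j (s t : B) : homog i s -> homog j t ->
  homog (V := B) (i + j) (fact_mul sA sH R s t).
Proof.
move=> hs ht; rewrite /fact_mul sw_hsw; last by lin.
apply: homog_hsw hs _ => i1 w i2 x hw hx <-; rewrite sw_hsw; last by lin.
apply: homog_hsw ht _ => j1 v j2 y hv hy <-; rewrite sw_hsw; last by lin.
apply: homog_hsw (super_R_homog hx hv) _ => l1 v' l2 x' hv' hx' l12.
have -> : (i1 + i2 + (j1 + j2) = (i1 + l1) + (l2 + j2))%N.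
  by rewrite -addnA (addnA i2) -l12 !addnA.
by apply: homog_pure; [apply: (gh_mul gA) | apply: (gh_mul gH)].
Qed.

Lemma super_fact_cop_homog n (t : B) : homog n t ->
  homog (V := gtensor B B) n (fact_cop sA sH Q t).
Proof.
move=> ht; rewrite /fact_cop sw_hsw; last by lin.
apply: homog_hsw ht _ => i w j x hw hx <-; rewrite sw_hsw; last by lin.
apply: homog_hsw (gh_cop gA hw) _ => i1 w1 i2 w2 hw1 hw2 <-.
rewrite sw_hsw; last by lin.
apply: homog_hsw (gh_cop gH hx) _ => j1 x1 j2 x2 hx1 hx2 <-.
rewrite sw_hsw; last by lin.
apply: homog_hsw (super_Q_homog hw2 hx1) _ => l1 x' l2 w' hx' hw' l12.
have -> : (i1 + i2 + (j1 + j2) = (i1 + l1) + (l2 + j2))%N.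
  by rewrite -addnA (addnA i2) -l12 !addnA.
by apply: (homog_pure (V := B) (W := B)); apply: homog_pure.
Qed.

Local Notation stm := (super_tensor_mul super_fact_str super_fact_str).
Local Notation mulB := (fact_mul sA sH R).
Local Notation copB := (fact_cop sA sH Q).
Let bst : is_bilinear stm := @super_tensor_mul_bilinear k B super_fact_str bm.
Let stm_pure := @super_tensor_mul_pure k B super_fact_str bm.

Lemma super_Q1r w : Q w (aone sH) = aone sH ⊗ w.
Proof.
apply: (graded_lin_ext (f := fun w => Q w (aone sH)) (g := fun w => aone sH ⊗ w));
  try lin.
move=> j {}w hw; rewrite (super_QE gA SB _ hw) (sb_beta1 SB).
rewrite (hsw_pure _ (gh_one gH) (gh_one gA)); last by lin.
by have [_ _ _ A1] := gh_algebra gA; rewrite muln0 scale1r A1.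
Qed.

Lemma super_Q1l x : Q (aone sA) x = beta x.
Proof.
rewrite (super_QE gA SB _ (gh_one gA)) -[RHS]hsw_id.
apply: eq_hsw => i a j b _ _; have [_ _ A1 _] := gh_algebra gA.
by rewrite mul0n scale1r A1.
Qed.

Lemma mul_left_pure w v y : mulB (w ⊗ aone sH) (v ⊗ y) = amul sA w v ⊗ y.
Proof.
rewrite (fact_mul_pure (gh_algebra gA) (gh_algebra gH) bR) (super_R1l gH SB).
by have [_ _ H1 _] := gh_algebra gH; rewrite sw_pure ?H1 //; lin.
Qed.

Lemma mul_pure_right w x y : mulB (w ⊗ x) (aone sA ⊗ y) = w ⊗ amul sH x y.
Proof.
rewrite (fact_mul_pure (gh_algebra gA) (gh_algebra gH) bR) (super_R1r gA gH SB).
by have [_ _ _ A1] := gh_algebra gA; rewrite sw_pure ?A1 //; lin.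
Qed.

Lemma mul_right_left x v : mulB (aone sA ⊗ x) (v ⊗ aone sH) = R x v.
Proof.
rewrite (fact_mul_pure (gh_algebra gA) (gh_algebra gH) bR) -[RHS]sw_id.
have [_ _ A1 _] := gh_algebra gA; have [_ _ _ H1] := gh_algebra gH.
by apply: eq_sw => a b; rewrite A1 H1.
Qed.

Lemma mul_pure_left w x v : mulB (w ⊗ x) (v ⊗ aone sH) =
  sw (R x v) (fun v' x' => amul sA w v' ⊗ x').
Proof.
rewrite (fact_mul_pure (gh_algebra gA) (gh_algebra gH) bR).
have [_ _ _ H1] := gh_algebra gH.
by apply: eq_sw => a b; rewrite H1.
Qed.

Lemma cop_left w : copB (w ⊗ aone sH) =
  hsw (cop sA w) (fun _ w1 _ w2 => (w1 ⊗ aone sH) ⊗ (w2 ⊗ aone sH)).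
Proof.
rewrite (fact_cop_pure (gh_coalgebra gA) (gh_coalgebra gH) bQ) sw_hsw; last by lin.
apply: eq_hsw => i w1 j w2 _ _; rewrite (super_hopf_cop1 (gh_super gH)).
rewrite sw_pure; last by lin.
by rewrite super_Q1r sw_pure //; lin.
Qed.

Lemma cop_right x : copB (aone sA ⊗ x) =
  hsw (cop sH x) (fun _ x1 _ x2 => hsw (beta x1) (fun _ x10 _ x11 =>
    (aone sA ⊗ x10) ⊗ (x11 ⊗ x2))).
Proof.
rewrite (fact_cop_pure (gh_coalgebra gA) (gh_coalgebra gH) bQ).
rewrite (super_hopf_cop1 (gh_super gA)) sw_pure; last by lin.
rewrite sw_hsw; last by lin.
apply: eq_hsw => i x1 j x2 _ _; rewrite super_Q1l.
by rewrite sw_hsw //; lin.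
Qed.

Let one_l i x : homog i x -> homog (V := B) i (aone sA ⊗ x).
Proof. by move=> hx; apply: (homog_pure (gh_one gA) hx). Qed.

Let one_r i w : homog i w -> homog (V := B) i (w ⊗ aone sH).
Proof. by move=> hw; rewrite -[i]addn0; apply: (homog_pure hw (gh_one gH)). Qed.

(** Multiplicativity of the coproduct is proved first for the four kinds of
    products of elements w ⊗ 1 and 1 ⊗ x. *)
Lemma cop_left_right w x :
  copB (w ⊗ x) = stm (copB (w ⊗ aone sH)) (copB (aone sA ⊗ x)).
Proof.
rewrite (fact_cop_pure (gh_coalgebra gA) (gh_coalgebra gH) bQ) sw_hsw; last by lin.
rewrite cop_left cop_right (lin_hsw _ _ (bil_l bst _)).
apply: eq_hsw => i w1 j w2 h1 h2; rewrite sw_hsw; last by lin.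
rewrite (lin_hsw _ _ (bil_r bst _)); apply: eq_hsw => p x1 q x2 hx1 hx2.
rewrite (lin_hsw _ _ (bil_r bst _)) sw_hsw; last by lin.
rewrite (super_QF gA SB _ h2); last by lin.
apply: eq_hsw => p0 x10 p1 x11 h10 h11.
rewrite (stm_pure (one_r h1) (one_r h2) (one_l h10)
  (homog_pure h11 hx2)) /= !mul_left_pure.
by have [_ _ _ A1] := gh_algebra gA; rewrite A1.
Qed.

Lemma cop_left_left w v :
  copB (amul sA w v ⊗ aone sH) = stm (copB (w ⊗ aone sH)) (copB (v ⊗ aone sH)).
Proof.
rewrite !cop_left (gh_copM gA); last by lin.
rewrite (lin_hsw _ _ (bil_l bst _)); apply: eq_hsw => i w1 j w2 h1 h2.
rewrite (lin_hsw _ _ (bil_r bst _)); apply: eq_hsw => p v1 q v2 hv1 hv2.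
rewrite (stm_pure (one_r h1) (one_r h2) (one_r hv1) (one_r hv2)).
by rewrite /= !mul_left_pure.
Qed.

(** Here Δ((1 ⊗ x)(1 ⊗ y)) is given by β((xy)_1), and the exchange R of x2 past
    y1^(1) in the product of the coproducts yields the action that occurs in
    the formula for β of a product. *)
Lemma cop_right_right x y :
  copB (aone sA ⊗ amul sH x y) = stm (copB (aone sA ⊗ x)) (copB (aone sA ⊗ y)).
Proof.
rewrite !cop_right (gh_copM gH); last by lin.
transitivity (hsw (cop sH x) (fun _ z q d => hsw (cop sH z) (fun _ a i b =>
  hsw (cop sH y) (fun _ y1 _ y2 => hsw (beta a) (fun _ a0 i1 a1 =>
  hsw (beta y1) (fun j0 y0 j1 y1' => (-1) ^+ (q * (j0 + j1) + (i1 + i) * j0) *: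
    ((aone sA ⊗ amul sH a0 y0) ⊗
     (amul sA a1 (act b y1') ⊗ amul sH d y2)))))))).
  apply: eq_hsw => i x1 q x2 h1 h2; rewrite [RHS]hsw_exchange.
  apply: eq_hsw => p y1 p' y2 hy1 hy2.
  rewrite (sb_betaMF gA gH SB) ?hsw_scale; last by lin.
  apply: eq_hsw => l a m b ha hb; rewrite hsw_scale.
  apply: eq_hsw => l0 a0 l1 a1 ha0 ha1; rewrite hsw_scale.
  apply: eq_hsw_homog (sb_beta_homog SB hy1) _ => j0 y0 j1 y1' hy0 hy1' <-.
  by sgn.
rewrite hcop_assoc //; [|exact: gh_coalgebra gH|by lin].
rewrite (lin_hsw _ _ (bil_l bst _)); apply: eq_hsw => l a m z ha hz.
rewrite (lin_hsw _ _ (bil_l bst _)).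
under eq_hsw => j b q d hb hd do rewrite hsw_exchange.
rewrite hsw_exchange; apply: eq_hsw => i a0 i1 a1 ha0 ha1.
rewrite (lin_hsw _ _ (bil_r bst _)) hsw_exchange.
apply: eq_hsw => p y1 p' y2 hy1 hy2.
rewrite (lin_hsw _ _ (bil_r bst _)) hsw_exchange.
apply: eq_hsw => j0 y0 j1 y1' hy0 hy1'.
rewrite (stm_pure (one_l ha0) (homog_pure ha1 hz) (one_l hy0)
  (homog_pure hy1' hy2)) /= mul_pure_right.
rewrite (fact_mul_pure (gh_algebra gA) (gh_algebra gH) bR) sw_hsw; last by lin.
rewrite (super_RF gH SB _ hy1'); last by lin.
rewrite (lin_hsw _ _ (bil_r (pure_bilinear _ _) _)) hsw_scale.
apply: eq_hsw_homog (gh_cop gH hz) _ => j b q d hb hd <-.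
rewrite (linZ _ _ (bil_r (pure_bilinear _ _) _)).
by sgn.
Qed.

(** Split x into a, b, c, d. Up to signs, on the left Δ of R(x,v) is the sum of
    a^(0) ▷ v1 ⊗ c^(0) ⊗ a^(1) (b ▷ v2) c^(1) ⊗ d. The matching condition for the
    pair (b,c) replaces it by a^(0) ▷ v1 ⊗ b^(0) ⊗ a^(1) b^(1) (c ▷ v2) ⊗ d. On the
    right, the comodule coalgebra condition for the pair (a,b) gives the same
    sum. *)
Lemma cop_right_left x v :
  copB (R x v) = stm (copB (aone sA ⊗ x)) (copB (v ⊗ aone sH)).
Proof.
apply: (graded_lin_ext (f := fun v => copB (R x v))
  (g := fun v => stm (copB (aone sA ⊗ x)) (copB (v ⊗ aone sH)))); try lin.
move=> p {}v hv.
pose G (a0 : OH) v1 (b0 : OH) (u : OA) (d : OH) : tensor B B :=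
  (act a0 v1 ⊗ b0) ⊗ (u ⊗ d).
transitivity (hsw (cop sH x) (fun _ a _ r => hsw (cop sH r) (fun iz z l d =>
  hsw (beta a) (fun _ a0 i1 a1 => hsw (cop sA v) (fun j1 v1 j2 v2 =>
  hsw (cop sH z) (fun _ b _ c => hsw (beta b) (fun m0 b0 _ b1 =>
  (-1) ^+ (l * (j1 + j2) + iz * j1 + i1 * j1 + i1 * m0) *:
    G a0 v1 b0 (amul sA a1 (amul sA b1 (act c v2))) d))))))).
  (* In the next exponent, j2 * m1 + i * m0 is the sign of the matching condition
     for (b, q); what remains depends on b and q only through their total degree
     and the degree m0. *)
  rewrite (super_RE gH SB _ hv) (lin_hsw _ _ lc).
  transitivity (hsw (cop sH x) (fun _ y _ z => hsw (cop sH y) (fun _ a i b =>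
    hsw (cop sH z) (fun iq q l d => hsw (beta a) (fun _ a0 i1 a1 =>
    hsw (cop sA v) (fun j1 v1 j2 v2 => hsw (beta q) (fun m0 c0 m1 c1 =>
    (-1) ^+ (l * (j1 + j2) + (i + iq) * j1 + i1 * j1 + i1 * m0
             + (j2 * m1 + i * m0)) *:
    G a0 v1 c0 (amul sA (amul sA a1 (act b v2)) c1) d))))))).
    apply: eq_hsw => iy y iz z hy hz; rewrite (linZ _ _ lc).
    rewrite (fact_cop_pure (gh_coalgebra gA) (gh_coalgebra gH) bQ).
    rewrite sw_hsw; last by lin.
    rewrite (sb_cop_actF gA SB) ?hsw_scale; last by lin.
    apply: eq_hsw => ia a i b ha hb; rewrite hsw_scale [RHS]hsw_exchange.
    apply: eq_hsw => i0 a0 i1 a1 ha0 ha1; rewrite hsw_scale [RHS]hsw_exchange.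
    apply: eq_hsw_homog (gh_cop gA hv) _ => j1 v1 j2 v2 hv1 hv2 <-.
    rewrite scalerA sw_hsw ?hsw_scale; last by lin.
    apply: eq_hsw_homog (gh_cop gH hz) _ => iq q l d hq hd <-.
    rewrite sw_hsw; last by lin.
    rewrite (super_QF gA SB _ (gh_mul gA ha1 (sb_act_homog SB hb hv2))); last by lin.
    rewrite !hsw_scale.
    apply: eq_hsw_homog (sb_beta_homog SB hq) _ => m0 c0 m1 c1 hc0 hc1 <-.
    by rewrite /G; sgn.
  rewrite (hcop_assoc4 _ (gh_coalgebra gH)); last by rewrite /G; lin.
  apply: eq_hsw => ia a ir r ha hr; apply: eq_hsw => iz z l d hz hd.
  rewrite hsw_exchange; apply: eq_hsw => i0 a0 i1 a1 ha0 ha1.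
  rewrite hsw_exchange; apply: eq_hsw => j1 v1 j2 v2 hv1 hv2.
  rewrite -(sb_matchF gA SB z (F := fun m0 b0 _ u =>
    (-1) ^+ (l * (j1 + j2) + iz * j1 + i1 * j1 + i1 * m0) *:
    G a0 v1 b0 (amul sA a1 u) d) hv2); last by rewrite /G; lin.
  apply: eq_hsw_homog (gh_cop gH hz) _ => i b iq q hb hq <-.
  apply: eq_hsw => m0 c0 m1 c1 hc0 hc1.
  have [_ AA _ _] := gh_algebra gA; rewrite -AA.
  by sgn.
symmetry; rewrite cop_left cop_right (lin_hsw _ _ (bil_l bst _)).
transitivity (hsw (cop sH x) (fun _ y _ z => hsw (cop sH y) (fun _ a ib b =>
  hsw (cop sH z) (fun iq c l d => hsw (beta a) (fun _ a0 i1 a1 =>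
  hsw (cop sA v) (fun j1 v1 j2 v2 => hsw (beta b) (fun m0 b0 m1 b1 =>
  (-1) ^+ (l * (j1 + j2) + (ib + iq) * j1 + i1 * j1 + i1 * m0) *:
    G a0 v1 b0 (amul sA a1 (amul sA b1 (act c v2))) d))))))).
  apply: eq_hsw => iy y iz z hy hz; rewrite (lin_hsw _ _ (bil_l bst _)).
  transitivity (hsw (cop sH z) (fun iq c l d => hsw (cop sA v) (fun j1 v1 j2 v2 =>
    hsw (beta y) (fun _ y0 i1 y1 => hsw (cop sH y0) (fun ia a0 ib b0 =>
    (-1) ^+ ((i1 + iq + l) * j1 + ib * j1 + l * j2) *:
     G a0 v1 b0 (amul sA y1 (act c v2)) d))))).
    rewrite [RHS]hsw_exchange.
    under [RHS]eq_hsw => j1 v1 j2 v2 hv1 hv2 do rewrite hsw_exchange.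
    rewrite [RHS]hsw_exchange; apply: eq_hsw => i0 y0 i1 y1 hy0 hy1.
    rewrite (lin_hsw _ _ (bil_r bst _)); apply: eq_hsw => j1 v1 j2 v2 hv1 hv2.
    rewrite (stm_pure (one_l hy0) (homog_pure hy1 hz) (one_r hv1) (one_r hv2)).
    rewrite /= mul_right_left mul_pure_left sw_hsw; last by lin.
    rewrite (super_RF gH SB _ hv2); last by lin.
    rewrite (super_RE gH SB _ hv1) (lin_hsw _ _ (bil_r (pure_bilinear _ _) _)).
    rewrite hsw_scale.
    apply: eq_hsw_homog (gh_cop gH hz) _ => iq c l d hc hd <-.
    rewrite (lin_hsw _ _ (bil_l (pure_bilinear _ _) _)) hsw_scale.
    apply: eq_hsw => ia a0 ib b0 ha0 hb0.
    rewrite (linZ _ _ (bil_r (pure_bilinear _ _) _)).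
    rewrite (linZ _ _ (bil_l (pure_bilinear _ _) _)).
    by rewrite /G; sgn.
  rewrite [RHS]hsw_exchange; apply: eq_hsw => iq c l d hc hd.
  under [RHS]eq_hsw => ia a ib b ha hb do rewrite hsw_exchange.
  rewrite [RHS]hsw_exchange; apply: eq_hsw => j1 v1 j2 v2 hv1 hv2.
  rewrite (sb_comodule_cop gA gH SB); last by rewrite /G; lin.
  apply: eq_hsw => ia a ib b ha hb; apply: eq_hsw => i0 a0 i1 a1 ha0 ha1.
  apply: eq_hsw_homog (sb_beta_homog SB hb) _ => m0 b0 m1 b1 hb0 hb1 <-.
  have [_ AA _ _] := gh_algebra gA; rewrite -AA.
  by sgn.
rewrite (hcop_assoc4 _ (gh_coalgebra gH)); last by rewrite /G; lin.
apply: eq_hsw => ia a ir r ha hr; apply: eq_hsw => iz z l d hz hd.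
rewrite hsw_exchange; apply: eq_hsw => i0 a0 i1 a1 ha0 ha1.
rewrite hsw_exchange; apply: eq_hsw => j1 v1 j2 v2 hv1 hv2.
apply: eq_hsw_homog (gh_cop gH hz) _ => i b iq q hb hq <-.
apply: eq_hsw => m0 c0 m1 c1 hc0 hc1.
by sgn.
Qed.

(** For (w ⊗ x)(v ⊗ y), rebracket so that x and v meet, use [cop_right_left] on
    this product, and [cop_left_left] and [cop_right_right] on the outcome. *)
Lemma super_fact_copM s t : copB (mulB s t) = stm (copB s) (copB t).
Proof.
have stA : associative stm.
  apply: (@super_tensor_mulA k B super_fact_str bm).
    by case: super_fact_algebra.
  exact: super_fact_mul_homog.
apply: (tensor_lin_ext (f := fun s => copB (mulB s t))
  (g := fun s => stm (copB s) (copB t))); try lin.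
move=> w x {s}; apply: (tensor_lin_ext (f := fun t => copB (mulB (w ⊗ x) t))
  (g := fun t => stm (copB (w ⊗ x)) (copB t))); try lin.
move=> v y {t}; rewrite (cop_left_right w x) (cop_left_right v y).
rewrite -stA (stA (copB (aone sA ⊗ x))) -cop_right_left.
pose L u := stm (copB (w ⊗ aone sH)) (stm (copB u) (copB (aone sA ⊗ y))).
have lL : linear L by rewrite /L; lin.
rewrite -/(L (R x v)) -[in RHS](sw_id (R x v)) (lin_sw _ _ lL).
rewrite (fact_mul_pure (gh_algebra gA) (gh_algebra gH) bR) (lin_sw _ _ lc).
apply: eq_sw => v' x'; rewrite /L (cop_left_right v' x') cop_left_right.
by rewrite cop_left_left cop_right_right !stA.
Qed.

Let cou_pure w x : fact_cou sA sH (w ⊗ x) = cou sA w * cou sH x.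
Proof. exact: fact_cou_pure (gh_coalgebra gA) (gh_coalgebra gH) w x. Qed.

Lemma super_fact_couM s t :
  fact_cou sA sH (mulB s t) = fact_cou sA sH s * fact_cou sA sH t.
Proof.
have eB : scalar (fact_cou sA sH).
  exact: fact_cou_scalar (gh_coalgebra gA) (gh_coalgebra gH).
have l1 a : linear (fun t => fact_cou sA sH (mulB a t) : k^o).
  exact: (lin_comp (U := k^o) eB (bil_r bm a)).
have l2 b : linear (fun t => fact_cou sA sH (mulB t b) : k^o).
  exact: (lin_comp (U := k^o) eB (bil_l bm b)).
apply: (tensor_lin_ext (U := k^o) (f := fun s => fact_cou sA sH (mulB s t))
  (g := fun s => fact_cou sA sH s * fact_cou sA sH t)) => //.
  exact: (lin_scalel (U := k^o) (fact_cou sA sH t) eB).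
move=> w x {s}; apply: (graded_tensor_lin_ext (U := k^o)
  (f := fun t => fact_cou sA sH (mulB (w ⊗ x) t))
  (g := fun t => fact_cou sA sH (w ⊗ x) * fact_cou sA sH t)) => //.
  exact: (lin_scale (U := k^o) (fact_cou sA sH (w ⊗ x)) eB).
move=> p q v y hv hy {t}; rewrite (fact_mul_pure (gh_algebra gA) (gh_algebra gH) bR).
rewrite (lin_sw (U := tensor OA OH) (U' := k^o) _ _ eB) !cou_pure.
have -> : cou sA w * cou sH x * (cou sA v * cou sH y) =
    (cou sH x) *: (cou sA w * (cou sA v * cou sH y) : k^o).
  by rewrite /GRing.scale /=; ring.
pose c : k^o := cou sA w * (cou sA v * cou sH y).
have lf : linear (fun x : OH => cou sH x *: c).
  exact: (lin_scalel (U := k^o) c eH).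
rewrite -/c -(cou_l x (gh_coalgebra gH) lf).
have bf : is_bilinear (fun (v' : OA) (x' : OH) =>
    fact_cou sA sH (amul sA w v' ⊗ amul sH x' y) : k^o).
  have lt : is_bilinear (fun (v' : OA) (x' : OH) => amul sA w v' ⊗ amul sH x' y).
    lin.
  by split=> ?; apply: (lin_comp (U := k^o) eB); [apply: bil_r lt _ | apply: bil_l lt _].
rewrite sw_hsw // (super_RF gH SB _ hv) //.
rewrite sw_hsw; last by lin.
apply: eq_hsw => i x1 j x2 h1 h2; rewrite cou_pure.
rewrite (super_hopf_couM (gh_super gA)) (super_hopf_couM (gh_super gH)).
rewrite (sb_cou_act SB) /c.
have [op|ep] := boolP (odd p).
  by rewrite (gh_cou_odd gA hv op) !(mulr0, mul0r, scaler0).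
rewrite -signr_odd oddM (negPf ep) andbF scale1r /GRing.scale /=.
ring.
Qed.

Lemma super_fact_antipode : exists S : B -> B,
  antipode super_fact_str S /\ forall p x, has_parity p x -> has_parity p (S x).
Proof.
have [SA [antA evA]] := super_hopf_antipode (gh_super gA).
have [SH [antH evH]] := super_hopf_antipode (gh_super gH).
have lSA : linear SA by case: antA. have lSH : linear SH by case: antH.
exists (fact_antipode sA sH R Q SA SH); split.
  apply: fact_antipodeP => //.
  - exact: gh_algebra gA.
  - exact: gh_algebra gH.
  - exact: gh_coalgebra gA.
  - exact: gh_coalgebra gH.
  - exact: super_fact_algebra.
  - exact: super_fact_coalgebra.
  - exact: super_R1l gH SB.
  - exact: super_R1r gA gH SB.
  - exact: super_Qcou_l gA gH SB.
  - exact: super_Qcou_r gA SB.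
have parP p q (w : OA) (x : OH) : has_parity p w -> has_parity q x ->
    has_parity (V := B) (p (+) q) (w ⊗ x).
  apply: (has_parity_bilinear (X := B) (pure_bilinear _ _)) => i j a b.
  exact: homog_pure.
move=> p t; apply: has_parity_linear.
  apply: conv_linear; [exact: super_fact_coalgebra|exact: super_fact_algebra| |].
    by apply: on_right_linear; [exact: gh_coalgebra gA | lin].
  by apply: on_left_linear; [exact: gh_coalgebra gH | lin].
move=> n {}t ht; rewrite /fact_antipode /conv /=.
have b1 : linear (on_right sA (fun x => aone sA ⊗ SH x)).
  by apply: on_right_linear; [exact: gh_coalgebra gA | lin].
have b2 : linear (on_left sH (fun w => SA w ⊗ aone sH)).
  by apply: on_left_linear; [exact: gh_coalgebra gH | lin].
rewrite (sw_hsw (V := B) (W := B)); last by lin.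
apply: has_parity_hsw (super_fact_cop_homog ht) _ => i a j b ha hb <-.
rewrite oddD; apply: has_parity_bilinear bm super_fact_mul_homog _ _.
  rewrite /on_right sw_hsw; last by lin.
  apply: has_parity_hsw ha _ => i1 w i2 x hw hx <-.
  have [o1|e1] := boolP (odd i1).
    by rewrite (gh_cou_odd gA hw o1) scale0r; apply: has_parity0.
  rewrite oddD (negPf e1); apply: has_parityZ; apply: parP.
    exact: super_hopf_one_even (gh_super gA).
  by apply: evH; apply: homog_has_parity.
rewrite /on_left sw_hsw; last by lin.
apply: has_parity_hsw hb _ => i1 w i2 x hw hx <-.
have [o1|e1] := boolP (odd i2).
  by rewrite (gh_cou_odd gH hx o1) scale0r; apply: has_parity0.
rewrite oddD (negPf e1); apply: has_parityZ; apply: parP.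
  by apply: evA; apply: homog_has_parity.
exact: super_hopf_one_even (gh_super gH).
Qed.

Lemma super_bicross_graded_hopf :
  graded_hopf (V := B) (super_bicross_str sA sH act beta).
Proof.
rewrite super_bicross_strE; split; last 1 first.
- exact: super_fact_cop_homog.
- split.
  + exact: super_fact_algebra.
  + exact: super_fact_coalgebra.
  + move=> p q x y; apply: (has_parity_bilinear bm super_fact_mul_homog).
  + by apply: (homog_has_parity (n := 0)); apply: (homog_pure (gh_one gA) (gh_one gH)).
  + move=> p x; apply: (has_parity_linear (W := gtensor B B) lc) => n y hy.
    by apply: homog_has_parity; apply: super_fact_cop_homog.
  + move=> t pt.
    have eB : scalar (fact_cou sA sH).
      exact: fact_cou_scalar (gh_coalgebra gA) (gh_coalgebra gH).
    rewrite [t]degboundE /= (lin_sum (U := k^o) _ _ eB) big1 // => n _.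
    have [on|no] := boolP (odd n); last first.
      by rewrite pt ?(negPf no) // (lin0 (U := k^o) eB).
    have bc : is_bilinear (fun (w : OA) (x : OH) => cou sA w * cou sH x : k^o).
      by split=> ?; [exact: (lin_scale (U := k^o)) | exact: (lin_scalel (U := k^o))].
    rewrite /fact_cou (sw_hsw _ bc); transitivity (hsw (U := k^o)
      (@hcomp k B n t) (fun _ _ _ _ => 0)); last exact: big1_eq.
    apply: eq_hsw_homog (homog_hcomp (V := B) n t) _ => i w j x hw hx ij.
    move: on; rewrite -ij oddD.
    have [oi _|ei] := boolP (odd i); first by rewrite (gh_cou_odd gA hw oi) mul0r.
    by move=> /= oj; rewrite (gh_cou_odd gH hx oj) mulr0.
  + exact: super_fact_copM.
  + rewrite /= cop_left (super_hopf_cop1 (gh_super gA)).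
    by rewrite (hsw_pure _ (gh_one gA) (gh_one gA)) //; lin.
  + exact: super_fact_couM.
  + by rewrite /= cou_pure (super_hopf_cou1 (gh_super gA))
      (super_hopf_cou1 (gh_super gH)) mulr1.
  + exact: super_fact_antipode.
- exact: (homog_pure (gh_one gA) (gh_one gH)).
- exact: super_fact_mul_homog.
Qed.

End Comultiplication.

(** * The ordinary bicrossproduct *)
Section DegreeZero.
Variable k : fieldType.

(** On graded spaces concentrated in degree 0 all signs are trivial, and the
    super notions coincide with the ordinary ones. *)
Definition in_degree0 (V : gmodType k) : Prop := forall x : V, homog 0 x.

Lemma degree0_homog (V : gmodType k) n (x : V) :
  in_degree0 V -> homog n x -> n = 0%N \/ x = 0.
Proof.
move=> V0 hx; case: n hx => [|n] hx; [by left | right].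
by rewrite -[x](V0 x) (hcomp_homog _ hx).
Qed.

Lemma degree0_tensor (V W : gmodType k) :
  in_degree0 V -> in_degree0 W -> in_degree0 (gtensor V W).
Proof.
move=> V0 W0 t; rewrite -[t]hsw_id; apply: (@homog_sum k (gtensor V W)) => u.
exact: (homog_pure (V0 u.1.2) (W0 u.2.2)).
Qed.

Lemma gsw_degree0 (V W : gmodType k) (U : lmodType k) (t : tensor V W)
    (F : nat -> V -> nat -> W -> U) :
  in_degree0 V -> in_degree0 W -> graded_bilinear F ->
  gsw t F = sw t (fun x y => F 0%N x 0%N y).
Proof.
move=> V0 W0 bF; have b0 := bF 0%N 0%N.
apply: (tensor_lin_ext (f := fun t => gsw t F)
  (g := fun t => sw t (fun x y => F 0%N x 0%N y))).
- exact: gsw_linear.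
- exact: sw_linear.
by move=> x y; rewrite (gsw_homog bF (V0 x) (W0 y)) sw_pure.
Qed.

Lemma degree0_bilinear (V W X : gmodType k) (f : V -> W -> X) :
  in_degree0 V -> in_degree0 W -> in_degree0 X -> is_bilinear f ->
  forall i j x y, homog i x -> homog j y -> homog (i + j) (f x y).
Proof.
move=> V0 W0 X0 bf i j x y hx hy.
have [i0|->] := degree0_homog V0 hx; last by rewrite (lin0 (bil_l bf y)); apply: homog0.
have [j0|->] := degree0_homog W0 hy; last by rewrite (lin0 (bil_r bf x)); apply: homog0.
by rewrite i0 j0.
Qed.

Lemma degree0_linear (V X : gmodType k) (f : V -> X) :
  in_degree0 V -> in_degree0 X -> linear f ->
  forall i x, homog i x -> homog i (f x).
Proof.
move=> V0 X0 lf i x hx.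
by have [->|->] := degree0_homog V0 hx; rewrite ?(lin0 lf) //; apply: homog0.
Qed.

Lemma super_tensor_mul_degree0 (V : gmodType k) (A : alg_str V) (s t : tensor V V) :
  in_degree0 V -> is_bilinear (amul A) -> super_tensor_mul A A s t = tensor_mul A A s t.
Proof.
move=> V0 mA; rewrite /super_tensor_mul gsw_degree0 //; last by lin.
apply: eq_sw => a b; rewrite gsw_degree0 //; last by lin.
by apply: eq_sw => c d; rewrite mul0n scale1r.
Qed.

Lemma graded_hopf_degree0 (V : gmodType k) (H : hopf_str V) :
  in_degree0 V -> hopf_algebra H -> graded_hopf H.
Proof.
move=> V0 hH; have [aH cH cM c1 eM e1 [S aS]] := hH.
have [mH _ _ _] := aH; have [lH eH _ _ _] := cH; have [lS _ _] := aS.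
have VV0 := degree0_tensor V0 V0.
have degM := degree0_bilinear V0 V0 V0 mH.
have degC := degree0_linear V0 VV0 lH.
have degS := degree0_linear V0 V0 lS.
split=> //; split=> //.
- by move=> p q x y; apply: has_parity_bilinear.
- exact: (homog_has_parity (V0 (aone H))).
- move=> p x; apply: (has_parity_linear (W := gtensor V V)) => // n y hy.
  by apply: homog_has_parity; apply: degC.
- by move=> x px; rewrite -[x](V0 x) px // (lin0 (U := k^o) eH).
- by move=> x y; rewrite cM super_tensor_mul_degree0.
- exists S; split=> // p x; apply: has_parity_linear => // n y hy.
  by apply: homog_has_parity; apply: degS.
Qed.

Lemma hopf_degree0 (V : gmodType k) (H : hopf_str V) :
  in_degree0 V -> graded_hopf H -> hopf_algebra H.
Proof.
move=> V0 gH; have [[aH cH _ _ _ _ cM c1 eM e1 [S [aS _]]] _ _ _] := gH.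
split=> //; last by exists S.
move=> x y; rewrite cM super_tensor_mul_degree0 //.
exact: gh_mul_bilinear gH.
Qed.

Section Bicross.
Variables (A H : gmodType k) (sA : hopf_str A) (sH : hopf_str H).
Variables (act : H -> A -> A) (beta : H -> tensor H A).
Hypotheses (A0 : in_degree0 A) (H0 : in_degree0 H).
Hypotheses (hA : hopf_algebra sA) (hH : hopf_algebra sH).
Hypothesis BP : bicrossproduct sA sH act beta.

Let mA : is_bilinear (amul sA). Proof. by case: (hopf_algebra_alg hA). Qed.
Let mH : is_bilinear (amul sH). Proof. by case: (hopf_algebra_alg hH). Qed.
Let mact : is_bilinear act. Proof. by case: (bicross_module BP) => -[]. Qed.
Let lbeta : linear beta. Proof. by case: (bicross_comodule BP) => -[]. Qed.

Lemma super_bicrossproduct_degree0 : super_bicrossproduct sA sH act beta.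
Proof.
have [[modA actM act1] [comH comC cocou] ca cpa b1 bM mt] := BP.
have HA0 := degree0_tensor H0 A0.
split=> //.
- exact: degree0_bilinear.
- split=> // p x a b _; rewrite actM gsw_degree0 //; last by lin.
  by apply: eq_sw => x1 x2; rewrite mul0n scale1r.
- exact: (degree0_linear (X := gtensor H A)).
- split=> // x; rewrite comC; apply: eq_sw => x1 x2.
  rewrite gsw_degree0 //; last by lin.
  apply: eq_sw => x10 x11; rewrite gsw_degree0 //; last by lin.
  by apply: eq_sw => x20 x21; rewrite mul0n scale1r.
- move=> x w; rewrite cpa gsw_degree0 //; last by lin.
  apply: eq_sw => x1 x2; rewrite gsw_degree0 //; last by lin.
  apply: eq_sw => x10 x11; rewrite gsw_degree0 //; last by lin.
  by apply: eq_sw => w1 w2; rewrite muln0 scale1r.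
- move=> x y; rewrite bM gsw_degree0 //; last by lin.
  apply: eq_sw => x1 x2; rewrite gsw_degree0 //; last by lin.
  apply: eq_sw => x10 x11; rewrite gsw_degree0 //; last by lin.
  by apply: eq_sw => w1 w2; rewrite muln0 scale1r.
move=> p x w hw; rewrite -mt gsw_degree0 //; last by lin.
apply: eq_sw => x1 x2; rewrite gsw_degree0 //; last by lin.
by apply: eq_sw => x20 x21; rewrite muln0 scale1r.
Qed.

Lemma super_bicross_str_degree0 :
  super_bicross_str sA sH act beta = bicross_str sA sH act beta.
Proof.
rewrite /super_bicross_str /bicross_str; congr HopfStr.
  congr AlgStr; apply: funext => s; apply: funext => t.
  apply: eq_sw => a h; rewrite gsw_degree0 //; last by lin.
  apply: eq_sw => b g; rewrite gsw_degree0 //; last by lin.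
  by apply: eq_sw => h1 h2; rewrite mul0n scale1r.
congr CoalgStr; apply: funext => t.
apply: eq_sw => a h; rewrite gsw_degree0 //; last by lin.
apply: eq_sw => a1 a2; apply: eq_sw => h1 h2.
rewrite gsw_degree0 //; last by lin.
by apply: eq_sw => h10 h11; rewrite mul0n scale1r.
Qed.

Lemma bicross_degree0_hopf_algebra : hopf_algebra (bicross_str sA sH act beta).
Proof.
rewrite -super_bicross_str_degree0.
apply: (@hopf_degree0 (gtensor A H)); first exact: degree0_tensor.
apply: super_bicross_graded_hopf; last exact: super_bicrossproduct_degree0.
  exact: graded_hopf_degree0.
exact: graded_hopf_degree0.
Qed.

End Bicross.

Definition trivial_hcomp (V : lmodType k) (n : nat) (x : V) : V :=
  if n == 0%N then x else 0.

Lemma trivial_grading (V : lmodType k) : is_grading (@trivial_hcomp V).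
Proof.
split=> [n c x y|m n x|x]; rewrite /trivial_hcomp.
- by case: eqP => // _; rewrite scaler0 addr0.
- by case: m n => [|m] [|n] //=; case: ifP.
- by exists 1%N; rewrite big_ord1.
Qed.

Definition trivial_gmod (V : lmodType k) : gmodType k := GMod (trivial_grading V).

Lemma bicross_hopf_algebra (A H : lmodType k) (sA : hopf_str A)
    (sH : hopf_str H) (act : H -> A -> A) (beta : H -> tensor H A) :
  hopf_algebra sA -> hopf_algebra sH -> bicrossproduct sA sH act beta ->
  hopf_algebra (bicross_str sA sH act beta).
Proof.
exact: (@bicross_degree0_hopf_algebra (trivial_gmod A) (trivial_gmod H)).
Qed.

End DegreeZero.

(** * The differential *)
Section TensorDifferential.
Variables (k : fieldType).

Lemma homog_tensor_lin_ext (V W : gmodType k) (U : lmodType k)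
    (f g : tensor V W -> U) n t :
  linear f -> linear g ->
  (forall i j x y, homog i x -> homog j y -> (i + j)%N = n ->
     f (x ⊗ y) = g (x ⊗ y)) ->
  homog (V := gtensor V W) n t -> f t = g t.
Proof.
move=> lf lg fg ht; rewrite -[t]hsw_id (lin_hsw _ _ lf) (lin_hsw _ _ lg).
by apply: eq_hsw_homog ht _ => i x j y; apply: fg.
Qed.

Definition tensor_d (V W : gmodType k) (dV : V -> V) (dW : W -> W)
    (t : tensor V W) : tensor V W :=
  gsw t (fun i x _ y => dV x ⊗ y + (-1) ^+ i *: (x ⊗ dW y)).

Record differential (V : gmodType k) (d : V -> V) : Prop := Differential {
  differential_linear : linear d;
  differential_degree : forall i x, homog i x -> homog i.+1 (d x);
  differential_square : forall x, d (d x) = 0 }.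

Variables (V W : gmodType k) (dV : V -> V) (dW : W -> W).
Hypotheses (diV : differential dV) (diW : differential dW).
Local Notation D := (tensor_d dV dW).

Let lV := differential_linear diV.
Let lW := differential_linear diW.

Let body_bilinear : graded_bilinear (fun i x (_ : nat) y => dV x ⊗ y + (-1) ^+ i *: (x ⊗ dW y)).
Proof. by lin. Qed.

Lemma tensor_d_linear : linear D.
Proof. exact: gsw_linear. Qed.

Lemma tensor_d_pure i x y : homog i x ->
  D (x ⊗ y) = dV x ⊗ y + (-1) ^+ i *: (x ⊗ dW y).
Proof.
move=> hx; rewrite /tensor_d gsw_hsw //.
rewrite (hsw_pure_l (f := fun i x y => dV x ⊗ y + (-1) ^+ i *: (x ⊗ dW y))
  _ _ hx) //; lin.
Qed.

Lemma tensor_dP : differential (V := gtensor V W) D.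
Proof.
split; first exact: tensor_d_linear.
- move=> n t ht; rewrite /tensor_d gsw_hsw //.
  apply: (homog_hsw (V' := gtensor V W) ht) => i x j y hx hy <-.
  apply: (homogD (V := gtensor V W)).
    by rewrite -addSn; apply: homog_pure => //; apply: (differential_degree diV).
  apply: (homogZ (V := gtensor V W)); rewrite -addnS.
  by apply: homog_pure => //; apply: (differential_degree diW).
have lD := tensor_d_linear.
apply: (graded_tensor_lin_ext (f := fun t => D (D t)) (g := fun=> 0)).
- lin.
- by move=> c x y; rewrite scaler0 addr0.
move=> i j x y hx hy; rewrite (tensor_d_pure _ hx) (linD _ _ lD) (linZ _ _ lD).
rewrite (tensor_d_pure _ (differential_degree diV hx)) (tensor_d_pure _ hx).
rewrite !(differential_square diV) !(differential_square diW).
have [lp rp] := pure_bilinear V W.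
rewrite (lin0 (rp _)) (lin0 (lp _)) scaler0 addr0 add0r -scalerDl.
by rewrite exprS mulN1r addNr scale0r.
Qed.

End TensorDifferential.

Section Differentials.
Variables (k : fieldType) (OA OH : gmodType k) (sA : hopf_str OA) (sH : hopf_str OH).
Variables (act : OH -> OA -> OA) (beta : OH -> tensor OH OA).
Hypotheses (gA : graded_hopf sA) (gH : graded_hopf sH).
Hypothesis SB : super_bicrossproduct sA sH act beta.
Variables (dA : OA -> OA) (dH : OH -> OH).
Hypotheses (diA : differential dA) (diH : differential dH).
Hypotheses
  (dA_leibniz : forall i x y, homog i x ->
    dA (amul sA x y) = amul sA (dA x) y + (-1) ^+ i *: amul sA x (dA y))
  (dH_leibniz : forall i x y, homog i x ->
    dH (amul sH x y) = amul sH (dH x) y + (-1) ^+ i *: amul sH x (dH y))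
  (dA_cop : forall w, cop sA (dA w) = tensor_d dA dA (cop sA w))
  (dH_cop : forall x, cop sH (dH x) = tensor_d dH dH (cop sH x))
  (d_act : forall i x w, homog i x ->
     dA (act x w) = act (dH x) w + (-1) ^+ i *: act x (dA w))
  (d_beta : forall x, beta (dH x) = tensor_d dH dA (beta x)).

Let mA := gh_mul_bilinear gA.
Let mH := gh_mul_bilinear gH.
Let mact : is_bilinear act. Proof. by case: (sb_module SB) => -[]. Qed.
Let ldA := differential_linear diA.
Let degA := differential_degree diA.

Local Notation R := (super_R sH act).
Local Notation Q := (super_Q sA beta).
Local Notation B := (gtensor OA OH).
Let bR := super_R_bilinear gH SB.
Let bQ := super_Q_bilinear gA SB.
Local Notation D := (tensor_d dA dH).
Local Notation mulB := (fact_mul sA sH R).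
Local Notation copB := (fact_cop sA sH Q).
Let lD : linear D := tensor_d_linear diA diH.
Let bm : is_bilinear mulB.
Proof. exact: fact_mul_bilinear (gh_algebra gA) (gh_algebra gH) bR. Qed.
Let lc : linear copB.
Proof. exact: fact_cop_linear (gh_coalgebra gA) (gh_coalgebra gH) bQ. Qed.

Lemma hsw_tensor_d (V W : gmodType k) (dV : V -> V) (dW : W -> W) (U : lmodType k)
    (t : tensor V W) (F : nat -> V -> nat -> W -> U) :
  differential dV -> differential dW -> graded_bilinear F ->
  hsw (tensor_d dV dW t) F =
  hsw t (fun i x j y => F i.+1 (dV x) j y + (-1) ^+ i *: F i x j.+1 (dW y)).
Proof.
move=> diV diW bF; rewrite -{1}[t]hsw_id (lin_hsw _ _ (tensor_d_linear diV diW)).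
rewrite hsw_bind //; apply: eq_hsw => i x j y hx hy.
have lF := hsw_linear bF.
rewrite (tensor_d_pure diV diW _ hx) (linD _ _ lF) (linZ _ _ lF).
rewrite (hsw_pure bF (differential_degree diV hx) hy).
by rewrite (hsw_pure bF hx (differential_degree diW hy)).
Qed.

(** R is a morphism of complexes: Δ and the action commute with d, and x2 picks
    up the same sign when it passes v as in the definition of R. *)
Lemma super_R_d i x v : homog i x ->
  D (R x v) = R (dH x) v + (-1) ^+ i *: R x (dA v).
Proof.
move=> hx; apply: (graded_lin_ext (f := fun v => D (R x v))
  (g := fun v => R (dH x) v + (-1) ^+ i *: R x (dA v))); try lin.
move=> p {}v hv; rewrite !(super_RE gH SB _ hv) (super_RE gH SB _ (degA hv)).
rewrite dH_cop (lin_hsw _ _ lD) hsw_tensor_d //; last by lin.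
rewrite hsw_scale -hsw_add.
apply: eq_hsw_homog (gh_cop gH hx) _ => i1 x1 j x2 h1 h2 <-.
rewrite (linZ _ _ lD) (tensor_d_pure diA diH _ (sb_act_homog SB h1 hv)).
rewrite (d_act _ h1) (linD _ _ (bil_l (pure_bilinear _ _) _)).
rewrite (linZ _ _ (bil_l (pure_bilinear _ _) _)) !scalerDr addrAC.
by congr (_ + _ + _); sgn.
Qed.

Lemma super_Q_d j w x : homog j w ->
  tensor_d dH dA (Q w x) = Q (dA w) x + (-1) ^+ j *: Q w (dH x).
Proof.
move=> hw; have lD' := tensor_d_linear diH diA.
rewrite !(super_QE gA SB _ hw) (super_QE gA SB _ (degA hw)).
rewrite d_beta (lin_hsw _ _ lD') hsw_tensor_d //; last by lin.
rewrite hsw_scale -hsw_add.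
apply: eq_hsw => i x0 l x1 h0 h1.
rewrite (linZ _ _ lD') (tensor_d_pure diH diA _ h0).
rewrite (dA_leibniz _ hw) (linD _ _ (bil_r (pure_bilinear _ _) _)).
rewrite (linZ _ _ (bil_r (pure_bilinear _ _) _)) !scalerDr.
rewrite addrCA; congr (_ + _); first by sgn.
by congr (_ + _); sgn.
Qed.

(** Leibniz rule for w · t · y, where t is a sum of tensors v' ⊗ x' whose first
    factor is multiplied by w and whose second factor is multiplied by y. The
    product of w ⊗ x and v ⊗ y is the case t = R(x,v). *)
Lemma mul_d_middle i1 w y n t : homog i1 w -> homog (V := B) n t ->
  let M w y t := sw t (fun v' x' => amul sA w v' ⊗ amul sH x' y) in
  D (M w y t) = M (dA w) y t + (-1) ^+ i1 *: M w y (D t)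
                + (-1) ^+ (i1 + n) *: M w (dH y) t.
Proof.
move=> hw ht M.
have lM a b : linear (M a b) by rewrite /M; lin.
have Mp a b v x : M a b (v ⊗ x) = amul sA a v ⊗ amul sH x b.
  by rewrite /M sw_pure //; lin.
apply: (homog_tensor_lin_ext (f := fun t => D (M w y t))
  (g := fun t => M (dA w) y t + (-1) ^+ i1 *: M w y (D t)
     + (-1) ^+ (i1 + n) *: M w (dH y) t)) ht.
- exact: lin_comp lD (lM w y).
- apply: lin_add; last exact: lin_scale.
  by apply: lin_add => //; apply: lin_scale; apply: lin_comp (lM w y) lD.
move=> l1 l2 v x hv hx <-.
rewrite (tensor_d_pure diA diH _ hv) (linD _ _ (lM w y)) (linZ _ _ (lM w y)) !Mp.
rewrite (tensor_d_pure diA diH _ (gh_mul gA hw hv)) (dA_leibniz _ hw).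
rewrite (dH_leibniz _ hx) (linD _ _ (bil_l (pure_bilinear _ _) _)).
rewrite (linZ _ _ (bil_l (pure_bilinear _ _) _)).
rewrite (linD _ _ (bil_r (pure_bilinear _ _) _)).
rewrite (linZ _ _ (bil_r (pure_bilinear _ _) _)) !scalerDr !addrA.
by congr (_ + _ + _ + _); sgn.
Qed.

Lemma super_leibniz i s t : homog (V := B) i s ->
  D (mulB s t) = mulB (D s) t + (-1) ^+ i *: mulB s (D t).
Proof.
move=> hs; apply: (homog_tensor_lin_ext (f := fun s => D (mulB s t))
  (g := fun s => mulB (D s) t + (-1) ^+ i *: mulB s (D t))) hs; try lin.
move=> i1 i2 w x hw hx <- {s}.
apply: (graded_tensor_lin_ext (f := fun t => D (mulB (w ⊗ x) t))
  (g := fun t => mulB (D (w ⊗ x)) t + (-1) ^+ (i1 + i2) *: mulB (w ⊗ x) (D t)));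
  try lin.
move=> p q v y hv hy {t}.
pose M w y t := sw t (fun v' x' => amul sA w v' ⊗ amul sH x' y).
have lM a b : linear (M a b) by rewrite /M; lin.
have mM w' x' v' y' : mulB (w' ⊗ x') (v' ⊗ y') = M w' y' (R x' v').
  exact: (fact_mul_pure (gh_algebra gA) (gh_algebra gH) bR).
rewrite mM (mul_d_middle _ hw (super_R_homog gH SB hx hv)).
rewrite (tensor_d_pure diA diH _ hw) (tensor_d_pure diA diH _ hv).
rewrite (linD _ _ (bil_l bm _)) (linZ _ _ (bil_l bm _)).
rewrite (linD _ _ (bil_r bm _)) (linZ _ _ (bil_r bm _)) !mM -/(M _ _ _).
rewrite (super_R_d _ hx) -!/(M _ _ _) (linD _ _ (lM _ _)) (linZ _ _ (lM _ _)).
rewrite !scalerDr !addrA.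
by congr (_ + _ + _ + _); sgn.
Qed.

(** The dual of [mul_d_middle]; the coproduct of w ⊗ x consists of such terms
    with t = Q(w2,x1). *)
Lemma cop_d_middle i1 w y n t : homog i1 w ->
  homog (V := gtensor OH OA) n t ->
  let N w y t := sw t (fun x' w' => (w ⊗ x') ⊗ (w' ⊗ y)) in
  tensor_d (V := B) (W := B) D D (N w y t) = N (dA w) y t
    + (-1) ^+ i1 *: N w y (tensor_d dH dA t) + (-1) ^+ (i1 + n) *: N w (dH y) t.
Proof.
move=> hw ht N.
have diD := tensor_dP diA diH.
have lDD := tensor_d_linear diD diD; have lD' := tensor_d_linear diH diA.
have lN a b : linear (N a b) by rewrite /N; lin.
have Np a b x v : N a b (x ⊗ v) = (a ⊗ x) ⊗ (v ⊗ b).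
  by rewrite /N sw_pure //; lin.
apply: (homog_tensor_lin_ext (f := fun t => tensor_d (V := B) (W := B) D D (N w y t))
  (g := fun t => N (dA w) y t + (-1) ^+ i1 *: N w y (tensor_d dH dA t)
     + (-1) ^+ (i1 + n) *: N w (dH y) t)) ht.
- exact: lin_comp lDD (lN w y).
- apply: lin_add; last exact: lin_scale.
  by apply: lin_add => //; apply: lin_scale; apply: lin_comp (lN w y) lD'.
move=> l1 l2 x v hx hv <-.
rewrite (tensor_d_pure diH diA _ hx) (linD _ _ (lN w y)) (linZ _ _ (lN w y)) !Np.
rewrite (tensor_d_pure diD diD _ (homog_pure hw hx)).
rewrite (tensor_d_pure diA diH _ hw) (tensor_d_pure diA diH _ hv).
rewrite (linD _ _ (bil_l (pure_bilinear _ _) _)).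
rewrite (linZ _ _ (bil_l (pure_bilinear _ _) _)).
rewrite (linD _ _ (bil_r (pure_bilinear _ _) _)).
rewrite (linZ _ _ (bil_r (pure_bilinear _ _) _)) !scalerDr !addrA.
by congr (_ + _ + _ + _); sgn.
Qed.

Lemma super_cop_d t : copB (D t) = tensor_d (V := B) (W := B) D D (copB t).
Proof.
have diD := tensor_dP diA diH; have lDD := tensor_d_linear diD diD.
apply: (graded_tensor_lin_ext (f := fun t => copB (D t))
  (g := fun t => tensor_d (V := B) (W := B) D D (copB t))); try lin.
move=> i j w x hw hx {t}.
pose N (w : OA) (y : OH) (t : tensor OH OA) := sw t (fun x' w' => (w ⊗ x') ⊗ (w' ⊗ y)).
have lN a b : linear (N a b) by rewrite /N; lin.
have Ny a t : linear (fun y => N a y t) by rewrite /N; lin.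
have Nw y t : linear (fun a => N a y t) by rewrite /N; lin.
have cN v y : copB (v ⊗ y) = hsw (cop sA v) (fun _ v1 _ v2 =>
    hsw (cop sH y) (fun _ y1 _ y2 => N v1 y2 (Q v2 y1))).
  rewrite (fact_cop_pure (gh_coalgebra gA) (gh_coalgebra gH) bQ).
  rewrite sw_hsw; last by lin.
  by apply: eq_hsw => a v1 b v2 _ _; rewrite sw_hsw //; lin.
have NQ1 a y b : linear (fun v => N a y (Q v b)) := lin_comp (lN a y) (bil_l bQ b).
have NQ2 a y v : linear (fun b => N a y (Q v b)) := lin_comp (lN a y) (bil_r bQ v).
rewrite (tensor_d_pure diA diH _ hw) (linD _ _ lc) (linZ _ _ lc) !cN.
rewrite dA_cop dH_cop hsw_tensor_d //; last first.
  by move=> ? ?; split=> ?; apply: hsw_lin_in => ? ? ? ?; [apply: NQ1 | apply: Nw].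
rewrite (lin_hsw _ _ lDD) hsw_scale -hsw_add.
apply: eq_hsw_homog (gh_cop gA hw) _ => i1 w1 i2 w2 hw1 hw2 <-.
rewrite hsw_tensor_d //.
rewrite (lin_hsw _ _ lDD) !hsw_scale -!hsw_add.
apply: eq_hsw_homog (gh_cop gH hx) _ => j1 x1 j2 x2 hx1 hx2 _.
rewrite (cop_d_middle _ hw1 (super_Q_homog gA SB hw2 hx1)) -!/(N _ _ _).
rewrite (super_Q_d _ hw2) (linD _ _ (lN _ _)) (linZ _ _ (lN _ _)) !scalerDr !addrA.
by congr (_ + _ + _ + _); sgn.
Qed.

End Differentials.

(** * The exterior algebra structure *)
Section ExteriorTools.
Variable k : fieldType.

(** It suffices to treat pure tensors whose factors have degrees adding up to
    n, so that elements of total degree 0 or 1 fall into very few cases. *)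
Lemma homog_tensor_ind (V W : gmodType k) (P : tensor V W -> Prop) n t :
  P 0 -> (forall s t, P s -> P t -> P (s + t)) ->
  (forall i j x y, homog i x -> homog j y -> (i + j)%N = n -> P (x ⊗ y)) ->
  homog (V := gtensor V W) n t -> P t.
Proof.
move=> P0 PD Pp ht; have [tE th tn] := hdecP t; rewrite tE big_seq.
apply: (big_ind P) => // u ru.
by have [h1 h2] := th u ru; apply: Pp h1 h2 (tn n ht u ru).
Qed.

Lemma strongly_bicovariant_graded_hopf (A : lmodType k) (sA : hopf_str A)
  (O : gmodType k) (E : ext_str A O) : strongly_bicovariant sA E -> graded_hopf E.
Proof.
case=> _ [[_ one mul _ _ _ _] _ _ _ _ _ _ _] super deg _ _.
by split.
Qed.

Section OneExterior.
Variables (A : lmodType k) (sA : alg_str A) (O : gmodType k) (sO : alg_str O).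
Variables (ein : A -> O) (d : O -> O).
Hypothesis EA : exterior_algebra sA sO ein d.

Lemma exterior_differential : differential d.
Proof. by case: EA => -[_ _ _ ld dd d2 _] _ _ _ _ _ _ _. Qed.

Lemma exterior_d_one : d (aone sO) = 0.
Proof.
have [[[_ _ O1l _] h1 _ _ _ _ leib] _ _ _ _ _ _ _] := EA.
have [mO _ _ O1r] := dga_alg (ext_dga EA).
have := leib _ (aone sO) (aone sO) h1; rewrite O1r O1l O1r scale1r.
by move=> E; apply: (addrI (d (aone sO))); rewrite addr0 -E.
Qed.

Lemma homog_inc a : homog 0 (ein a).
Proof. by apply/(ext_deg0 EA); exists a. Qed.

(** The projection to degree 0. Tensor products of retractions are retractions,
    which gives the injectivity of the tensor product of the two inclusions. *)
Lemma exterior_retraction : exists2 p : O -> A, linear p & forall a, p (ein a) = a.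
Proof.
have H w : exists a, hcomp 0 w = ein a.
  by apply/(ext_deg0 EA); apply: homog_hcomp.
pose p w := projT1 (cid (H w)).
have pE w : hcomp 0 w = ein (p w) by rewrite /p; case: cid.
exists p => [c x y|a]; apply: (ext_inc_inj EA).
  rewrite -pE (ext_inc_linear EA) -!pE; exact: lin_hcomp.
by rewrite -pE; apply: homog_inc.
Qed.

End OneExterior.

End ExteriorTools.

Section BicrossExterior.
Variables (k : fieldType) (A H : lmodType k) (sA : hopf_str A) (sH : hopf_str H).
Variables (act : H -> A -> A) (beta : H -> tensor H A).
Variables (OA OH : gmodType k) (EA : ext_str A OA) (EH : ext_str H OH).
Variables (actO : OH -> OA -> OA) (betaO : OH -> tensor OH OA).
Hypotheses (BP : bicrossproduct sA sH act beta).
Hypotheses (sbA : strongly_bicovariant sA EA) (sbH : strongly_bicovariant sH EH).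
Hypothesis SB : super_bicrossproduct EA EH actO betaO.
Hypotheses
  (act_ext : forall h a, actO (einc EH h) (einc EA a) = einc EA (act h a))
  (beta_ext : forall h, betaO (einc EH h) =
     sw (beta h) (fun h0 h1 => einc EH h0 ⊗ einc EA h1)).

Let gA := strongly_bicovariant_graded_hopf sbA.
Let gH := strongly_bicovariant_graded_hopf sbH.
Let exA := sbc_ext sbA.
Let exH := sbc_ext sbH.
Let mA := gh_mul_bilinear gA.
Let mH := gh_mul_bilinear gH.
Let mA0 : is_bilinear (amul sA).
Proof. by case: (hopf_algebra_alg (sbc_hopf sbA)). Qed.
Let mH0 : is_bilinear (amul sH).
Proof. by case: (hopf_algebra_alg (sbc_hopf sbH)). Qed.
Let lA0 : linear (cop sA).
Proof. by case: (hopf_algebra_coalg (sbc_hopf sbA)). Qed.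
Let lH0 : linear (cop sH).
Proof. by case: (hopf_algebra_coalg (sbc_hopf sbH)). Qed.
Let mact : is_bilinear act. Proof. by case: (bicross_module BP) => -[]. Qed.
Let lbeta : linear beta. Proof. by case: (bicross_comodule BP) => -[]. Qed.
Let mactO : is_bilinear actO. Proof. by case: (sb_module SB) => -[]. Qed.
Let liA := ext_inc_linear exA.
Let liH := ext_inc_linear exH.
Let diA := exterior_differential exA.
Let diH := exterior_differential exH.

Local Notation R := (super_R EH actO).
Local Notation Q := (super_Q EA betaO).
Local Notation B := (gtensor OA OH).
Let bR := super_R_bilinear gH SB.
Let bQ := super_Q_bilinear gA SB.
Local Notation mulB := (fact_mul EA EH R).
Local Notation copB := (fact_cop EA EH Q).
Local Notation D := (tensor_d (ediff EA) (ediff EH)).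
Let bm : is_bilinear mulB.
Proof. exact: fact_mul_bilinear (gh_algebra gA) (gh_algebra gH) bR. Qed.
Let lc : linear copB.
Proof. exact: fact_cop_linear (gh_coalgebra gA) (gh_coalgebra gH) bQ. Qed.

Definition tensor_inc (t : tensor A H) : tensor OA OH :=
  sw t (fun a h => einc EA a ⊗ einc EH h).

Lemma tensor_inc_linear : linear tensor_inc.
Proof. by rewrite /tensor_inc; lin. Qed.

Lemma tensor_inc_pure a h : tensor_inc (a ⊗ h) = einc EA a ⊗ einc EH h.
Proof. by rewrite /tensor_inc sw_pure //; lin. Qed.

Lemma tensor_inc_inj : injective tensor_inc.
Proof.
have [pA lpA pAK] := exterior_retraction exA.
have [pH lpH pHK] := exterior_retraction exH.
pose p (t : tensor OA OH) := sw t (fun w x => pA w ⊗ pH x).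
have lp : linear p by rewrite /p; lin.
apply: (can_inj (g := p)) => t; apply: (tensor_lin_ext (f := fun t => p (tensor_inc t))
  (g := fun t => t)); first exact: lin_comp lp tensor_inc_linear.
  by [].
by move=> a h; rewrite tensor_inc_pure /p sw_pure ?pAK ?pHK //; lin.
Qed.

Lemma tensor_inc_homog t : homog (V := B) 0 (tensor_inc t).
Proof.
apply: (@homog_sum k B) => u.
exact: (homog_pure (homog_inc exA u.1) (homog_inc exH u.2)).
Qed.

(** On elements of degree 0 the exchange maps have no signs, and the extended
    action and coaction restrict to the given ones. *)
Lemma super_R_inc h a : R (einc EH h) (einc EA a) =
  sw (cop sH h) (fun h1 h2 => einc EA (act h1 a) ⊗ einc EH h2).
Proof.
rewrite (super_RE gH SB _ (homog_inc exA a)).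
transitivity (sw (cop EH (einc EH h)) (fun x1 x2 => actO x1 (einc EA a) ⊗ x2)).
  rewrite sw_hsw; last by lin.
  by apply: eq_hsw => i x1 j x2 _ _; rewrite muln0 scale1r.
rewrite (sbc_restrict sbH) sw_bind; last by lin.
apply: eq_sw => h1 h2; rewrite sw_pure ?act_ext //; lin.
Qed.

Lemma super_Q_inc a h : Q (einc EA a) (einc EH h) =
  sw (beta h) (fun h0 h1 => einc EH h0 ⊗ einc EA (amul sA a h1)).
Proof.
rewrite (super_QE gA SB _ (homog_inc exA a)).
transitivity (sw (betaO (einc EH h)) (fun x0 x1 => x0 ⊗ amul EA (einc EA a) x1)).
  rewrite sw_hsw; last by lin.
  by apply: eq_hsw => i x1 j x2 _ _; rewrite mul0n scale1r.
rewrite beta_ext sw_bind; last by lin.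
by apply: eq_sw => h1 h2; rewrite sw_pure ?(ext_incM exA) //; lin.
Qed.

Let m0 := amul (bicross_str sA sH act beta).

Lemma tensor_incM s t : tensor_inc (m0 s t) = mulB (tensor_inc s) (tensor_inc t).
Proof.
have li := tensor_inc_linear.
have bm0 : is_bilinear m0 by rewrite /m0 /=; lin.
apply: (tensor_lin_ext (f := fun s => tensor_inc (m0 s t))
  (g := fun s => mulB (tensor_inc s) (tensor_inc t))); try lin.
move=> a h {s}; apply: (tensor_lin_ext (f := fun t => tensor_inc (m0 (a ⊗ h) t))
  (g := fun t => mulB (tensor_inc (a ⊗ h)) (tensor_inc t))); try lin.
move=> b g {t}; rewrite /m0 /= sw_pure; last by lin.
rewrite sw_pure; last by lin.
rewrite (lin_sw _ _ li) !tensor_inc_pure.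
rewrite (fact_mul_pure (gh_algebra gA) (gh_algebra gH) bR) super_R_inc.
rewrite sw_bind; last by lin.
apply: eq_sw => h1 h2; rewrite tensor_inc_pure sw_pure; last by lin.
by rewrite (ext_incM exA) (ext_incM exH).
Qed.

Lemma tensor_inc_cop t : copB (tensor_inc t) =
  sw (cop (bicross_str sA sH act beta) t) (fun s1 s2 => tensor_inc s1 ⊗ tensor_inc s2).
Proof.
have li := tensor_inc_linear.
pose c0 := cop (bicross_str sA sH act beta).
have lc0 : linear c0 by rewrite /c0 /=; lin.
rewrite -/c0; apply: (tensor_lin_ext (f := fun t => copB (tensor_inc t))
  (g := fun t => sw (c0 t) (fun s1 s2 => tensor_inc s1 ⊗ tensor_inc s2))); try lin.
move=> a h; rewrite tensor_inc_pure /c0 /= [in RHS]sw_pure; last by lin.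
rewrite (fact_cop_pure (gh_coalgebra gA) (gh_coalgebra gH) bQ).
rewrite (sbc_restrict sbA) sw_bind; last by lin.
rewrite [RHS]sw_bind; last by lin.
apply: eq_sw => a1 a2; rewrite sw_pure; last by lin.
rewrite (sbc_restrict sbH) sw_bind; last by lin.
rewrite [RHS]sw_bind; last by lin.
apply: eq_sw => h1 h2; rewrite sw_pure; last by lin.
rewrite super_Q_inc sw_bind; last by lin.
rewrite [RHS]sw_bind; last by lin.
apply: eq_sw => h10 h11; rewrite sw_pure; last by lin.
by rewrite sw_pure ?tensor_inc_pure //; lin.
Qed.

Lemma tensor_deg0 t : homog (V := B) 0 t <-> exists s, t = tensor_inc s.
Proof.
split=> [|[s ->]]; last exact: tensor_inc_homog.
have li := tensor_inc_linear.
apply: (homog_tensor_ind (P := fun t => exists s, t = tensor_inc s)) => [|s1 s2 [u1 ->] [u2 ->]|].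
- by exists 0; rewrite (lin0 li).
- by exists (u1 + u2); rewrite (linD _ _ li).
move=> [|i] [|j] w x hw hx // _.
have [a ->] := iffLR (ext_deg0 exA w) hw.
have [h ->] := iffLR (ext_deg0 exH x) hx.
by exists (a ⊗ h); rewrite tensor_inc_pure.
Qed.

Lemma tensor_deg1 t : homog (V := B) 1 t <->
  exists r : seq (tensor A H * tensor A H),
    t = \sum_(u <- r) mulB (tensor_inc u.1) (D (tensor_inc u.2)).
Proof.
pose P t := exists r : seq (tensor A H * tensor A H),
    t = \sum_(u <- r) mulB (tensor_inc u.1) (D (tensor_inc u.2)).
rewrite -/(P t).
have P0 : P 0 by exists [::]; rewrite big_nil.
have PD s1 s2 : P s1 -> P s2 -> P (s1 + s2).
  by move=> [r1 ->] [r2 ->]; exists (r1 ++ r2); rewrite big_cat.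
have Psum I (r : seq I) F : (forall i, P (F i)) -> P (\sum_(i <- r) F i).
  by move=> PF; apply: (big_ind P) => // i _; apply: PF.
have P1 s1 s2 : P (mulB (tensor_inc s1) (D (tensor_inc s2))).
  by exists [:: (s1, s2)]; rewrite big_seq1.
have Dp a x : D (einc EA a ⊗ x) = ediff EA (einc EA a) ⊗ x + einc EA a ⊗ ediff EH x.
  by rewrite (tensor_d_pure diA diH _ (homog_inc exA a)) scale1r.
have [lp rp] := pure_bilinear OA OH.
have D1 x : D (aone EA ⊗ x) = aone EA ⊗ ediff EH x.
  by rewrite -(ext_inc1 exA) Dp (ext_inc1 exA) (exterior_d_one exA) (lin0 (rp _)) add0r.
split; last first.
  move=> [r ->]; apply: (@homog_sum k B) => u; rewrite -(add0n 1%N).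
  apply: (super_fact_mul_homog gA gH SB); first exact: tensor_inc_homog.
  exact: (differential_degree (tensor_dP diA diH)) (tensor_inc_homog _).
have Pl a h h' : P (einc EA a ⊗ amul EH (einc EH h) (ediff EH (einc EH h'))).
  have -> : einc EA a ⊗ amul EH (einc EH h) (ediff EH (einc EH h')) =
      mulB (tensor_inc (a ⊗ h)) (D (tensor_inc (aone sA ⊗ h'))); last exact: P1.
  by rewrite !tensor_inc_pure (ext_inc1 exA) D1 (mul_pure_right gA gH SB).
apply: (homog_tensor_ind (P := P)) => // -[|[|i]] [|[|j]] w x hw hx // _.
- have [a ->] := iffLR (ext_deg0 exA w) hw.
  have [s ->] := iffLR (ext_deg1 exH x) hx.
  by rewrite (lin_sum _ _ (lp _)); apply: Psum => u; apply: Pl.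
have [h ->] := iffLR (ext_deg0 exH x) hx.
have [s ->] := iffLR (ext_deg1 exA w) hw.
rewrite (lin_sum _ _ (rp _)); apply: Psum => -[a b] /=.
(* Only products with differentials on the right are allowed, whence
   (a db) ⊗ h = (a ⊗ 1) d(b ⊗ h) - (a b ⊗ 1) d(1 ⊗ h). *)
have -> : amul EA (einc EA a) (ediff EA (einc EA b)) ⊗ einc EH h =
    mulB (tensor_inc (a ⊗ aone sH)) (D (tensor_inc (b ⊗ h))) +
    mulB (tensor_inc (- (amul sA a b) ⊗ aone sH)) (D (tensor_inc (aone sA ⊗ h))).
  rewrite !tensor_inc_pure Dp (ext_inc1 exA) D1 (ext_inc1 exH).
  rewrite (linD _ _ (bil_r bm _)) !(mul_left_pure gA gH SB).
  have [_ _ _ A1] := gh_algebra gA; rewrite A1.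
  rewrite -scaleN1r (linZ _ _ liA) (linZ _ _ (rp _)) (ext_incM exA) scaleN1r.
  by rewrite addrK.
by apply: PD; apply: P1.
Qed.

Lemma tensor_generated (P : B -> Prop) :
  P (aone EA ⊗ aone EH) ->
  (forall c x y, P x -> P y -> P (c *: x + y)) ->
  (forall x y, P x -> P y -> P (mulB x y)) ->
  (forall x, homog 0 x \/ homog 1 x -> P x) ->
  forall x, P x.
Proof.
move=> P1 PL PM P01.
have [lp rp] := pure_bilinear OA OH.
have PA w : P (w ⊗ aone EH).
  apply: (ext_generated exA (P := fun w => P (w ⊗ aone EH))) => //.
  - by move=> c v v' Pv Pv'; rewrite (rp _); apply: PL.
  - by move=> v v' Pv Pv'; rewrite -(mul_left_pure gA gH SB); apply: PM.
  by move=> v [hv|hv]; apply: P01; [left|right]; apply: (homog_pure hv (gh_one gH)).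
have PH x : P (aone EA ⊗ x).
  apply: (ext_generated exH (P := fun x => P (aone EA ⊗ x))) => //.
  - by move=> c v v' Pv Pv'; rewrite (lp _); apply: PL.
  - by move=> v v' Pv Pv'; rewrite -(mul_pure_right gA gH SB); apply: PM.
  by move=> v [hv|hv]; apply: P01; [left|right]; apply: (homog_pure (gh_one gA) hv).
have P0 : P 0.
  by have := PL (-1) _ _ P1 P1; rewrite scaleN1r addNr.
move=> t; rewrite -[t]sw_id; apply: (big_ind P) => // [x y Px Py|u _].
  by rewrite -[x]scale1r; apply: PL.
rewrite -[u.1 ⊗ u.2](_ : mulB (u.1 ⊗ aone EH) (aone EA ⊗ u.2) = _); first exact: PM.
by rewrite (mul_left_pure gA gH SB); have [_ _ _ ->] := gh_algebra gA.
Qed.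

End BicrossExterior.

Theorem theorem5p1 (k : fieldType)
  (A H : lmodType k) (sA : hopf_str A) (sH : hopf_str H)
  (act : H -> A -> A) (beta : H -> tensor H A)
  (OA OH : gmodType k) (EA : ext_str A OA) (EH : ext_str H OH)
  (actO : OH -> OA -> OA) (betaO : OH -> tensor OH OA) :
  hopf_algebra sA -> hopf_algebra sH ->
  bicrossproduct sA sH act beta ->
  strongly_bicovariant sA EA -> strongly_bicovariant sH EH ->
  (* actO extends act, preserves degrees, and is a super action *)
  (forall h a, actO (einc EH h) (einc EA a) = einc EA (act h a)) ->
  (forall i j x w, homog i x -> homog j w -> homog (i + j)%N (actO x w)) ->
  super_module_algebra EH EA actO ->
  (* betaO extends beta, preserves degrees, and is a super coaction *)
  (forall h, betaO (einc EH h) =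
     sw (beta h) (fun h0 h1 => einc EH h0 ⊗ einc EA h1)) ->
  (forall i x, homog i x -> homog (V := gtensor OH OA) i (betaO x)) ->
  super_comodule_coalgebra EH EA betaO ->
  (forall i x w, homog i x ->
     ediff EA (actO x w) =
     actO (ediff EH x) w + (-1) ^+ i *: actO x (ediff EA w)) ->
  (forall x, betaO (ediff EH x) =
     gsw (betaO x) (fun i x0 _ x1 =>
       ediff EH x0 ⊗ x1 + (-1) ^+ i *: (x0 ⊗ ediff EA x1))) ->
  (forall x w, cou EA (actO x w) = cou EH x * cou EA w) ->
  (forall x w, cop EA (actO x w) =
     gsw (cop EH x) (fun _ x1 i2 x2 =>
     gsw (betaO x1) (fun _ x10 i11 x11 =>
     gsw (cop EA w) (fun j1 w1 _ w2 =>
       (-1) ^+ ((i11 + i2) * j1)%N *: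
         (actO x10 w1 ⊗ amul EA x11 (actO x2 w2)))))) ->
  (forall x y, betaO (amul EH x y) =
     gsw (cop EH x) (fun _ x1 i2 x2 =>
     gsw (betaO x1) (fun _ x10 i11 x11 =>
     gsw (betaO y) (fun j0 y0 _ y1 =>
       (-1) ^+ ((i11 + i2) * j0)%N *:
         (amul EH x10 y0 ⊗ amul EA x11 (actO x2 y1)))))) ->
  (forall p x w, homog p w ->
     gsw (cop EH x) (fun i1 x1 _ x2 =>
     gsw (betaO x2) (fun i20 x20 i21 x21 =>
       (-1) ^+ (p * i21 + i1 * i20)%N *:
         (x20 ⊗ amul EA (actO x1 w) x21)))
     = sw (cop EH x) (fun x1 x2 =>
       sw (betaO x1) (fun x10 x11 =>
         x10 ⊗ amul EA x11 (actO x2 w)))) ->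
  strongly_bicovariant (bicross_str sA sH act beta)
    (super_bicross EA EH actO betaO).
Proof.
move=> hA hH BP sbA sbH act_ext act_deg modO beta_ext beta_deg comO d_act d_beta
  cou_act cop_act betaM match_act.
have gA := strongly_bicovariant_graded_hopf sbA.
have gH := strongly_bicovariant_graded_hopf sbH.
have exA := sbc_ext sbA; have exH := sbc_ext sbH.
have diA := exterior_differential exA; have diH := exterior_differential exH.
have beta1 : betaO (aone EH) = aone EH ⊗ aone EA.
  rewrite -(ext_inc1 exH) beta_ext (bicross_beta1 BP) sw_pure.
    by rewrite (ext_inc1 exH) (ext_inc1 exA).
  have liA := ext_inc_linear exA; have liH := ext_inc_linear exH; lin.
have SB : super_bicrossproduct EA EH actO betaO by split.
have leibA := dga_leibniz (ext_dga exA); have leibH := dga_leibniz (ext_dga exH).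
have diD := tensor_dP diA diH.
have algB := super_fact_algebra gA gH SB.
split.
- exact: bicross_hopf_algebra.
- rewrite /super_bicross (super_bicross_strE gA gH SB); split => /=.
  + split.
    * exact: algB.
    * exact: (homog_pure (gh_one gA) (gh_one gH)).
    * exact: (super_fact_mul_homog gA gH SB).
    * exact: differential_linear diD.
    * exact: differential_degree diD.
    * exact: differential_square diD.
    * move=> i x y; apply: (super_leibniz gA gH SB diA diH leibA leibH) => //.
      exact: (sbc_diff sbH).
  + exact: (tensor_inc_linear sbA sbH).
  + exact: (tensor_inc_inj sbA sbH).
  + rewrite -/(tensor_inc EA EH _) (tensor_inc_pure sbA sbH).
    by rewrite (ext_inc1 exA) (ext_inc1 exH).
  + exact: (tensor_incM BP sbA sbH SB act_ext).
  + exact: (tensor_deg0 sbA sbH).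
  + exact: (tensor_deg1 sbA sbH SB).
  + exact: (tensor_generated sbA sbH SB).
- exact: gh_super (super_bicross_graded_hopf gA gH SB).
- exact: gh_cop (super_bicross_graded_hopf gA gH SB).
- rewrite /super_bicross (super_bicross_strE gA gH SB) /=.
  exact: (tensor_inc_cop BP sbA sbH SB beta_ext).
rewrite /super_bicross (super_bicross_strE gA gH SB) /=.
apply: (super_cop_d gA gH SB diA diH leibA) => //; first exact: (sbc_diff sbA).
exact: (sbc_diff sbH).
Qed.
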